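(* Let $M=\mathbb R^{2n}/\mathbb Z^{2n}$ be the standard symplectic torus with its prequantum line bundle $L$ and the real polarization $P$ spanned by $\partial/\partial y^1,\dots,\partial/\partial y^n$. Suppose $f\in\mathcal C^\infty(M)$ and $N\in\mathbb N$. Then there exists a constant $C_{f,N}>0$ such that for all $k\in\mathbb Z^+$, $s\in\Gamma_P^{-\infty}(M,L^{\otimes k})$ and test section $\tau\in\Gamma(M,(L^* )^{\otimes k})$, $$\left|\left\langle T_{f,k}s-\sum_{r=0}^NT_{f,r,k}s,\ \tau\right\rangle\right|\le C_{f,N}\cdot\|s\|_{\ell^1}\cdot\|\tau\|_{N+1}\cdot\frac1{k^{N+1}}.$$
   Context: $\mathbb N=\{0,1,\dots\}$; functions are complex valued. $M=\mathbb R^{2n}/\mathbb Z^{2n}$ has periodic coordinates $(x^1,\dots,x^n,y^1,\dots,y^n)$ and symplectic form $\omega=2\pi\sum_idx^i\wedge dy^i$. $L$ is the quotient of $\mathbb R^{2n}\times\mathbb C$ by $(\mu,\nu)\cdot(x,y,c)=(x+\mu,y+\nu,e^{2\pi\sqrt{-1}\langle\mu,y\rangle}c)$, $\mu,\nu\in\mathbb Z^n$, with connection induced by $d-2\pi\sqrt{-1}\sum_ix^idy^i$. So smooth sections of $(L^* )^{\otimes k}$ are identified with $\tau\in\mathcal C^\infty(\mathbb R^{2n})$ satisfying $\tau(x+\mu,y+\nu)=e^{-2\pi k\sqrt{-1}\langle\mu,y\rangle}\tau(x,y)$ for $\mu,\nu\in\mathbb Z^n$, and on $L^{\otimes k}$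 and $(L^* )^{\otimes k}$ the covariant derivative along $\partial_{x^i}$ is $\partial/\partial x^i$. For $m\in\mathbb Z^n$ the $m$th Weil--Brezin coefficient of $\tau$ is the Schwartz function $\widetilde\tau_m(x)=\int_{[0,1]^n}e^{2\pi\sqrt{-1}\langle m,y\rangle}\tau(x,y)\,d^ny$ on $\mathbb R^n$; it satisfies $\widetilde\tau_{m+kq}(x)=\widetilde\tau_m(x-q)$ for $q\in\mathbb Z^n$. Distributional sections: $\Gamma^{-\infty}(M,L^{\otimes k})$ is the continuous dual of $\Gamma(M,(L^* )^{\otimes k})$ (smooth sections embedded via $s\mapsto\int_M\tau(s)\,\omega^n/n!$); covariant derivatives and multiplication by functions act in the weak sense, e.g. $\langle\nabla_{\partial_{x^i}}s,\tau\rangle=-\langle s,\nabla_{\partial_{x^i}}\tau\rangle$. $\Gamma_P^{-\infty}(M,L^{\otimes k})$ is the subspace of $s$ with $\nabla_Ys=0$ for all $Y\in\Gamma(M,P)$. It has the basis $\{\sigma_k^{[m]}\}_{[m]\in(\mathbb Z/k\mathbb Z)^n}$ given by $\langle\sigma_k^{[m]},\tau\rangle=\int_{[0,1]^n}e^{2\pi\sqrt{-1}\langle m,y\rangle}\tau(\tfrac mk,y)\,d^ny=\widetilde\tau_m(\tfrac mk)$. Write $f(x,y)=\sum_{p\in\mathbb Z^n}\widehat f_p(x)e^{2\pi\sqrt{-1}\langle p,y\rangle}$. The Toeplitz-type operator $T_{f,k}:\Gamma_P^{-\infty}(M,L^{\otimes k})\to\Gamma_P^{-\infty}(M,L^{\otimes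 k})$ is the linear operator with $$\langle T_{f,k}\sigma_k^{[m]},\tau\rangle=\sum_{p\in\mathbb Z^n}(\widehat f_p\cdot\widetilde\tau_{m+p})\Big(\frac{m+p}k\Big).$$ The operator $T_{f,r,k}:\Gamma^{-\infty}(M,L^{\otimes k})\to\Gamma^{-\infty}(M,L^{\otimes k})$ is the action of the polarized-weight-$r$ component of the Fedosov flat section $\mathbf J_f=\sum_{p,q}\frac1{(p+q)!}\frac{\partial^{p+q}f}{\partial x^{i_1}\cdots\partial x^{i_q}\partial y^{j_1}\cdots\partial y^{j_p}}u^{i_1}\cdots u^{i_q}\check u^{j_1}\cdots\check u^{j_p}$, where $f$-derivative products are symmetrized; this action only involves the terms with $q=0$, $p=r$, with $\check u^j$ acting as $\frac{\sqrt{-1}}{2\pi k}\nabla_{\partial_{x^j}}$, so explicitly $$T_{f,r,k}s=\frac1{r!}\Big(\frac{\sqrt{-1}}{2\pi k}\Big)^r\sum_{1\le i_1,\dots,i_r\le n}\frac{\partial^rf}{\partial y^{i_1}\cdots\partial y^{i_r}}\,\nabla_{\partial_{x^{i_1}}}\cdots\nabla_{\partial_{x^{i_r}}}s.$$ Norms: $\|\tau\|_N=\sup\{|\frac{\partial^r\widetilde\tau_m}{\partial x^{i_1}\cdots\partial x^{i_r}}(x)|:[m]\in(\mathbb Z/k\mathbb Z)^n,\ 0\le r\le N,\ 1\le i_1,\dots,i_r\le n,\ x\in\mathbb R^n\}$, and for $s=\sum_{[m]}s_{[m]}\sigma_k^{[m]}$, $\|s\|_{\ell^1}=\sum_{[m]}|s_{[m]}|$.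 *)

(* Defs.v *)
From HB Require Import structures.
From mathcomp Require Import all_boot all_order all_algebra.
From mathcomp Require Import all_classical all_reals all_analysis.
From mathcomp Require Import complex.
From mathcomp.analysis Require Import showcase.summability.

Set Implicit Arguments.
Unset Strict Implicit.
Unset Printing Implicit Defensive.

Import Order.TTheory GRing.Theory Num.Theory.
Import numFieldNormedType.Exports.

Local Open Scope classical_set_scope.
Local Open Scope ring_scope.

(* R[i] carries no normed R-module structure in the library, so derivatives,
   integrals and sums of complex-valued functions are taken on real and
   imaginary parts.  Moduli are the real numbers [normc z]. *)
Notation normc := ComplexField.Normc.normc.

Section Calculus.
Variable R : realType.

Definition re_fun (T : Type) (g : T -> R[i]) : T -> R := fun z => complex.Re (g z).
Definition im_fun (T : Type) (g : T -> R[i]) : T -> R := fun z => complex.Im (g z).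

Definition cderive (V : normedModType R) (v : V) (g : V -> R[i]) : V -> R[i] :=
  fun z => Complex ('D_v (re_fun g) z) ('D_v (im_fun g) z).

(* C^oo: iterated directional derivatives of all orders are (Frechet)
   differentiable, hence exist and are continuous.  The sequence [vs] is empty
   for [g] itself. *)
Definition smooth (V : normedModType R) (g : V -> R[i]) : Prop :=
  forall (vs : seq V) (z : V),
    differentiable (re_fun (foldr (@cderive V) g vs)) z /\
    differentiable (im_fun (foldr (@cderive V) g vs)) z.

(* The complex number exp(2 pi sqrt(-1) t). *)
Definition expi (t : R) : R[i] := Complex (cos (2 * pi * t)) (sin (2 * pi * t)).

Definition dotr (n : nat) (u v : 'rV[R]_n) : R := \sum_(i < n) u 0 i * v 0 i.

Definition zrow (n : nat) (m : 'rV[int]_n) : 'rV[R]_n := map_mx intr m.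

(* Integral over [0,1]^n, as an iterated Lebesgue integral. *)
Fixpoint cube_int (n : nat) : ('rV[R]_n -> R) -> R :=
  match n with
  | 0 => fun g => g 0
  | n'.+1 => fun g =>
      \int[@lebesgue_measure R]_(t in `[0%R, 1%R]%classic)
        cube_int (fun y : 'rV[R]_n' => g (row_mx (t%:M : 'rV[R]_1) y))
  end.

Definition ccube_int (n : nat) (g : 'rV[R]_n -> R[i]) : R[i] :=
  Complex (cube_int (re_fun g)) (cube_int (im_fun g)).

(* Unconditional sum: limit of the partial sums along the net of finite sets. *)
Definition csum (I : choiceType) (F : I -> R[i]) : R[i] :=
  Complex (@summability.sum I R R^o (re_fun F))
          (@summability.sum I R R^o (im_fun F)).

End Calculus.

Section Torus.
Variables (R : realType) (n : nat).

(* Points (x, y) of the universal cover R^(2n). *)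
Notation V := ('rV[R]_n * 'rV[R]_n)%type.
Notation fct := (V -> R[i]).

Definition dirx (i : 'I_n) : V := (delta_mx 0 i, 0).
Definition diry (j : 'I_n) : V := (0, delta_mx 0 j).
Definition dirxy (d : 'I_n + 'I_n) : V :=
  match d with inl i => dirx i | inr j => diry j end.

Definition dx (i : 'I_n) (g : fct) : fct := cderive (dirx i) g.
Definition dy (j : 'I_n) (g : fct) : fct := cderive (diry j) g.

(* C^oo(M), as Z^(2n)-periodic functions. *)
Definition smooth_on_torus (f : fct) : Prop :=
  smooth f /\
  forall (mu nu : 'rV[int]_n) (z : V),
    f (z.1 + zrow R mu, z.2 + zrow R nu) = f z.

(* Gamma(M, (L^* )^k). *)
Definition test_section (k : nat) (tau : fct) : Prop :=
  smooth tau /\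
  forall (mu nu : 'rV[int]_n) (z : V),
    tau (z.1 + zrow R mu, z.2 + zrow R nu) =
      expi (- (k%:R * dotr (zrow R mu) z.2)) * tau z.

(* Covariant derivatives on (L^* )^k along d/dx^i and d/dy^j.  The connection
   on L being d - 2 pi sqrt(-1) x dy, the one on (L^* )^k is
   d + 2 pi k sqrt(-1) x dy. *)
Definition nabla_x (i : 'I_n) (tau : fct) : fct := dx i tau.
Definition nabla_y (k : nat) (j : 'I_n) (tau : fct) : fct :=
  fun z => dy j tau z + Complex 0 (2 * pi * k%:R * z.1 0 j) * tau z.

(* A distributional section is a functional whose values matter only on test
   sections. *)
Notation functional := (fct -> R[i]).

Definition in_unit_cube (z : V) : Prop :=
  forall i, (0 <= z.1 0 i <= 1) /\ (0 <= z.2 0 i <= 1).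

(* Gamma^{-oo}(M, L^k).  Continuity is for the C^oo topology, given by the
   seminorms max_{|alpha| <= K} sup |d^alpha tau| over the fundamental domain
   [0,1]^(2n); B stands for any upper bound of the K-th seminorm. *)
Definition distribution (k : nat) (s : functional) : Prop :=
  (forall (a : R[i]) (t1 t2 : fct), test_section k t1 -> test_section k t2 ->
     s (fun z => a * t1 z + t2 z) = a * s t1 + s t2) /\
  (exists (C : R) (K : nat), forall (tau : fct) (B : R),
     test_section k tau ->
     (forall (ds : seq ('I_n + 'I_n)) (z : V),
        (size ds <= K)%N -> in_unit_cube z ->
        normc (foldr (fun d => cderive (dirxy d)) tau ds z) <= B) ->
     normc (s tau) <= C * B).

(* Weak action of functions and of covariant derivatives on functionals. *)
Definition mulD (g : fct) (s : functional) : functional :=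
  fun tau => s (fun z => g z * tau z).
Definition nabla_xD (i : 'I_n) (s : functional) : functional :=
  fun tau => - s (nabla_x i tau).
Definition nabla_yD (k : nat) (j : 'I_n) (s : functional) : functional :=
  fun tau => - s (nabla_y k j tau).

(* Gamma_P^{-oo}(M, L^k): nabla_Y s = 0 for all Y = \sum_j a_j d/dy^j. *)
Definition polarized (k : nat) (s : functional) : Prop :=
  distribution k s /\
  forall a : 'I_n -> fct, (forall j, smooth_on_torus (a j)) ->
  forall tau, test_section k tau ->
    \sum_(j < n) mulD (a j) (nabla_yD k j s) tau = 0.

Definition weil_brezin (tau : fct) (m : 'rV[int]_n) : 'rV[R]_n -> R[i] :=
  fun x => ccube_int (fun y => expi (dotr (zrow R m) y) * tau (x, y)).

Definition fourier_y (f : fct) (p : 'rV[int]_n) : 'rV[R]_n -> R[i] :=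
  fun x => ccube_int (fun y => expi (- dotr (zrow R p) y) * f (x, y)).

(* (Z/kZ)^n is encoded by its representatives in {0, ..., k-1}^n; the
   definitions below do not depend on this choice. *)
Definition residues (k : nat) := {ffun 'I_n -> 'I_k}.
Definition rep (k : nat) (m : residues k) : 'rV[int]_n :=
  \row_i Posz (nat_of_ord (m i)).

Definition over (k : nat) (m : 'rV[int]_n) : 'rV[R]_n := k%:R^-1 *: zrow R m.

Definition sigma (k : nat) (m : residues k) : functional :=
  fun tau => weil_brezin tau (rep m) (over k (rep m)).

(* Coordinates of s in the basis (sigma k m)_m of Gamma_P^{-oo}(M, L^k); the
   default 0 is for functionals outside that space. *)
Definition coords (k : nat) (s : functional) : {ffun residues k -> R[i]} :=
  xget 0 [set c : {ffun residues k -> R[i]} |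
    forall tau, test_section k tau -> s tau = \sum_m c m * sigma m tau].

(* T_{f,k}, extended linearly from the basis sigma. *)
Definition toeplitz_sigma (f : fct) (k : nat) (m : residues k) : functional :=
  fun tau => csum (fun p : 'rV[int]_n =>
    fourier_y f p (over k (rep m + p)) * weil_brezin tau (rep m + p) (over k (rep m + p))).
Definition toeplitz (f : fct) (k : nat) (s : functional) : functional :=
  fun tau => \sum_m coords k s m * toeplitz_sigma f m tau.

(* T_{f,r,k}: the j-th fibre coordinate dual to y^j acts as
   sqrt(-1) / (2 pi k) times the covariant derivative along d/dx^j. *)
Definition toeplitz_term (f : fct) (r k : nat) (s : functional) : functional :=
  fun tau => (r`!%:R)^-1 * (Complex 0 (2 * pi * k%:R)^-1) ^+ r *
    \sum_(t : r.-tuple 'I_n) mulD (foldr dy f t) (foldr nabla_xD s t) tau.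

Definition l1norm (k : nat) (s : functional) : R :=
  \sum_m normc (coords k s m).

(* The set is bounded for a test section, so [sup] is a genuine supremum. *)
Definition test_norm (k N : nat) (tau : fct) : R :=
  sup [set a : R | exists (m : residues k) (t : seq 'I_n) (x : 'rV[R]_n),
    (size t <= N)%N /\
    a = normc (foldr (fun i => cderive (delta_mx 0 i)) (weil_brezin tau (rep m)) t x)].

End Torus.

(* Main.v *)
From HB Require Import structures.
Require Import Defs.
From mathcomp Require Import all_boot all_order all_algebra.
From mathcomp Require Import all_classical all_reals all_analysis.
From mathcomp Require Import complex finmap ring lra zify.
From mathcomp.analysis Require Import showcase.summability.

(** Write [m] for an index in [Z^n] and [h_p] for the function
    [x |-> fourier_y f p x * weil_brezin tau (m + p) x] on [R^n]. On the basis
    section of index [m], the Toeplitz operator is the sum over [p] of the values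
    of [h_p] at [(m + p) / k]. The operator of weight [r] is the sum over [p] of
    the Taylor terms of degree [r] of [h_p] at [m / k], for the increment [p / k]:
    a derivative of [f] along [y_j] multiplies its Fourier coefficient by
    [2 pi i p_j], which combines with the factor [i / (2 pi k)] and the sign of
    the weak derivative to give [p_j / k] ([hasum_term]). The difference in the
    theorem is thus a sum over [p] of Taylor remainders of order [N + 1]. Each
    carries [N + 1] factors [p_j / k]; the [p_j] are absorbed into derivatives of
    [f], whose Fourier coefficients decay uniformly in x ([remainder_decay]), and
    the factors coming from [tau] are bounded by its seminorm.

    Two facts about the torus support this. The products of Fourier coefficients
    of [f] with Weil-Brezin coefficients of [tau] sum to the Weil-Brezin
    coefficients of [f tau] ([weil_brezin_product]), which rests on Fourier
    inversion. And a polarized distributional section is a combination of the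
    basis ([coordsP]). It annihilates covariant derivatives along the
    polarization. The average of [tau] over parallel transport around the circle
    in the direction [y_j] differs from [tau] by such a derivative, and
    [theta k j * tau] is itself one, where [theta k j] is the holonomy minus 1. After
    averaging in all directions, a section with vanishing coefficients at the
    points [m / k] is zero on the fibres over those points.

    Both facts reduce to the same division theorem ([division_theorem]): a section
    that vanishes on the fibres over the lattice [(Z / l)^n] is a combination of
    multiples of the functions [expi (l x_j) - 1]. With [l = k] it says that the
    averaged section is annihilated, so that the polarized section depends only
    on finitely many coefficients. With [l = 1], for functions of [y], it turns
    the Fourier series of [f - f (x, y)] into a telescoping one
    ([fourier_inversion]). Division itself is done by moving each
    coordinate towards the nearest lattice point, through a smooth periodic map
    that is locally constant near the lattice: the change is an explicit multiple
    of the function [expi (l x_j) - 1], and the moved section is zero near the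
    lattice fibres, so it can be divided by the sum of the squared moduli. *)

Set Implicit Arguments.
Unset Strict Implicit.
Unset Printing Implicit Defensive.
Import Order.TTheory GRing.Theory Num.Theory.
Import numFieldNormedType.Exports.
Local Open Scope classical_set_scope.
Local Open Scope ring_scope.

(** * Smooth real functions on a normed space *)

Section RealSmooth.
Variable R : realType.
Implicit Types V W : normedModType R.

(** Differentiability of order [r]. Recursion on the order lets every closure
    property be proved by induction for all functions at once; order 0 carries no
    condition, since differentiability at one order gives the continuity at the
    previous one. *)
Fixpoint times_diff V (r : nat) (g : V -> R) : Prop :=
  if r is r'.+1 then
    (forall z, differentiable g z) /\ (forall v, times_diff r' (fun z => 'D_v g z))
  else True.

Definition rsmooth V (g : V -> R) : Prop := forall r, times_diff r g.

Lemma times_diff_ext V r (f g : V -> R) :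
  f =1 g -> times_diff r g -> times_diff r f.
Proof. by move=> /funext ->. Qed.

Lemma rsmooth_ext V (f g : V -> R) : f =1 g -> rsmooth g -> rsmooth f.
Proof. by move=> /funext ->. Qed.

Lemma rsmooth_diff V (g : V -> R) z : rsmooth g -> differentiable g z.
Proof. by move=> /(_ 1%N)[]. Qed.

Lemma rsmooth_derive V (g : V -> R) v : rsmooth g -> rsmooth (fun z => 'D_v g z).
Proof. by move=> h r; have [_] := h r.+1; apply. Qed.

Lemma rsmooth_continuous V (g : V -> R) : rsmooth g -> continuous g.
Proof. by move=> h z; apply: differentiable_continuous; exact: rsmooth_diff. Qed.

Lemma times_diffS V r (g : V -> R) : times_diff r.+1 g -> times_diff r g.
Proof.
elim: r g => [//|r IH] g [d hd]; split=> // v; apply: IH; exact: hd.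
Qed.

Lemma rsmooth_foldr V (g : V -> R) (vs : seq V) :
  rsmooth g -> rsmooth (foldr (fun v h z => 'D_v h z) g vs).
Proof. by move=> hg; elim: vs => //= v vs; exact: rsmooth_derive. Qed.

Lemma rsmoothP V (g : V -> R) :
  (forall vs z, differentiable (foldr (fun v h z => 'D_v h z) g vs) z) <-> rsmooth g.
Proof.
split=> [h r|h vs z]; last by apply: rsmooth_diff; exact: rsmooth_foldr.
elim: r g h => [//|r IH] g h; split; first exact: (h [::]).
by move=> v; apply: IH => vs z; have := h (rcons vs v) z; rewrite foldr_rcons.
Qed.

Lemma re_foldr_cderive V (g : V -> R[i]) vs :
  re_fun (foldr (@cderive R V) g vs) = foldr (fun v h z => 'D_v h z) (re_fun g) vs.
Proof. by elim: vs => //= v vs <-. Qed.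

Lemma im_foldr_cderive V (g : V -> R[i]) vs :
  im_fun (foldr (@cderive R V) g vs) = foldr (fun v h z => 'D_v h z) (im_fun g) vs.
Proof. by elim: vs => //= v vs <-. Qed.

Lemma smoothP V (g : V -> R[i]) :
  smooth g <-> rsmooth (re_fun g) /\ rsmooth (im_fun g).
Proof.
rewrite -!rsmoothP; split=> [h|[h1 h2] vs z].
  by split=> vs z; have := h vs z; rewrite re_foldr_cderive im_foldr_cderive => -[].
by rewrite re_foldr_cderive im_foldr_cderive.
Qed.

Lemma deriveDE V (f g : V -> R) v z :
  differentiable f z -> differentiable g z ->
  'D_v (fun z => f z + g z) z = 'D_v f z + 'D_v g z.
Proof. by move=> df dg; rewrite [LHS]deriveD//; apply: diff_derivable. Qed.

Lemma deriveME V (f g : V -> R) v z :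
  differentiable f z -> differentiable g z ->
  'D_v (fun z => f z * g z) z = f z * 'D_v g z + g z * 'D_v f z.
Proof. by move=> df dg; rewrite [LHS]deriveM//; apply: diff_derivable. Qed.

Lemma deriveNE V (f : V -> R) v z :
  differentiable f z -> 'D_v (fun z => - f z) z = - 'D_v f z.
Proof. by move=> df; rewrite [LHS]deriveN//; apply: diff_derivable. Qed.

Lemma times_diff_cst V r (a : R) : times_diff r (fun _ : V => a).
Proof.
elim: r a => [//|r IH] a; split=> [z|v]; first exact: differentiable_cst.
by apply: times_diff_ext (IH 0) => z; exact: derive_cst.
Qed.

Lemma times_diffD V r (f g : V -> R) :
  times_diff r f -> times_diff r g -> times_diff r (fun z => f z + g z).
Proof.
elim: r f g => [//|r IH] f g [df hf] [dg hg]; split=> [z|v]; first exact: differentiableD.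
by apply: times_diff_ext (IH _ _ (hf v) (hg v)) => z; rewrite deriveDE.
Qed.

Lemma times_diffM V r (f g : V -> R) :
  times_diff r f -> times_diff r g -> times_diff r (fun z => f z * g z).
Proof.
elim: r f g => [//|r IH] f g hf hg.
have /times_diffS hf' := hf; have /times_diffS hg' := hg.
case: hf hg => [df hf] [dg hg].
split=> [z|v]; first exact: differentiableM.
apply: (@times_diff_ext _ _ _ (fun z => f z * 'D_v g z + g z * 'D_v f z)).
  by move=> z; rewrite deriveME.
by apply: times_diffD; apply: IH => //; [exact: hg|exact: hf].
Qed.

Lemma rsmooth_cst V (a : R) : rsmooth (fun _ : V => a).
Proof. by move=> r; exact: times_diff_cst. Qed.

Lemma rsmoothD V (f g : V -> R) :
  rsmooth f -> rsmooth g -> rsmooth (fun z => f z + g z).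
Proof. by move=> hf hg r; exact: times_diffD. Qed.

Lemma rsmoothM V (f g : V -> R) :
  rsmooth f -> rsmooth g -> rsmooth (fun z => f z * g z).
Proof. by move=> hf hg r; exact: times_diffM. Qed.

Lemma rsmoothN V (f : V -> R) : rsmooth f -> rsmooth (fun z => - f z).
Proof.
move=> hf; apply: (@rsmooth_ext _ _ (fun z => (-1) * f z)).
  by move=> z; rewrite mulN1r.
by apply: rsmoothM => //; exact: rsmooth_cst.
Qed.

Lemma rsmoothB V (f g : V -> R) :
  rsmooth f -> rsmooth g -> rsmooth (fun z => f z - g z).
Proof. by move=> hf hg; apply: rsmoothD => //; exact: rsmoothN. Qed.

Lemma rsmooth_sum V (I : finType) (F : I -> V -> R) :
  (forall i, rsmooth (F i)) -> rsmooth (fun z => \sum_i F i z).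
Proof.
move=> hF; elim: (index_enum I) => [|i s IH].
  by under eq_fun do rewrite big_nil; exact: rsmooth_cst.
by under eq_fun do rewrite big_cons; apply: rsmoothD.
Qed.

Lemma rsmooth_prod V (I : finType) (F : I -> V -> R) :
  (forall i, rsmooth (F i)) -> rsmooth (fun z => \prod_i F i z).
Proof.
move=> hF; elim: (index_enum I) => [|i s IH].
  by under eq_fun do rewrite big_nil; exact: rsmooth_cst.
by under eq_fun do rewrite big_cons; apply: rsmoothM.
Qed.

Lemma rsmoothV V (f : V -> R) :
  rsmooth f -> (forall z, f z != 0) -> rsmooth (fun z => (f z)^-1).
Proof.
move=> hf f0; elim=> [//|r IH]; split=> [z|v].
  by apply: differentiableV => //; exact: rsmooth_diff.
apply: (@times_diff_ext _ _ _ (fun z => ((-1) * ((f z)^-1 * (f z)^-1)) * 'D_v f z)).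
  move=> z; rewrite deriveV //; last by apply: diff_derivable; exact: rsmooth_diff.
  by rewrite -invfM -expr2 mulN1r.
apply: times_diffM; last exact: rsmooth_derive.
by apply: times_diffM; [exact: times_diff_cst|exact: times_diffM].
Qed.

(** Substitutions [l z + a z *: w] cover translations, restrictions to lines,
    post-composition by a function of one variable, and the displacement of one
    coordinate by a variable amount. They are closed under this chain rule, so
    smoothness passes through them by induction on the order. *)
Lemma derive_comp_affine V W (G : W -> R) (l : V -> W) (a : V -> R) (w : W) v z :
  differentiable l z -> differentiable a z -> (forall y, differentiable G y) ->
  differentiable (fun z => G (l z + a z *: w)) z /\
  'D_v (fun z => G (l z + a z *: w)) z =
    'D_('D_v l z) G (l z + a z *: w) + 'D_v a z * 'D_w G (l z + a z *: w).
Proof.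
move=> dl da dG.
have dZ : differentiable (fun z => a z *: w) z by exact: differentiableZl.
have dP : differentiable (l + (fun z => a z *: w)) z by exact: differentiableD.
have dC : differentiable (G \o (l + (fun z => a z *: w))) z.
  exact: differentiable_comp.
split; first exact: dC.
rewrite [LHS]deriveE //.
have -> : 'd (fun z => G (l z + a z *: w)) z = 'd (G \o (l + (fun z => a z *: w))) z by [].
rewrite diff_comp //= diffD //= diffZl //= linearD /=.
rewrite !deriveE //.
by rewrite linearZ.
Qed.

Lemma rsmooth_comp V W (G : W -> R) (l : V -> W) (L : V -> W) (a : V -> R) (w : W) :
  (forall z, differentiable l z) -> (forall v z, 'D_v l z = L v) ->
  rsmooth G -> rsmooth a -> rsmooth (fun z => G (l z + a z *: w)).
Proof.
move=> dl Dl hG ha r; elim: r G hG => [//|r IH] G hG.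
have key v z := derive_comp_affine w v (dl z) (rsmooth_diff z ha)
  (fun y => rsmooth_diff y hG).
split=> [z|v]; first exact: (proj1 (key 0 z)).
apply: (@times_diff_ext _ _ _ (fun z =>
   'D_(L v) G (l z + a z *: w) + 'D_v a z * 'D_w G (l z + a z *: w))).
  by move=> z; rewrite (proj2 (key v z)) Dl.
apply: times_diffD; first by apply: (IH (fun y => 'D_(L v) G y)); exact: rsmooth_derive.
apply: times_diffM; first exact: rsmooth_derive.
by apply: (IH (fun y => 'D_w G y)); exact: rsmooth_derive.
Qed.

(** Kept as a predicate on bare functions, so that projections and explicit
    formulas can be used as they are written. *)
Definition clinear V W (l : V -> W) := linear l /\ continuous l.

Lemma clinear_diff V W (l : V -> W) : clinear l ->
  (forall z, differentiable l z) /\ (forall v z, 'D_v l z = l v).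
Proof.
move=> [hl cl].
pose lin : {linear V -> W} := HB.pack l (GRing.isLinear.Build R V W *:%R l hl).
have d z : differentiable lin z by apply: linear_differentiable.
split=> [z|v z]; first exact: d.
by rewrite deriveE; [rewrite (@diff_lin _ _ _ lin)|exact: d].
Qed.

Lemma rsmooth_linear V (l : V -> R) : clinear l -> rsmooth l.
Proof.
move=> /clinear_diff[dl Dl] [//|r]; split=> // v.
by apply: times_diff_ext (times_diff_cst V r (l v)) => z.
Qed.

Lemma rsmooth_affine V W (G : W -> R) (l : V -> W) (c : W) :
  clinear l -> rsmooth G ->
  rsmooth (fun z => G (l z + c)) /\
  forall v, (fun z => 'D_v (fun z => G (l z + c)) z) = (fun z => 'D_(l v) G (l z + c)).
Proof.
move=> /clinear_diff[dl Dl] hG; split.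
  apply: (@rsmooth_ext _ _ (fun z => G (l z + 1 *: c))).
    by move=> z; rewrite scale1r.
  by apply: (rsmooth_comp (a := fun=> 1)) dl Dl _ _ => //; exact: rsmooth_cst.
move=> v; apply/funext => z.
have E : (fun z => G (l z + c)) = (fun z => G (l z + (cst 1) z *: c)).
  by apply/funext => y; rewrite scale1r.
have dcst1 : differentiable (cst 1 : V -> R) z by exact: differentiable_cst.
rewrite E (proj2 (derive_comp_affine c v (dl z) dcst1 (fun y => rsmooth_diff y hG))).
by rewrite Dl derive_cst mul0r addr0 scale1r.
Qed.

Lemma clinear_id V : clinear (@id V).
Proof. by split=> [//|z]; exact: cvg_id. Qed.

Lemma rsmooth_comp1 V (h : R -> R) (a : V -> R) : rsmooth h -> rsmooth a ->
  rsmooth (fun z => h (a z)).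
Proof.
move=> hh ha.
apply: (@rsmooth_ext _ _ (fun z => h ((cst 0) z + a z *: (1:R)))).
  by move=> z; rewrite add0r /GRing.scale /= mulr1.
apply: (@rsmooth_comp V R h (cst 0) (fun=> 0) a 1) => //.
by move=> v z; exact: derive_cst.
Qed.

Lemma derive_comp1 V (h : R -> R) (a : V -> R) v z :
  differentiable a z -> differentiable h (a z) ->
  'D_v (fun z => h (a z)) z = 'D_v a z * 'D_1 h (a z).
Proof.
move=> da dh.
have dC : differentiable (h \o a) z by exact: differentiable_comp.
rewrite [LHS]deriveE // (_ : (fun z => h (a z)) = h \o a) // diff_comp //= !deriveE //.
by rewrite -{1}[X in 'd h _ X]mulr1 linearZ.
Qed.

Lemma derive_dir1 (h : R -> R) v z : differentiable h z -> 'D_v h z = v * 'D_1 h z.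
Proof.
move=> dh; rewrite !deriveE // -{1}[v]mulr1.
by rewrite -[X in 'd h z X]/(v *: (1:R)) linearZ.
Qed.

Lemma times_diff_is_derive r (h h' : R -> R) :
  (forall x : R, is_derive x (1:R) h (h' x)) -> times_diff r h' -> times_diff r.+1 h.
Proof.
move=> dh hh'.
have dd x : differentiable h x by apply/derivable1_diffP; have [] := dh x.
split=> // v; apply: (@times_diff_ext _ _ _ (fun z => v * h' z)).
  move=> z; rewrite derive_dir1 //; congr (_ * _).
  by have := dh z => -[_ ->].
by apply: times_diffM => //; exact: times_diff_cst.
Qed.

Lemma rsmooth_cos_sin : rsmooth (@cos R) /\ rsmooth (@sin R).
Proof.
suff H r : times_diff r (@cos R) /\ times_diff r (@sin R).
  by split=> r; have [] := H r.
elim: r => [//|r [IHc IHs]]; split.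
  apply: (@times_diff_is_derive _ _ (fun x => (-1) * sin x)).
    by move=> x; rewrite mulN1r; exact: is_derive_cos.
  by apply: times_diffM => //; exact: times_diff_cst.
exact: (@times_diff_is_derive _ _ _ (@is_derive_sin R)).
Qed.

End RealSmooth.

(** * Integrals over the unit interval depending on a parameter *)

Section UnitIntegral.
Variable R : realType.
Implicit Types F G : R -> R.

Definition int01 F : R := \int[@lebesgue_measure R]_(t in `[0%R, 1%R]%classic) F t.

Lemma integrable01 F : continuous F ->
  (@lebesgue_measure R).-integrable `[0%R, 1%R]%classic (EFin \o F).
Proof.
move=> cF; apply: continuous_compact_integrable; first exact: segment_compact.
exact: continuous_subspaceT.
Qed.

Lemma eq_int01 F G : (forall t, 0 <= t <= 1 -> F t = G t) -> int01 F = int01 G.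
Proof.
move=> h; apply: eq_Rintegral => t /set_mem /=; rewrite in_itv /=; exact: h.
Qed.

Lemma int01D F G : continuous F -> continuous G ->
  int01 (fun t => F t + G t) = int01 F + int01 G.
Proof. by move=> cF cG; apply: RintegralD => //; exact: integrable01. Qed.

Lemma int01Z F a : continuous F -> int01 (fun t => a * F t) = a * int01 F.
Proof. by move=> cF; apply: RintegralZl => //; exact: integrable01. Qed.

Lemma int01_cst a : int01 (fun=> a) = a.
Proof.
by rewrite /int01 Rintegral_cst //= lebesgue_measure_itv /= lte01 oppr0 adde0 /= mulr1.
Qed.

Lemma int01B F G : continuous F -> continuous G ->
  int01 (fun t => F t - G t) = int01 F - int01 G.
Proof. by move=> cF cG; apply: RintegralB => //; exact: integrable01. Qed.

Lemma int01_sum (I : finType) (F : I -> R -> R) : (forall i, continuous (F i)) ->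
  int01 (fun t => \sum_i F i t) = \sum_i int01 (F i).
Proof.
move=> cF; elim: (index_enum I) => [|i s IH].
  rewrite big_nil -[RHS](int01_cst 0); apply: eq_int01 => t _.
  by rewrite big_nil.
rewrite big_cons -IH -int01D //.
  by apply: eq_int01 => t _; rewrite big_cons.
elim: s {IH} => [|j s IH].
  by under eq_fun do rewrite big_nil; move=> t; exact: cvg_cst.
by under eq_fun do rewrite big_cons; move=> t; apply: cvgD; [exact: cF|exact: IH].
Qed.

Lemma int01_le F M : continuous F -> (forall t, 0 <= t <= 1 -> `|F t| <= M) ->
  `|int01 F| <= M.
Proof.
move=> cF hM.
have cN : continuous (fun t => `|F t|).
  by move=> t; apply: cvg_norm; exact: cF.
apply: (le_trans (le_normr_Rintegral _ (integrable01 cF))); first by [].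
rewrite -[leRHS](int01_cst M); apply: le_Rintegral => //; first exact: integrable01.
by apply: integrable01 => t; exact: cvg_cst.
Qed.

Lemma int01_ftc F f : (forall t : R, is_derive t (1:R) F (f t)) -> continuous f ->
  int01 f = F 1 - F 0.
Proof.
move=> dF cf.
have cF : continuous F.
  move=> t; apply: differentiable_continuous; apply/derivable1_diffP.
  by have [] := dF t.
rewrite /int01 /Rintegral (@continuous_FTC2 _ _ F) //.
- exact: continuous_subspaceT.
- split; first by move=> x _; have [] := dF x.
    by apply: cvg_at_right_filter; exact: cF.
  by apply: cvg_at_left_filter; exact: cF.
- by move=> x _; rewrite derive1E; have := dF x => -[_ ->].
Qed.

End UnitIntegral.

Section ParametricIntegral.
Variable R : realType.
Variable V : normedModType R.

(** Coordinates bounded by the norm are all that finite dimension contributes to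
    differentiation under the integral sign. *)
Definition frame (I : finType) (e : I -> V) (c : I -> V -> R) :=
  [/\ forall u, u = \sum_i c i u *: e i,
      forall i u, `|c i u| <= `|u| & forall i, linear (c i : V -> R^o)].

(** By compactness of the interval, the modulus of continuity in [z] can be chosen
    uniformly in the parameter. *)
Lemma near_uniform01 (H : V * R -> R) (z : V) (eps : R) : continuous H -> 0 < eps ->
  exists2 d : R, 0 < d & forall h t, `|h| < d -> 0 <= t <= 1 ->
    `|H (z + h, t) - H (z, t)| <= eps.
Proof.
move=> cH e0.
have /compact_near_coveringP cov := @segment_compact R 0 1.
suff /(cov V (nbhs (0:V)) (fun h t => `|H (z + h, t) - H (z, t)| <= eps) _)
    /nbhs_ballP[d /= d0 hd] : forall x : R, `[0, 1]%classic x ->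
    \forall x' \near x & i \near (0:V), `|H (z + i, x') - H (z, x')| <= eps.
  exists d => // h t hh ht; apply: hd => //=.
  by rewrite -ball_normE /= sub0r normrN.
move=> t _.
  pose D (p : R * V) := H (z + p.2, p.1) - H (z, p.1).
  have cp1 : {for (t, 0), continuous (fun p : R * V => (z + p.2, p.1))}.
    apply: (@cvg_pair _ _ _ _ (nbhs (z + 0)) (nbhs t)); last exact: cvg_fst.
    by apply: cvgD; [exact: cvg_cst|exact: cvg_snd].
  have cp2 : {for (t, 0), continuous (fun p : R * V => (z, p.1))}.
    by apply: (@cvg_pair _ _ _ _ (nbhs z) (nbhs t)); [exact: cvg_cst|exact: cvg_fst].
  have cD : {for (t, 0), continuous D}.
    exact: continuousB (continuous_comp cp1 (cH _)) (continuous_comp cp2 (cH _)).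
  move/cvgrPdist_le : cD => /(_ eps e0).
  rewrite /D /= addr0 subrr; apply: filterS => -[t' h] /=.
  by rewrite sub0r normrN.
Qed.

(** The differential is defined by choice among linear maps; a first-order
    expansion pins it down. *)
Lemma differentiable_expansion (f : V -> R) (x : V) (L : {linear V -> R^o}) :
  continuous L ->
  (forall eps, 0 < eps -> \forall h \near (0:V), `|f (h + x) - f x - L h| <= eps * `|h|) ->
  differentiable f x /\ forall v, 'D_v f x = L v.
Proof.
move=> cL hf.
have E : f \o shift x = cst (f x) + L +o_ 0 id.
  apply/eqaddoP => _/posnumP[eps]; apply: filterS (hf _ (gt0 eps)) => h /=.
  by rewrite !fctE /= opprD addrA.
have d : differentiable f x.
  by apply/diff_locallyP; rewrite (diff_unique cL E).
by split=> // v; rewrite deriveE // (diff_unique cL E).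
Qed.

Variables (I : finType) (e : I -> V) (c : I -> V -> R).
Hypothesis hfr : frame e c.

Definition pint (K : V * R -> R) (z : V) : R := int01 (fun t => K (z, t)).

Lemma continuous_pair1 (K : V * R -> R) z : continuous K -> continuous (fun t => K (z, t)).
Proof.
move=> cK t; have cp : {for t, continuous (fun t : R => (z, t))}.
  by apply: (@cvg_pair _ _ _ _ (nbhs z) (nbhs t)); [exact: cvg_cst|exact: cvg_id].
exact: (continuous_comp cp (cK _)).
Qed.

Lemma derive_frame (K : V * R -> R) v p : differentiable K p ->
  'D_(v, 0) K p = \sum_i c i v * 'D_(e i, 0) K p.
Proof.
move=> dK; have [hs _ _] := hfr; rewrite deriveE //.
under eq_bigr do rewrite deriveE //.
have -> : (v, 0) = \sum_i c i v *: (e i, 0) :> V * R.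
  rewrite [v in LHS]hs -[LHS]/(_, _).
  elim: (index_enum I) => [|i s IH]; first by rewrite !big_nil.
  by rewrite !big_cons -IH; congr (_, _) => /=; rewrite scaler0 addr0.
by rewrite linear_sum; apply: eq_bigr => i _; rewrite linearZ.
Qed.

Lemma derive_line (K : V * R -> R) (z h : V) (t s : R) : rsmooth K ->
  is_derive s (1:R) (fun s => K (z + s *: h, t)) ('D_(h, 0) K (z + s *: h, t)).
Proof.
move=> sK.
have E : (fun s => K (z + s *: h, t)) =
    (fun s => K ((cst (z, t) : R -> V * R) s + (id s) *: ((h, 0) : V * R))).
  by apply/funext => y; congr K; congr (_, _); rewrite /= scaler0 addr0.
have dcst : differentiable (cst (z, t) : R -> V * R) s by exact: differentiable_cst.
have did : differentiable (id : R -> R) s.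
  by apply/derivable1_diffP; exact: derivable_id.
have [d D] := derive_comp_affine (h, 0) (1 : R) dcst did (fun y => rsmooth_diff y sK).
rewrite E; apply: DeriveDef; first by apply/derivable1_diffP.
have P : cst (z, t) s + id s *: ((h, 0) : V * R) = (z + s *: h, t).
  by congr (_, _) => /=; rewrite scaler0 addr0.
have D0 : 'D_1 (cst (z, t) : R -> V * R) s = 0 by exact: derive_cst.
have D1 : 'D_1 (id : R -> R) s = 1 by exact: derive_id.
by rewrite D D0 D1 P mul1r [X in X + _]derive0 add0r.
Qed.

(** Differentiation under the integral sign. By the mean value theorem the increment
    of [K] in [z] is its differential at an intermediate point; the finitely many
    partial derivatives there are uniformly close, over the parameter, to those at
    [z]. This yields Frechet differentiability at once. *)
Lemma pint_diff (K : V * R -> R) z : rsmooth K ->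
  differentiable (pint K) z /\
  forall v, 'D_v (pint K) z = pint (fun p => 'D_(v, 0) K p) z.
Proof.
move=> sK; have [hs hb hl] := hfr.
pose Ki i p := 'D_(e i, 0) K p.
have cKi i : continuous (Ki i) by apply: rsmooth_continuous; exact: rsmooth_derive.
have cK := rsmooth_continuous sK.
pose L v : R^o := pint (fun p => 'D_(v, 0) K p) z.
have LE v : L v = \sum_i c i v * pint (Ki i) z.
  rewrite /L /pint.
  rewrite (_ : int01 _ = int01 (fun t => \sum_i c i v * Ki i (z, t))); last first.
    by apply: eq_int01 => t _; apply: derive_frame; exact: rsmooth_diff.
  rewrite int01_sum.
    by apply: eq_bigr => i _; rewrite int01Z //; exact: continuous_pair1.
  move=> i t; apply: cvgM; first exact: cvg_cst.
  exact: (@continuous_pair1 (Ki i)).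
have lL : linear L.
  move=> a u v; rewrite !LE scaler_sumr -big_split /=; apply: eq_bigr => i _.
  by rewrite hl mulrDl -!mulrA.
pose LL : {linear V -> R^o} := HB.pack L (GRing.isLinear.Build R V R^o *:%R L lL).
have cL : continuous LL.
  apply: bounded_linear_continuous.
  apply/linear_boundedP.
  exists (\sum_i `|pint (Ki i) z|); split; first exact: num_real.
  move=> M hM v.
  have : L v = LL v by [].
  rewrite LE => <-; apply: (le_trans (ler_norm_sum _ _ _)).
  apply: (@le_trans _ _ (\sum_i `|pint (Ki i) z| * `|v|)).
    by apply: ler_sum => i _; rewrite normrM mulrC ler_wpM2l.
  by rewrite -mulr_suml ler_wpM2r // ltW.
apply: (differentiable_expansion cL) => eps e0.
(* Each partial derivative contributes at most [eps / N]; the added 1 keeps [N]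
   positive when there is none. *)
pose N : R := #|I|%:R + 1.
have N0 : 0 < N by rewrite ltr_wpDl.
have /choice [d hd] : forall i, exists d : R, 0 < d /\ forall h t, `|h| < d -> 0 <= t <= 1 ->
    `|Ki i (z + h, t) - Ki i (z, t)| <= eps / N.
  by move=> i; have [d d0 h] := @near_uniform01 (Ki i) z (eps / N) (cKi i) (divr_gt0 e0 N0); exists d.
near=> h.
have hh : forall i, `|h| < d i.
  by near: h; apply: filter_forall => i; apply: nbhs0_lt; have [] := hd i.
have -> : pint K (h + z) - pint K z - LL h =
    int01 (fun t => K (z + h, t) - K (z, t) - 'D_(h, 0) K (z, t)).
  have cD : continuous (fun t => 'D_(h, 0) K (z, t)).
    apply: (@continuous_pair1 (fun p => 'D_(h, 0) K p)).
    by apply: rsmooth_continuous; exact: rsmooth_derive.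
  rewrite int01B //; last first.
    by move=> t; apply: cvgB; exact: continuous_pair1.
  by rewrite int01B ?[z + h]addrC //; exact: continuous_pair1.
apply: int01_le.
  move=> t; apply: cvgB; last first.
    apply: (@continuous_pair1 (fun p => 'D_(h, 0) K p)).
    by apply: rsmooth_continuous; exact: rsmooth_derive.
  by apply: cvgB; exact: continuous_pair1.
move=> t ht.
have [|xi xi01 /=] := @MVT R (fun s => K (z + s *: h, t)) (fun s => 'D_(h, 0) K (z + s *: h, t)) 0 1 ltr01
  (fun s _ => derive_line z h t s sK).
  apply: continuous_subspaceT => s; apply: differentiable_continuous.
  by apply/derivable1_diffP; have [] := derive_line z h t s sK.
rewrite scale1r scale0r addr0 subr0 mulr1 => ->.
rewrite !derive_frame; try exact: rsmooth_diff.
rewrite -sumrB; apply: (le_trans (ler_norm_sum _ _ _)).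
apply: (@le_trans _ _ (\sum_(i : I) (eps / N) * `|h|)).
  apply: ler_sum => i _; rewrite -mulrBr normrM mulrC ler_pM //.
  have [_] := hd i; apply => //.
  apply: le_lt_trans (hh i); rewrite normrZ ler_piMl //.
  by move: xi01; rewrite in_itv /= => /andP[h0 h1]; rewrite ger0_norm ltW.
rewrite sumr_const -mulr_natl mulrA ler_wpM2r // mulrCA ger_pMr //.
by rewrite ler_pdivrMr // mul1r /N lerDl.
Unshelve. all: by end_near. Qed.

Lemma rsmooth_pint (K : V * R -> R) : rsmooth K -> rsmooth (pint K).
Proof.
move=> hK r; elim: r K hK => [//|r IH] K hK; split=> [z|v].
  by have [] := pint_diff z hK.
apply: times_diff_ext (IH _ (rsmooth_derive (v, 0) hK)) => z.
by have [_ ->] := pint_diff z hK.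
Qed.

End ParametricIntegral.

(** * A function flat at the origin *)

Section FlatFunction.
Variable R : realType.

(** The derivative of a function of this family is a combination of two others, so
    that all of them are smooth together. *)
Definition flatn (j : nat) (t : R) : R :=
  if 0 < t then t^-1 ^+ j * expR (- t^-1) else 0.

(** A single term of the exponential series at [1/t] beats [t^-j] with a factor
    [t^2] to spare. *)
Lemma flatn_le j (t : R) : 0 < t -> `|flatn j t| <= (j.+2)`!%:R * t ^+ 2.
Proof.
move=> t0; rewrite /flatn t0 expRN.
have u0 : 0 < t^-1 by rewrite invr_gt0.
rewrite ger0_norm; last by rewrite mulr_ge0 ?exprn_ge0 ?invr_ge0 ?expR_ge0 // ltW.
rewrite ler_pdivrMr ?expR_gt0 //.
have h : t^-1 ^+ j.+2 / (j.+2)`!%:R <= expR t^-1.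
  by apply: le_trans (expR_ge1Dxn j.+1 (ltW u0)); rewrite lerDr.
have f0 : 0 < (j.+2)`!%:R :> R by rewrite ltr0n fact_gt0.
apply: (@le_trans _ _ ((j.+2)`!%:R * t ^+ 2 * (t^-1 ^+ j.+2 / (j.+2)`!%:R))).
  rewrite le_eqVlt; apply/orP; left; apply/eqP.
  rewrite !exprS expr0 mulr1; move: f0; move: (_%:R) (t^-1 ^+ j) => a b a0.
  by field; rewrite !gt_eqF.
by rewrite ler_wpM2l // mulr_ge0 // sqr_ge0.
Qed.

Lemma is_derive_flatn j (t : R) :
  is_derive t (1:R) (flatn j) ((- j%:R) * flatn j.+1 t + flatn j.+2 t).
Proof.
have [t0|t0|->] := ltgtP t 0.
- have -> : - j%:R * flatn j.+1 t + flatn j.+2 t = 0.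
    by rewrite /flatn ltNge ltW //= mulr0 addr0.
  apply: (near_eq_is_derive (f := cst 0)).
  near=> x; have x0 : x < 0 by near: x; exact: lt_nbhsl.
  by rewrite /flatn ltNge ltW.
- have tn0 : t != 0 by rewrite gt_eqF.
  have dV : is_derive t (1:R) (fun x : R => x^-1) (- (t ^- 2)).
    apply: DeriveDef; first exact: derivableV.
    by rewrite deriveV // derive_id scaler1.
  have dE : is_derive t (1:R) (fun x : R => expR (- x^-1)) (t ^- 2 * expR (- t^-1)).
    have dN : is_derive t (1:R) (fun x : R => - x^-1) (t ^- 2).
      by rewrite -[t ^- 2]opprK; exact: is_deriveN.
    rewrite mulrC.
    exact: (is_derive1_comp (f := expR) (g := fun x : R => - x^-1)).
  have dX : is_derive t (1:R) (fun x : R => x^-1 ^+ j) (- (j%:R * t^-1 ^+ j.+1)).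
    case: j => [|j].
      rewrite mul0r oppr0; under eq_fun do rewrite expr0.
      by apply: DeriveDef; [exact: derivable_cst|exact: derive_cst].
    have -> : (fun x : R => x^-1 ^+ j.+1) = (fun x : R => x^-1) ^+ j.+1.
      by apply/funext => x; rewrite exprfctE.
    have dXj := is_deriveX j.+1 dV.
    apply: is_derive_eq dXj _.
    by rewrite /GRing.scale /= mulrN -mulrA -[t ^- 2]exprVn -exprD addn2.
  have dM : is_derive t (1:R) (fun x : R => x^-1 ^+ j * expR (- x^-1))
     (- j%:R * flatn j.+1 t + flatn j.+2 t).
    apply: is_derive_eq; rewrite /flatn t0 /GRing.scale /= -exprVn.
    by rewrite !exprS; ring.
  apply: near_eq_is_derive dM.
  near=> x; have x0 : 0 < x by near: x; exact: lt_nbhsr.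
  by rewrite /flatn x0.
have -> : - j%:R * flatn j.+1 0 + flatn j.+2 0 = 0 :> R.
  by rewrite /flatn ltxx mulr0 addr0.
have cz : continuous (\0 : {linear R -> R^o}) by move=> x; exact: cvg_cst.
have [|d D] := @differentiable_expansion R R (flatn j) 0 \0 cz; last first.
  by apply: DeriveDef; [apply/derivable1_diffP|rewrite D].
move=> eps e0; near=> h; rewrite addr0 /= subr0 {2}/flatn ltxx subr0.
have [h0|h0] := leP h 0; first by rewrite /flatn ltNge h0 /= normr0 mulr_ge0 // ltW.
apply: (le_trans (flatn_le _ h0)).
rewrite expr2 mulrA (gtr0_norm h0) (ler_wpM2r (ltW h0)) //.
rewrite mulrC -ler_pdivlMr ?ltr0n ?fact_gt0 //.
by near: h; apply: nbhs0_ltW; rewrite divr_gt0 // ltr0n fact_gt0.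
Unshelve. all: by end_near. Qed.

Lemma rsmooth_flatn j : rsmooth (flatn j).
Proof.
move=> r; elim: r j => [//|r IH] j.
apply: times_diff_is_derive (is_derive_flatn j) _.
apply: times_diffD => //; apply: times_diffM => //; exact: times_diff_cst.
Qed.

Definition flat := flatn 0.

Lemma flat_gt0 t : 0 < t -> 0 < flat t.
Proof. by move=> t0; rewrite /flat /flatn t0 expr0 mul1r expR_gt0. Qed.

Lemma flat_le0 t : t <= 0 -> flat t = 0.
Proof. by move=> t0; rewrite /flat /flatn ltNge t0. Qed.

Lemma flat_ge0 t : 0 <= flat t.
Proof. by have [/flat_le0->//|/flat_gt0/ltW] := leP t 0. Qed.

End FlatFunction.

(** * Smooth complex-valued functions *)

Section ComplexFacts.
Variable R : realType.
Implicit Types (x y : R[i]).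

Lemma Re_add x y : complex.Re (x + y) = complex.Re x + complex.Re y.
Proof. by case: x y => [a b] [c d]. Qed.
Lemma Im_add x y : complex.Im (x + y) = complex.Im x + complex.Im y.
Proof. by case: x y => [a b] [c d]. Qed.
Lemma Re_opp x : complex.Re (- x) = - complex.Re x.
Proof. by case: x. Qed.
Lemma Im_opp x : complex.Im (- x) = - complex.Im x.
Proof. by case: x. Qed.
Lemma Re_mul x y :
  complex.Re (x * y) = complex.Re x * complex.Re y - complex.Im x * complex.Im y.
Proof. by case: x y => [a b] [c d]. Qed.
Lemma Im_mul x y :
  complex.Im (x * y) = complex.Re x * complex.Im y + complex.Im x * complex.Re y.
Proof. by case: x y => [a b] [c d]. Qed.

Lemma complex_ext x y :
  complex.Re x = complex.Re y -> complex.Im x = complex.Im y -> x = y.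
Proof. by case: x y => [a b] [c d] /= -> ->. Qed.

Lemma Re_sum (I : Type) (s : seq I) (P : pred I) (F : I -> R[i]) :
  complex.Re (\sum_(i <- s | P i) F i) = \sum_(i <- s | P i) complex.Re (F i).
Proof.
elim: s => [|i s IH]; first by rewrite !big_nil.
by rewrite !big_cons; case: ifP => _; rewrite ?Re_add IH.
Qed.

Lemma Im_sum (I : Type) (s : seq I) (P : pred I) (F : I -> R[i]) :
  complex.Im (\sum_(i <- s | P i) F i) = \sum_(i <- s | P i) complex.Im (F i).
Proof.
elim: s => [|i s IH]; first by rewrite !big_nil.
by rewrite !big_cons; case: ifP => _; rewrite ?Im_add IH.
Qed.

Lemma normcE x : (normc x)%:C%C = `|x|.
Proof. by case: x. Qed.

Lemma normc_ge0 x : 0 <= normc x.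
Proof. by case: x => a b; exact: sqrtr_ge0. Qed.

Lemma le_normcD x y : normc (x + y) <= normc x + normc y.
Proof. by rewrite -lecR rmorphD /= !normcE ler_normD. Qed.

Lemma normcN x : normc (- x) = normc x.
Proof. by apply: complexI; rewrite !normcE normrN. Qed.

Lemma le_normcB x y : normc (x - y) <= normc x + normc y.
Proof. by rewrite -(normcN y) le_normcD. Qed.

Lemma normc0 : normc (0 : R[i]) = 0.
Proof. exact: ComplexField.Normc.normc0. Qed.

Lemma normc1 : normc (1 : R[i]) = 1.
Proof. exact: ComplexField.Normc.normc1. Qed.

Lemma normcM x y : normc (x * y) = normc x * normc y.
Proof. exact: ComplexField.Normc.normcM. Qed.

Lemma normcX x r : normc (x ^+ r) = normc x ^+ r.
Proof.
by elim: r => [|r IH]; rewrite ?expr0 ?normc1 // !exprS normcM IH.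
Qed.

Lemma normcV x : normc x^-1 = (normc x)^-1.
Proof. exact: ComplexField.Normc.normcV. Qed.

Lemma normc_real (a : R) : normc (Complex a 0) = `|a|.
Proof. by rewrite /normc expr0n /= addr0 sqrtr_sqr. Qed.

Lemma normc_imag (a : R) : normc (Complex 0 a) = `|a|.
Proof. by rewrite /normc expr0n /= add0r sqrtr_sqr. Qed.

Lemma le_normc_sum (I : Type) (s : seq I) (P : pred I) (F : I -> R[i]) :
  normc (\sum_(i <- s | P i) F i) <= \sum_(i <- s | P i) normc (F i).
Proof.
elim: s => [|i s IH]; first by rewrite !big_nil normc0.
rewrite !big_cons; case: ifP => _ //.
by apply: (le_trans (le_normcD _ _)); rewrite lerD2l.
Qed.

Lemma Re_le_normc x : `|complex.Re x| <= normc x.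
Proof.
case: x => a b /=; rewrite -sqrtr_sqr ler_sqrt ?addr_ge0 ?sqr_ge0 //.
by rewrite lerDl sqr_ge0.
Qed.

Lemma Im_le_normc x : `|complex.Im x| <= normc x.
Proof.
case: x => a b /=; rewrite -sqrtr_sqr ler_sqrt ?addr_ge0 ?sqr_ge0 //.
by rewrite lerDr sqr_ge0.
Qed.

Lemma normc_le_ReIm x : normc x <= `|complex.Re x| + `|complex.Im x|.
Proof.
have -> : x = Complex (complex.Re x) 0 + Complex 0 (complex.Im x).
  by apply: complex_ext; rewrite ?Re_add ?Im_add /= ?addr0 ?add0r.
apply: (le_trans (le_normcD _ _)); rewrite normc_real normc_imag.
by rewrite Re_add Im_add /= addr0 add0r.
Qed.

Lemma expiD (a b : R) : expi (a + b) = expi a * expi b.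
Proof.
apply: complex_ext; rewrite ?Re_mul ?Im_mul /= mulrDr; first by rewrite cosD.
by rewrite sinD; ring.
Qed.

Lemma expi0 : expi (0 : R) = 1.
Proof. by apply: complex_ext; rewrite /= mulr0 ?cos0 ?sin0. Qed.

Lemma normc_expi (a : R) : normc (expi a) = 1.
Proof. by rewrite /normc /= cos2Dsin2 sqrtr1. Qed.

Lemma expi_nat (m : nat) : expi (m%:R : R) = 1.
Proof.
elim: m => [|m IH]; first exact: expi0.
rewrite -addn1 natrD expiD IH mul1r; apply: complex_ext => /=.
  by rewrite mulr1 mulr_natl cos2pi.
by rewrite mulr1 mulr_natl sin2pi.
Qed.

Lemma expiNK (a : R) : expi (- a) * expi a = 1.
Proof. by rewrite -expiD addNr expi0. Qed.

Lemma expi_int (m : int) : expi (m%:~R : R) = 1.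
Proof.
case: m => m; first exact: expi_nat.
by rewrite NegzE mulrNz; have := expiNK (m.+1%:R); rewrite expi_nat mulr1.
Qed.

Lemma expi_neq0 (a : R) : expi a != 0.
Proof.
apply/eqP => h; have := normc_expi a; rewrite h normc0 => /eqP.
by rewrite eq_sym oner_eq0.
Qed.

End ComplexFacts.

Section ComplexSmooth.
Variable R : realType.
Implicit Types V W : normedModType R.

Lemma smooth_diff V (g : V -> R[i]) z : smooth g ->
  differentiable (re_fun g) z /\ differentiable (im_fun g) z.
Proof. by move=> /(_ [::] z). Qed.

Lemma smooth_cderive V (g : V -> R[i]) v : smooth g -> smooth (cderive v g).
Proof.
move=> /smoothP[h1 h2]; apply/smoothP; split.
  exact: (rsmooth_derive v h1).
exact: (rsmooth_derive v h2).
Qed.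

Lemma smooth_ext V (f g : V -> R[i]) : f =1 g -> smooth g -> smooth f.
Proof. by move=> /funext ->. Qed.

Lemma smooth_cst V (a : R[i]) : smooth (fun _ : V => a).
Proof. by apply/smoothP; split; exact: rsmooth_cst. Qed.

Lemma re_funD V (f g : V -> R[i]) :
  re_fun (fun z => f z + g z) = (fun z => re_fun f z + re_fun g z).
Proof. by apply/funext => z; rewrite /re_fun Re_add. Qed.
Lemma im_funD V (f g : V -> R[i]) :
  im_fun (fun z => f z + g z) = (fun z => im_fun f z + im_fun g z).
Proof. by apply/funext => z; rewrite /im_fun Im_add. Qed.
Lemma re_funM V (f g : V -> R[i]) : re_fun (fun z => f z * g z) =
  (fun z => re_fun f z * re_fun g z + (- (im_fun f z * im_fun g z))).
Proof. by apply/funext => z; rewrite /re_fun Re_mul. Qed.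
Lemma im_funM V (f g : V -> R[i]) : im_fun (fun z => f z * g z) =
  (fun z => re_fun f z * im_fun g z + im_fun f z * re_fun g z).
Proof. by apply/funext => z; rewrite /im_fun Im_mul. Qed.

Lemma smoothD V (f g : V -> R[i]) : smooth f -> smooth g -> smooth (fun z => f z + g z).
Proof.
move=> /smoothP[f1 f2] /smoothP[g1 g2]; apply/smoothP; rewrite re_funD im_funD.
by split; apply: rsmoothD.
Qed.

Lemma smoothM V (f g : V -> R[i]) : smooth f -> smooth g -> smooth (fun z => f z * g z).
Proof.
move=> /smoothP[f1 f2] /smoothP[g1 g2]; apply/smoothP; rewrite re_funM im_funM.
split; apply: rsmoothD; try exact: rsmoothM.
by apply: rsmoothN; exact: rsmoothM.
Qed.

Lemma smoothN V (f : V -> R[i]) : smooth f -> smooth (fun z => - f z).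
Proof.
move=> hf; apply: (@smooth_ext _ _ (fun z => (-1) * f z)).
  by move=> z; rewrite mulN1r.
by apply: smoothM => //; exact: smooth_cst.
Qed.

Lemma smoothB V (f g : V -> R[i]) : smooth f -> smooth g -> smooth (fun z => f z - g z).
Proof. by move=> hf hg; apply: smoothD => //; exact: smoothN. Qed.

Lemma smooth_sum V (I : Type) (s : seq I) (F : I -> V -> R[i]) :
  (forall i, smooth (F i)) -> smooth (fun z => \sum_(i <- s) F i z).
Proof.
move=> hF; elim: s => [|i s IH].
  by under eq_fun do rewrite big_nil; exact: smooth_cst.
by under eq_fun do rewrite big_cons; apply: smoothD.
Qed.

Lemma smooth_pair V (a b : V -> R) : rsmooth a -> rsmooth b ->
  smooth (fun z => Complex (a z) (b z)).
Proof. by move=> ha hb; apply/smoothP. Qed.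

Lemma smooth_expi V (a : V -> R) : rsmooth a -> smooth (fun z => expi (a z)).
Proof.
move=> ha; have [hc hs] := rsmooth_cos_sin R.
have h2 : rsmooth (fun z => 2 * pi * a z) by apply: rsmoothM => //; exact: rsmooth_cst.
by apply: smooth_pair; exact: rsmooth_comp1 h2.
Qed.

Lemma cderiveD V (f g : V -> R[i]) v z : smooth f -> smooth g ->
  cderive v (fun z => f z + g z) z = cderive v f z + cderive v g z.
Proof.
move=> /(smooth_diff z)[f1 f2] /(smooth_diff z)[g1 g2].
rewrite /cderive re_funD im_funD.
by apply: complex_ext; rewrite ?Re_add ?Im_add /= deriveDE.
Qed.

Lemma cderiveM V (f g : V -> R[i]) v z : smooth f -> smooth g ->
  cderive v (fun z => f z * g z) z = cderive v f z * g z + f z * cderive v g z.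
Proof.
move=> /(smooth_diff z)[f1 f2] /(smooth_diff z)[g1 g2].
have d1 := differentiableM f1 g1; have d2 := differentiableM f2 g2.
have d3 := differentiableM f1 g2; have d4 := differentiableM f2 g1.
have d2' : differentiable (fun z => - (im_fun f z * im_fun g z)) z by exact: differentiableN.
rewrite /cderive re_funM im_funM.
apply: complex_ext; rewrite ?Re_add ?Im_add ?Re_mul ?Im_mul /=.
  rewrite deriveDE // deriveNE // !deriveME // /re_fun /im_fun; ring.
by rewrite deriveDE // !deriveME // /re_fun /im_fun; ring.
Qed.

Lemma cderive_cst V (a : R[i]) v z : cderive v (fun _ : V => a) z = 0.
Proof. by apply: complex_ext; exact: derive_cst. Qed.

Lemma cderiveZ V (a : R[i]) (f : V -> R[i]) v z : smooth f ->
  cderive v (fun z => a * f z) z = a * cderive v f z.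
Proof.
by move=> hf; rewrite cderiveM //; [rewrite cderive_cst mul0r add0r|exact: smooth_cst].
Qed.

Lemma cderive_sum V (I : Type) (s : seq I) (F : I -> V -> R[i]) v z :
  (forall i, smooth (F i)) ->
  cderive v (fun z => \sum_(i <- s) F i z) z = \sum_(i <- s) cderive v (F i) z.
Proof.
move=> hF; elim: s => [|i s IH].
  by rewrite big_nil; under eq_fun do rewrite big_nil; rewrite cderive_cst.
rewrite big_cons -IH -cderiveD //; last exact: smooth_sum.
by apply: (congr1 (fun h => cderive v h z)); apply/funext => y; exact: big_cons.
Qed.

Lemma cderive_expi V (a : V -> R) v z : rsmooth a ->
  cderive v (fun z => expi (a z)) z = Complex 0 (2 * pi * 'D_v a z) * expi (a z).
Proof.
move=> ha; have [hc hs] := rsmooth_cos_sin R.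
have da := rsmooth_diff z ha.
have h2 : rsmooth (fun z => 2 * pi * a z) by apply: rsmoothM => //; exact: rsmooth_cst.
have d2 := rsmooth_diff z h2.
have E : 'D_v (fun z => 2 * pi * a z) z = 2 * pi * 'D_v a z.
  by rewrite deriveME // derive_cst mulr0 addr0.
apply: complex_ext; rewrite ?Re_mul ?Im_mul /= mul0r.
  rewrite (derive_comp1 _ d2); last exact: rsmooth_diff.
  by rewrite E; have [_ ->] := is_derive_cos (2 * pi * a z); ring.
rewrite (derive_comp1 _ d2); last exact: rsmooth_diff.
by rewrite E; have [_ ->] := is_derive_sin (2 * pi * a z); ring.
Qed.

Lemma smooth_affine V W (g : W -> R[i]) (l : V -> W) (c : W) : clinear l -> smooth g ->
  smooth (fun z => g (l z + c)) /\
  forall v z, cderive v (fun z => g (l z + c)) z = cderive (l v) g (l z + c).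
Proof.
move=> hl /smoothP[h1 h2].
have [s1 D1] := rsmooth_affine c hl h1; have [s2 D2] := rsmooth_affine c hl h2.
split; first by apply/smoothP.
move=> v z; apply: complex_ext.
  exact: (congr1 (fun h => h z) (D1 v)).
exact: (congr1 (fun h => h z) (D2 v)).
Qed.

Lemma smooth_comp V W (G : W -> R[i]) (l : V -> W) (a : V -> R) (w : W) :
  clinear l -> smooth G -> rsmooth a -> smooth (fun z => G (l z + a z *: w)).
Proof.
move=> /clinear_diff[d1 D1] /smoothP[h1 h2] ha; apply/smoothP; split.
  exact: rsmooth_comp d1 D1 h1 ha.
exact: rsmooth_comp d1 D1 h2 ha.
Qed.

Lemma smooth_continuous V (g : V -> R[i]) : smooth g ->
  continuous (re_fun g) /\ continuous (im_fun g).
Proof. by move=> /smoothP[h1 h2]; split; exact: rsmooth_continuous. Qed.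

Lemma cderive_add V (f : V -> R[i]) u v z : smooth f ->
  cderive (u + v) f z = cderive u f z + cderive v f z.
Proof.
move=> /(smooth_diff z)[f1 f2]; apply: complex_ext; rewrite ?Re_add ?Im_add /= !deriveE //.
  by rewrite linearD.
by rewrite linearD.
Qed.

Lemma cderive_scale V (f : V -> R[i]) (a : R) v z : smooth f ->
  cderive (a *: v) f z = Complex a 0 * cderive v f z.
Proof.
move=> /(smooth_diff z)[f1 f2]; apply: complex_ext; rewrite ?Re_mul ?Im_mul /= !deriveE //.
  by rewrite linearZ /= mul0r subr0.
by rewrite linearZ /= mul0r addr0.
Qed.

Lemma cderive_dir0 V (f : V -> R[i]) z : cderive 0 f z = 0.
Proof. by apply: complex_ext; rewrite /= derive0. Qed.

End ComplexSmooth.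

(** * Averages along segments and the integral over the unit cube *)

Section LineAverage.
Variable R : realType.

Section AnyModule.
Variable W : normedModType R.
Implicit Types (F : W -> R) (G H : W -> R[i]) (w : W) (ws : seq W).

(** Integration as an operator on functions of the base point: it can be iterated,
    and it commutes with derivatives. *)
Definition ravg w F : W -> R := fun z => int01 (fun t => F (z + t *: w)).
Definition cavg w G : W -> R[i] :=
  fun z => Complex (ravg w (re_fun G) z) (ravg w (im_fun G) z).
Definition ravgs ws F := foldr ravg F ws.
Definition cavgs ws G := foldr cavg G ws.

Lemma re_cavgs ws G : re_fun (cavgs ws G) = ravgs ws (re_fun G).
Proof. by elim: ws => //= w ws <-. Qed.

Lemma im_cavgs ws G : im_fun (cavgs ws G) = ravgs ws (im_fun G).
Proof. by elim: ws => //= w ws <-. Qed.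

Lemma clinear_flow w : clinear (fun p : W * R => p.1 + p.2 *: w).
Proof.
split=> [a [u s] [v t] /=|z].
  by rewrite scalerDr scalerDl /= scalerA addrACA.
apply: cvgD; first exact: cvg_fst.
by apply: cvgZr_tmp; exact: cvg_snd.
Qed.

Lemma clinear_line w : clinear (fun t : R => t *: w).
Proof.
split=> [a s t|t]; first by rewrite scalerDl scalerA.
by apply: cvgZr_tmp; exact: cvg_id.
Qed.

(** Translations commute with averages, so periodicity is inherited. *)
Lemma cavgs_invariant ws G c : (forall z, G (z + c) = G z) ->
  forall z, cavgs ws G (z + c) = cavgs ws G z.
Proof.
move=> hG; elim: ws => [//|w ws IH] z /=.
apply: complex_ext => /=; apply: eq_int01 => t _; rewrite /re_fun /im_fun.
  by rewrite addrAC IH.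
by rewrite addrAC IH.
Qed.

End AnyModule.

Lemma ravgs_affine (W W' : normedModType R) (A : W -> W') (L : W -> W') ws (F : W' -> R) :
  (forall z t w, A (z + t *: w) = A z + t *: L w) ->
  forall z, ravgs ws (fun z => F (A z)) z = ravgs (map L ws) F (A z).
Proof.
move=> hA; elim: ws => [//|w ws IH] z /=.
by apply: eq_int01 => t _; rewrite -hA IH.
Qed.

(** The recursion of [cube_int] on the dimension is traded for an iteration on a
    fixed space, one average along each axis. *)
Lemma cube_int_ravgs n (F : 'rV[R]_n -> R) :
  cube_int F = ravgs [seq delta_mx 0 j | j <- enum 'I_n] F 0.
Proof.
elim: n F => [|n IH] F.
  by rewrite (_ : enum 'I_0 = [::]) //; apply/eqP; rewrite -size_eq0 size_enum_ord.
rewrite enum_ordSl /= -map_comp; apply: eq_int01 => t _; rewrite IH.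
have hA (z : 'rV[R]_n) (s : R) (w : 'rV[R]_n) :
    row_mx (t%:M : 'rV[R]_1) (z + s *: w) = row_mx (t%:M : 'rV[R]_1) z + s *: row_mx (0 : 'rV[R]_1) w.
  by rewrite scale_row_mx add_row_mx scaler0 addr0.
rewrite (ravgs_affine (W' := 'rV[R]_(1 + n)%N) _ F hA) -map_comp.
have -> : row_mx (t%:M : 'rV[R]_1) 0 = 0 + t *: (delta_mx 0 ord0 : 'rV[R]_(1 + n)).
  apply/rowP => i; rewrite !mxE; case: splitP => j hj; rewrite !mxE ?add0r.
    by rewrite (ord1 j) eqxx mulr1n (_ : i = ord0) ?eqxx ?mulr1 //; apply: val_inj; rewrite /= hj (ord1 j).
  by rewrite (_ : i == ord0 = false) ?mulr0 ?addr0 //; apply/eqP => h; move: hj; rewrite h.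
congr (ravgs _ F _); apply: eq_map => j /=.
apply/rowP => i; rewrite !mxE; case: splitP => k hk; rewrite !mxE eqxx /=.
  by rewrite (_ : i == lift ord0 j = false) //; apply/eqP => h; move: hk; rewrite h (ord1 k).
rewrite (_ : (i == lift ord0 j) = (k == j)) //; apply/eqP/eqP => h.
  by apply: val_inj; move: hk; rewrite h /= /bump /= add1n => -[].
by apply: val_inj; rewrite /= hk h.
Qed.

Section Framed.
Variable W : normedModType R.
Variables (I : finType) (e : I -> W) (c : I -> W -> R).
Hypothesis hfr : frame e c.
Implicit Types (F : W -> R) (G H : W -> R[i]) (w : W) (ws : seq W).

Lemma ravg_derive w F : rsmooth F ->
  rsmooth (ravg w F) /\
  forall v, (fun z => 'D_v (ravg w F) z) = ravg w (fun z => 'D_v F z).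
Proof.
move=> hF; have [s D] := rsmooth_affine 0 (clinear_flow w) hF.
have E : ravg w F = pint (fun p : W * R => F ((p.1 + p.2 *: w) + 0)).
  by apply/funext => z; apply: eq_int01 => t _; rewrite addr0.
split; first by rewrite E; exact: rsmooth_pint hfr _ s.
move=> v; apply/funext => z; rewrite E; have [_ ->] := pint_diff hfr z s.
apply: eq_int01 => t _ /=.
have := congr1 (fun h => h (z, t)) (D (v, 0)) => /= ->.
by rewrite scale0r !addr0.
Qed.

Lemma smooth_cavg w G : smooth G -> smooth (cavg w G).
Proof.
move=> /smoothP[h1 h2]; apply/smoothP; split.
  by have [] := ravg_derive w h1.
by have [] := ravg_derive w h2.
Qed.

Lemma cderive_cavg w v G : smooth G -> cderive v (cavg w G) = cavg w (cderive v G).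
Proof.
move=> /smoothP[h1 h2]; apply/funext => z; apply: complex_ext.
  have [_ D] := ravg_derive w h1; exact: (congr1 (fun h => h z) (D v)).
have [_ D] := ravg_derive w h2; exact: (congr1 (fun h => h z) (D v)).
Qed.

Lemma smooth_cavgs ws G : smooth G -> smooth (cavgs ws G).
Proof. by move=> hG; elim: ws => //= w ws; exact: smooth_cavg. Qed.

Lemma cderive_cavgs ws v G : smooth G -> cderive v (cavgs ws G) = cavgs ws (cderive v G).
Proof.
move=> hG; elim: ws => //= w ws <-; rewrite cderive_cavg //; exact: smooth_cavgs.
Qed.

Lemma continuous_line F z w : continuous F -> continuous (fun t : R => F (z + t *: w)).
Proof.
move=> cF t.
have h : {for t, continuous (fun t : R => z + t *: w)}.
  by apply: cvgD; [exact: cvg_cst|apply: cvgZr_tmp; exact: cvg_id].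
exact: (continuous_comp h (cF _)).
Qed.

Lemma cavgD w G H z : smooth G -> smooth H ->
  cavg w (fun z => G z + H z) z = cavg w G z + cavg w H z.
Proof.
move=> /smooth_continuous[g1 g2] /smooth_continuous[h1 h2].
rewrite /cavg re_funD im_funD; apply: complex_ext; rewrite ?Re_add ?Im_add /=.
  by rewrite /ravg int01D //; exact: continuous_line.
by rewrite /ravg int01D //; exact: continuous_line.
Qed.

Lemma cavgM w G H z : smooth G -> (forall z t, H (z + t *: w) = H z) ->
  cavg w (fun z => H z * G z) z = H z * cavg w G z.
Proof.
move=> /smooth_continuous[g1 g2] hH.
have c1 := continuous_line (z := z) (w := w) g1; have c2 := continuous_line (z := z) (w := w) g2.
have z1 a : continuous (fun t : R => a * re_fun G (z + t *: w)).
  by move=> t; apply: cvgM; [exact: cvg_cst|exact: c1].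
have z2 a : continuous (fun t : R => a * im_fun G (z + t *: w)).
  by move=> t; apply: cvgM; [exact: cvg_cst|exact: c2].
apply: complex_ext; rewrite ?Re_mul ?Im_mul /= /ravg -!int01Z //.
  by rewrite -int01B //; apply: eq_int01 => t _; rewrite /re_fun /im_fun Re_mul hH.
by rewrite -int01D //; apply: eq_int01 => t _; rewrite /re_fun /im_fun Im_mul hH.
Qed.

Lemma cavgsD ws G H z : smooth G -> smooth H ->
  cavgs ws (fun z => G z + H z) z = cavgs ws G z + cavgs ws H z.
Proof.
move=> hG hH; elim: ws z => [//|w ws IH] z /=.
rewrite -cavgD; try exact: smooth_cavgs.
by congr (cavg w _ z); apply/funext.
Qed.

(** A factor that is constant along the directions of averaging comes out of the
    integrals. *)
Lemma cavgsM ws G H z : smooth G -> (forall w z t, w \in ws -> H (z + t *: w) = H z) ->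
  cavgs ws (fun z => H z * G z) z = H z * cavgs ws G z.
Proof.
move=> hG; elim: ws z => [//|w ws IH] z hH /=.
rewrite -cavgM; first last.
  by move=> y t; apply: hH; rewrite inE eqxx.
  exact: smooth_cavgs.
congr (cavg w _ z); apply/funext => y; apply: IH => w' y' t hw'.
by apply: hH; rewrite inE hw' orbT.
Qed.

Lemma cavgsZ ws (a : R[i]) G z : smooth G ->
  cavgs ws (fun z => a * G z) z = a * cavgs ws G z.
Proof. by move=> hG; apply: (@cavgsM ws G (fun=> a)). Qed.

Lemma cavgs0 ws z : cavgs ws (fun _ => 0) z = 0.
Proof.
by rewrite -[RHS](mul0r (cavgs ws (fun _ => 1) z)) -cavgsZ; [rewrite mul0r|exact: smooth_cst].
Qed.

Lemma ravgs_le ws F M z : rsmooth F -> (forall z, `|F z| <= M) -> `|ravgs ws F z| <= M.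
Proof.
move=> hF hM; elim: ws z => [//|w ws IH] z /=.
apply: int01_le => [|t _]; last exact: IH.
apply: continuous_line; apply: rsmooth_continuous.
elim: ws {IH} => //= w' ws; move=> /(ravg_derive w'); tauto.
Qed.

Lemma normc_cavgs_le ws G M z : smooth G -> (forall z, normc (G z) <= M) ->
  normc (cavgs ws G z) <= 2 * M.
Proof.
move=> /smoothP[h1 h2] hM; apply: (le_trans (normc_le_ReIm _)).
rewrite mulr2n mulrDl mul1r lerD //.
  rewrite -[complex.Re _]/(re_fun _ _) re_cavgs ravgs_le // => y.
  exact: le_trans (Re_le_normc _) (hM y).
rewrite -[complex.Im _]/(im_fun _ _) im_cavgs ravgs_le // => y.
exact: le_trans (Im_le_normc _) (hM y).
Qed.

Lemma is_derive_ray F z w (t : R) : rsmooth F ->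
  is_derive t (1:R) (fun t => F (z + t *: w)) ('D_w F (z + t *: w)).
Proof.
move=> hF; have [s D] := rsmooth_affine z (clinear_line w) hF.
have E : (fun t => F (z + t *: w)) = (fun t => F (t *: w + z)).
  by apply/funext => y; rewrite addrC.
rewrite E addrC; apply: DeriveDef.
  by apply/derivable1_diffP; exact: rsmooth_diff.
by have := congr1 (fun h => h t) (D 1) => /= ->; rewrite scale1r.
Qed.

Lemma ravg_ftc w F z : rsmooth F -> ravg w (fun z => 'D_w F z) z = F (z + w) - F z.
Proof.
move=> hF.
have cD : continuous (fun t : R => 'D_w F (z + t *: w)).
  apply: (@continuous_line (fun z => 'D_w F z)).
  by apply: rsmooth_continuous; exact: rsmooth_derive.
by rewrite /ravg (int01_ftc (fun t => is_derive_ray z w t hF) cD) scale1r scale0r addr0.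
Qed.

Lemma cavg_ftc w G z : smooth G -> cavg w (cderive w G) z = G (z + w) - G z.
Proof.
move=> /smoothP[h1 h2]; apply: complex_ext; rewrite ?Re_add ?Im_add ?Re_opp ?Im_opp /=.
  exact: ravg_ftc.
exact: ravg_ftc.
Qed.

(** Integration by parts without boundary terms: along its own axis the average of a
    derivative is a difference of two values that coincide by periodicity, and the
    other averages commute with the derivative. *)
Lemma cavgs_cderive0 ws w G z : smooth G -> (forall z, G (z + w) = G z) -> w \in ws ->
  cavgs ws (cderive w G) z = 0.
Proof.
move=> hG hp; elim: ws z => [//|w' ws IH] z; rewrite inE => /predU1P[<-|hw] /=.
  rewrite -cderive_cavgs // cavg_ftc; last exact: smooth_cavgs.
  by rewrite cavgs_invariant // subrr.
rewrite (_ : cavgs ws _ = fun=> 0); first exact: (cavgs0 [:: w']).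
by apply/funext => y; exact: IH.
Qed.

End Framed.
End LineAverage.

(** * Functions and sections on the torus *)

Section TorusSections.
Variables (R : realType) (n : nat).
Notation V := ('rV[R]_n * 'rV[R]_n)%type.
Implicit Types (z : V) (g tau : V -> R[i]) (mu nu m p q : 'rV[int]_n).

Definition coord (d : 'I_n + 'I_n) : V -> R :=
  match d with inl i => fun z => z.1 0 i | inr j => fun z => z.2 0 j end.

Lemma rV_entry_le (u : 'rV[R]_n) i : `|u 0 i| <= `|u|.
Proof.
rewrite [X in _ <= X]mx_normrE; apply: (le_bigmax _ (fun ij => `|u ij.1 ij.2|) (0, i)).
Qed.

Lemma frame_torus : frame (@dirxy R n) coord.
Proof.
split.
- move=> u; rewrite big_sumType /= /dirx /diry.
  under eq_bigr do rewrite -[_ *: _]/(_, _) scaler0.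
  under [X in _ + X]eq_bigr do rewrite -[_ *: _]/(_, _) scaler0.
  have pairE (I : finType) (F : I -> 'rV[R]_n) (G : I -> 'rV[R]_n) :
      \sum_i (F i, G i) = (\sum_i F i, \sum_i G i) :> V.
    elim: (index_enum I) => [|i s IH]; first by rewrite !big_nil.
    by rewrite !big_cons IH.
  rewrite !pairE !big1_eq -[RHS]/(_ + 0, 0 + _) addr0 add0r.
  by case: u => a b /=; congr (_, _); rewrite [LHS]row_sum_delta.
- by case=> i u /=; apply: (le_trans (rV_entry_le _ _)); rewrite prod_normE le_max lexx ?orbT.
- by case=> i a u v /=; rewrite !mxE.
Qed.

Lemma clinear_coord d : clinear (coord d).
Proof.
split; first by case: frame_torus => _ _ /(_ d).
move=> z; case: d => i /=.
  exact: (continuous_comp (cvg_fst : {for z, continuous fst}) (@coord_continuous _ _ _ 0 i _)).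
exact: (continuous_comp (cvg_snd : {for z, continuous snd}) (@coord_continuous _ _ _ 0 i _)).
Qed.

Lemma rsmooth_coord d : rsmooth (coord d).
Proof. exact: rsmooth_linear (clinear_coord d). Qed.

Definition lat mu nu : V := (zrow R mu, zrow R nu).

Lemma add_lat z mu nu : z + lat mu nu = (z.1 + zrow R mu, z.2 + zrow R nu).
Proof. by []. Qed.

Lemma test_section_lat k tau mu nu z : test_section k tau ->
  tau (z + lat mu nu) = expi (- (k%:R * dotr (zrow R mu) z.2)) * tau z.
Proof. by move=> [_ h]; rewrite add_lat h. Qed.

Lemma zrow0 : zrow R (0 : 'rV[int]_n) = 0.
Proof. by apply/rowP => i; rewrite !mxE. Qed.

Lemma zrowD p q : zrow R (p + q) = zrow R p + zrow R q.
Proof. by apply/rowP => i; rewrite !mxE rmorphD. Qed.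

Lemma zrow_delta j : zrow R (delta_mx 0 j : 'rV[int]_n) = delta_mx 0 j.
Proof. by apply/rowP => i; rewrite !mxE; case: eqP => //=; case: eqP. Qed.

Lemma dot0r (u : 'rV[R]_n) : dotr 0 u = 0.
Proof. by rewrite /dotr big1 // => i _; rewrite mxE mul0r. Qed.

Lemma dotrD (u v w : 'rV[R]_n) : dotr u (v + w) = dotr u v + dotr u w.
Proof. by rewrite /dotr -big_split; apply: eq_bigr => i _; rewrite mxE mulrDr. Qed.

Lemma dotrDl (u v w : 'rV[R]_n) : dotr (u + v) w = dotr u w + dotr v w.
Proof. by rewrite /dotr -big_split; apply: eq_bigr => i _; rewrite mxE mulrDl. Qed.

Lemma dotrC (u v : 'rV[R]_n) : dotr u v = dotr v u.
Proof. by apply: eq_bigr => i _; rewrite mulrC. Qed.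

Lemma dotrZ a (u v : 'rV[R]_n) : dotr u (a *: v) = a * dotr u v.
Proof. by rewrite /dotr mulr_sumr; apply: eq_bigr => i _; rewrite mxE mulrCA. Qed.

Lemma dotr_delta (u : 'rV[R]_n) j : dotr u (delta_mx 0 j) = u 0 j.
Proof.
rewrite /dotr (bigD1 j) //= mxE !eqxx mulr1 big1 ?addr0 // => i /negbTE ij.
by rewrite mxE ij andbF mulr0.
Qed.

Lemma dotr_int p q : dotr (zrow R p) (zrow R q) = (\sum_i p 0 i * q 0 i)%:~R.
Proof. by rewrite /dotr rmorph_sum; apply: eq_bigr => i _; rewrite !mxE rmorphM. Qed.

Lemma section_y_periodic k tau nu z : test_section k tau -> tau (z + lat 0 nu) = tau z.
Proof. by move=> /test_section_lat ->; rewrite zrow0 dot0r mulr0 oppr0 expi0 mul1r. Qed.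

Lemma diry_lat j : diry R j = lat 0 (delta_mx 0 j).
Proof. by rewrite /diry /lat zrow0 zrow_delta. Qed.

(** Functions on the torus are treated as sections of the trivial power, [k = 0]. *)
Lemma torus_functionE g : smooth_on_torus g <-> test_section 0 g.
Proof.
by split=> -[h1 h2]; split=> // mu nu z; rewrite h2 mul0r oppr0 expi0 mul1r.
Qed.

Lemma test_section_lin k (a : R[i]) t1 t2 : test_section k t1 -> test_section k t2 ->
  test_section k (fun z => a * t1 z + t2 z).
Proof.
move=> [s1 h1] [s2 h2]; split.
  by apply: smoothD => //; apply: smoothM => //; exact: smooth_cst.
by move=> mu nu z; rewrite h1 h2 mulrDr mulrCA.
Qed.

Lemma test_section0 k : test_section k (fun _ : V => 0).
Proof. by split=> [|mu nu z]; [exact: smooth_cst|rewrite mulr0]. Qed.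

Lemma test_sectionD k t1 t2 : test_section k t1 -> test_section k t2 ->
  test_section k (fun z => t1 z + t2 z).
Proof.
move=> h1 h2; rewrite (_ : (fun z => _) = (fun z => 1 * t1 z + t2 z)).
  exact: test_section_lin.
by apply/funext => z; rewrite mul1r.
Qed.

Lemma test_section_sum k (I : Type) (s : seq I) (F : I -> V -> R[i]) :
  (forall i, test_section k (F i)) -> test_section k (fun z => \sum_(i <- s) F i z).
Proof.
move=> hF; elim: s => [|i s IH].
  by under eq_fun do rewrite big_nil; exact: test_section0.
by under eq_fun do rewrite big_cons; apply: test_sectionD.
Qed.

Lemma test_sectionM k g tau : test_section 0 g -> test_section k tau ->
  test_section k (fun z => g z * tau z).
Proof.
move=> [s1 h1] [s2 h2]; split; first exact: smoothM.
by move=> mu nu z; rewrite h1 h2 mul0r oppr0 expi0 mul1r mulrCA.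
Qed.

Lemma test_section_cst (a : R[i]) : test_section 0 (fun _ : V => a).
Proof.
by split=> [|mu nu z]; [exact: smooth_cst|rewrite mul0r oppr0 expi0 mul1r].
Qed.

Lemma test_sectionZ k (a : R[i]) tau : test_section k tau ->
  test_section k (fun z => a * tau z).
Proof. by apply: test_sectionM; exact: test_section_cst. Qed.

Lemma rsmooth_dot_y p : rsmooth (fun z => dotr (zrow R p) z.2).
Proof.
apply: rsmooth_sum => j; apply: rsmoothM; first exact: rsmooth_cst.
exact: (rsmooth_coord (inr j)).
Qed.

Lemma derive_dot_y p v z : 'D_v (fun z => dotr (zrow R p) z.2) z = dotr (zrow R p) v.2.
Proof.
have L : clinear (fun z : V => dotr (zrow R p) z.2).
  split; last by apply: rsmooth_continuous; exact: rsmooth_dot_y.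
  by move=> a u w; rewrite /= dotrD dotrZ.
by have [_ ->] := clinear_diff L.
Qed.

(** The multiplier of a section depends on [y] alone, so derivatives along x do not
    see it; for functions it is constant. *)
Lemma test_section_cderive k v tau : test_section k tau ->
  (k = 0 \/ v.2 = 0) -> test_section k (cderive v tau).
Proof.
move=> ht hv; have [st _] := ht; split; first exact: smooth_cderive.
move=> mu nu z; rewrite -add_lat.
have [s D] := smooth_affine (lat mu nu) (clinear_id V) st.
rewrite -(D v z).
pose chi z : R[i] := expi (- (k%:R * dotr (zrow R mu) z.2)).
have -> : (fun z => tau (id z + lat mu nu)) = fun z => chi z * tau z.
  by apply/funext => y; rewrite (test_section_lat _ _ _ ht).
have ra : rsmooth (fun z => - (k%:R * dotr (zrow R mu) z.2)).
  apply: rsmoothN; apply: rsmoothM; first exact: rsmooth_cst.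
  exact: rsmooth_dot_y.
rewrite cderiveM //; last exact: smooth_expi.
rewrite cderive_expi // (_ : 'D_v _ z = 0).
  by rewrite mulr0 -[Complex 0 0]/(0 : R[i]) mul0r mul0r add0r.
have dd := rsmooth_diff z (rsmooth_dot_y mu).
rewrite deriveNE; last exact: differentiableM.
rewrite deriveME // derive_cst mulr0 addr0 derive_dot_y.
by case: hv => ->; [rewrite mul0r oppr0|rewrite dotrC dot0r mulr0 oppr0].
Qed.

Lemma test_section_dx k i tau : test_section k tau -> test_section k (dx i tau).
Proof. by move=> h; apply: test_section_cderive => //; right. Qed.

Lemma test_section_foldr_dx k t tau : test_section k tau -> test_section k (foldr (@dx R n) tau t).
Proof. by move=> h; elim: t => //= i t; exact: test_section_dx. Qed.

Lemma test_section_dy j g : test_section 0 g -> test_section 0 (dy j g).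
Proof. by move=> h; apply: test_section_cderive => //; left. Qed.

Lemma test_section_foldr_dy t g : test_section 0 g -> test_section 0 (foldr (@dy R n) g t).
Proof. by move=> h; elim: t => //= i t; exact: test_section_dy. Qed.

Lemma normc_section_lat k tau mu nu z : test_section k tau ->
  normc (tau (z + lat mu nu)) = normc (tau z).
Proof. by move=> /test_section_lat ->; rewrite normcM normc_expi mul1r. Qed.

Lemma reduce_to_cube (z : V) : exists mu nu, exists2 z0, in_unit_cube z0 & z = z0 + lat mu nu.
Proof.
pose fl (u : 'rV[R]_n) : 'rV[int]_n := map_mx Num.floor u.
exists (fl z.1), (fl z.2), (z - lat (fl z.1) (fl z.2)); last by rewrite subrK.
move=> i /=; rewrite !mxE; split; rewrite subr_ge0 lerBlDl.
  have /andP[-> /ltW] := floor_itv (z.1 0 i); rewrite intrD; tauto.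
have /andP[-> /ltW] := floor_itv (z.2 0 i); rewrite intrD; tauto.
Qed.

Lemma compact_unit_cube : compact (fun z : V => in_unit_cube z).
Proof.
have c1 : compact (fun v : 'rV[R]_n => forall i, `[0%R, 1%R]%classic (v ord0 i)).
  exact: (@rV_compact R n (fun _ => `[0%R, 1%R]%classic) (fun i => @segment_compact R 0 1)).
have := compact_setX c1 c1; congr compact; apply/seteqP; split => z /=.
  move=> [h1 h2] i; split; [have := h1 i|have := h2 i]; by rewrite /= in_itv.
by move=> h; split=> i; have [] := h i; rewrite /= in_itv.
Qed.

(** The modulus of a section is periodic, hence bounded by its maximum over the
    compact unit cube. *)
Lemma section_bounded k tau : test_section k tau ->
  exists B : R, forall z, normc (tau z) <= B.
Proof.
move=> ht; have [st _] := ht; have [c1 c2] := smooth_continuous st.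
pose h (z : V) : R := `|re_fun tau z| + `|im_fun tau z|.
have ch : continuous h by move=> z; apply: cvgD; apply: cvg_norm; [exact: c1|exact: c2].
have [|zm _ hm] := @compact_EVT_max _ _ h (fun z : V => in_unit_cube z) _ compact_unit_cube
  (continuous_subspaceT ch).
  by exists 0 => i /=; rewrite !mxE lexx ler01.
exists (h zm) => z.
have [mu [nu [z0 hz0 ->]]] := reduce_to_cube z.
rewrite (normc_section_lat _ _ _ ht); apply: (le_trans (normc_le_ReIm _)).
by apply: hm; apply/mem_set.
Qed.

End TorusSections.

(** * The distance to the nearest integer as a multiple of the sine *)

Section Recentering.
Variable R : realType.

Lemma frame_real : frame (fun _ : unit => (1 : R)) (fun _ x => x).
Proof.
split=> [u|_ u|_ a u v] //.
by rewrite (big_pred1 tt) => [|[]] //; rewrite /GRing.scale /= mulr1.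
Qed.

(** Where the cosine is at least 1/2 the flat term vanishes and the integral of
    [cos / recenter_den] is an elementary arctangent; elsewhere the flat term keeps
    the denominator away from 0. *)
Definition recenter_den (s t : R) : R :=
  cos (2 * pi * s) ^+ 2 + t ^+ 2 * sin (2 * pi * s) ^+ 2 + flat (2^-1 - cos (2 * pi * s)).

(** A smooth 1-periodic function whose product with [sin (2 pi s)] is, near the
    integers, the difference between [s] and the nearest integer ([recenterE]). For
    small [s], [2 pi s = atan (sin / cos)] is [sin] times the integral of
    [cos / (cos^2 + t^2 sin^2)] over the unit interval. *)
Definition recenter (s : R) : R :=
  (2 * pi)^-1 * int01 (fun t => cos (2 * pi * s) / recenter_den s t).

Lemma recenter_den_gt0 s t : 0 < recenter_den s t.
Proof.
rewrite /recenter_den; have [h|h] := leP 2^-1 (cos (2 * pi * s)).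
  have h0 : 0 < cos (2 * pi * s) by apply: lt_le_trans h; rewrite invr_gt0.
  apply: ltr_wpDr; first exact: flat_ge0.
  apply: ltr_wpDr; last by rewrite exprn_gt0.
  by rewrite mulr_ge0 // sqr_ge0.
apply: ltr_wpDl; last by apply: flat_gt0; rewrite subr_gt0.
by apply: addr_ge0; [exact: sqr_ge0|rewrite mulr_ge0 ?sqr_ge0].
Qed.

Lemma rsmooth_angle (V : normedModType R) (a : V -> R) : @rsmooth R V a -> rsmooth (fun z => 2 * pi * a z).
Proof. by move=> ha; apply: rsmoothM => //; exact: rsmooth_cst. Qed.

Lemma rsmooth_cos2pi (V : normedModType R) (a : V -> R) : @rsmooth R V a -> rsmooth (fun z => cos (2 * pi * a z)).
Proof.
move=> /rsmooth_angle ha; have [hc _] := rsmooth_cos_sin R; exact: rsmooth_comp1 hc ha.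
Qed.

Lemma rsmooth_sin2pi (V : normedModType R) (a : V -> R) : @rsmooth R V a -> rsmooth (fun z => sin (2 * pi * a z)).
Proof.
move=> /rsmooth_angle ha; have [_ hs] := rsmooth_cos_sin R; exact: rsmooth_comp1 hs ha.
Qed.

Lemma clinear_fst (V W : normedModType R) : clinear (fst : V * W -> V).
Proof. by split=> [//|z]; exact: cvg_fst. Qed.

Lemma clinear_snd (V W : normedModType R) : clinear (snd : V * W -> W).
Proof. by split=> [//|z]; exact: cvg_snd. Qed.

Lemma rsmooth_recenter : rsmooth recenter.
Proof.
apply: rsmoothM; first exact: rsmooth_cst.
have h1 : rsmooth (fun p : R * R => p.1) by apply: rsmooth_linear; exact: clinear_fst.
have h2 : rsmooth (fun p : R * R => p.2) by apply: rsmooth_linear; exact: clinear_snd.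
have hc := rsmooth_cos2pi h1; have hs := rsmooth_sin2pi h1.
apply: (@rsmooth_pint R R unit (fun=> 1) (fun _ x => x) frame_real
   (fun p => cos (2 * pi * p.1) / recenter_den p.1 p.2)).
apply: rsmoothM => //; apply: rsmoothV; last by move=> p; rewrite gt_eqF // recenter_den_gt0.
apply: rsmoothD; first apply: rsmoothD.
- exact: (rsmoothM hc hc).
- exact: (rsmoothM (rsmoothM h2 h2) (rsmoothM hs hs)).
- apply: (rsmooth_comp1 (rsmooth_flatn _ 0)); apply: rsmoothB => //; exact: rsmooth_cst.
Qed.

Lemma cos2pi_int s (q : int) : cos (2 * pi * (s + q%:~R)) = cos (2 * pi * s) :> R.
Proof.
have := congr1 (@complex.Re R) (expiD s q%:~R); rewrite expi_int mulr1; exact.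
Qed.

Lemma sin2pi_int s (q : int) : sin (2 * pi * (s + q%:~R)) = sin (2 * pi * s) :> R.
Proof.
have := congr1 (@complex.Im R) (expiD s q%:~R); rewrite expi_int mulr1; exact.
Qed.

Lemma recenter_int s (q : int) : recenter (s + q%:~R) = recenter s.
Proof. by rewrite /recenter /recenter_den cos2pi_int sin2pi_int. Qed.

(** The integrand is the derivative of [t |-> atan (t * tan th)], where [th] is
    the representative of the angle in the interval of length 2 pi around 0. *)
Lemma recenterE s : 2^-1 <= cos (2 * pi * s) ->
  exists q : int, sin (2 * pi * s) * recenter s = s - q%:~R.
Proof.
(* [q] is the integer nearest to [s], so [2 pi (s - q)] is within [pi] of 0. As its
   cosine is positive, it is within [pi / 2], where [atan] inverts [tan]. *)
move=> hc; exists (Num.floor (s + 2^-1)); set q := Num.floor _.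
pose u := s - q%:~R.
have hu : - 2^-1 <= u < 2^-1.
  have /andP[h1 h2] := floor_itv (s + 2^-1); rewrite intrD -/q in h1 h2.
  apply/andP; split; rewrite /u; lra.
have E : s = u + q%:~R by rewrite /u subrK.
rewrite E recenter_int sin2pi_int addrK; rewrite E cos2pi_int in hc.
pose th := 2 * pi * u.
have ppi : 0 < pi :> R := pi_gt0 R.
have hth : - pi <= th < pi.
  case/andP: hu => h1 h2; apply/andP; split; rewrite /th; nra.
have cth : 0 < cos th by apply: lt_le_trans hc; rewrite invr_gt0.
have thr : th \in `](- (pi / 2)), (pi / 2)[.
  rewrite in_itv /=; case/andP: hth => h1 h2; apply/andP; split; rewrite ltNge; apply/negP => h.
    have : 0 <= sin (- th - pi / 2) by apply: sin_ge0_pi; apply/andP; split; lra.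
    by rewrite sinBpihalf cosN oppr_ge0 leNgt cth.
  have : 0 <= sin (th - pi / 2) by apply: sin_ge0_pi; apply/andP; split; lra.
  by rewrite sinBpihalf oppr_ge0 leNgt cth.
have cn0 : cos th != 0 by rewrite gt_eqF.
pose f t := sin th * (cos th / recenter_den u t).
have D t : is_derive t (1:R) (fun t => atan (t * tan th)) (f t).
  have d1 : is_derive t (1:R) (fun t => t * tan th) (tan th).
    apply: DeriveDef; first exact: derivableM.
    by rewrite deriveMr // derive_id /GRing.scale /= mulr1.
  have d2 := is_derive1_comp (f := atan) (g := fun t => t * tan th) (is_derive1_atan _) d1.
  apply: is_derive_eq d2 _; rewrite /f /recenter_den -/th flat_le0; last by rewrite subr_le0.
  rewrite addr0 /tan.
  have p1 : cos th ^+ 2 + t ^+ 2 * sin th ^+ 2 != 0.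
    by rewrite gt_eqF // ltr_wpDr ?exprn_gt0 // mulr_ge0 // sqr_ge0.
  by field; rewrite exprMn cn0 p1.
have sg : rsmooth (fun t => cos th / recenter_den u t).
  apply: rsmoothM; first exact: rsmooth_cst.
  apply: rsmoothV; last by move=> t; rewrite gt_eqF // recenter_den_gt0.
  apply: rsmoothD; last exact: rsmooth_cst.
  apply: rsmoothD; first exact: rsmooth_cst.
  apply: rsmoothM; last exact: rsmooth_cst.
  have h : rsmooth (@id R) by apply: rsmooth_linear; exact: clinear_id.
  exact: (rsmoothM h h).
have cf : continuous f.
  by apply: rsmooth_continuous; apply: rsmoothM => //; exact: rsmooth_cst.
have cg := rsmooth_continuous sg.
rewrite /recenter -/th mulrCA -int01Z // (int01_ftc D cf) mul1r mul0r atan0 subr0 tanK //.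
by rewrite /th mulKf // mulf_neq0 // gt_eqF.
Qed.

End Recentering.

(** * Division of sections vanishing on lattice fibres *)

Section DivisionTheorem.
Variables (R : realType) (n : nat).
Notation V := ('rV[R]_n * 'rV[R]_n)%type.
Implicit Types (z : V) (g h : V -> R[i]).
Variable l : nat.
Hypothesis l_gt0 : (0 < l)%N.

Definition theta (j : 'I_n) (z : V) : R[i] := expi (l%:R * z.1 0 j) - 1.

Lemma rsmooth_lx j : rsmooth (fun z : V => l%:R * z.1 0 j).
Proof. by apply: rsmoothM; [exact: rsmooth_cst|exact: (rsmooth_coord R (inl j))]. Qed.

Lemma lx_lat j z mu nu :
  l%:R * (z + lat R mu nu).1 0 j = l%:R * z.1 0 j + (Posz l * mu 0 j)%:~R.
Proof. by rewrite /= !mxE mulrDr intrM. Qed.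

Lemma test_section_expi_x j (c : int) :
  test_section 0 (fun z : V => expi (c%:~R * (l%:R * z.1 0 j))).
Proof.
split.
  by apply: smooth_expi; apply: rsmoothM; [exact: rsmooth_cst|exact: rsmooth_lx].
move=> mu nu z; rewrite -add_lat lx_lat mulrDr expiD -intrM expi_int mulr1.
by rewrite mul0r oppr0 expi0 mul1r.
Qed.

Lemma test_section_theta j : test_section 0 (theta j).
Proof.
have h := test_section_expi_x j 1.
apply: test_sectionD; last exact: test_section_cst.
by move: h; under eq_fun do rewrite mul1r.
Qed.

Definition recenter_x (j : 'I_n) (z : V) : R := recenter (l%:R * z.1 0 j).

Lemma rsmooth_recenter_x j : rsmooth (recenter_x j).
Proof. exact: rsmooth_comp1 (rsmooth_recenter R) (rsmooth_lx j). Qed.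

(** Adding [displace j z] to the coordinate [j] of [z] leaves it fixed modulo
    translations by the lattice, and sends it exactly onto [Z / l] when it is close
    to that set. *)
Definition displace (j : 'I_n) (z : V) : R :=
  - (l%:R^-1 * (sin (2 * pi * (l%:R * z.1 0 j)) * recenter_x j z)).

Lemma rsmooth_displace j : rsmooth (displace j).
Proof.
apply: rsmoothN; apply: rsmoothM; first exact: rsmooth_cst.
apply: rsmoothM; last exact: rsmooth_recenter_x.
exact: rsmooth_sin2pi (rsmooth_lx j).
Qed.

Lemma displace_lat j z mu nu : displace j (z + lat R mu nu) = displace j z.
Proof. by rewrite /displace /recenter_x lx_lat sin2pi_int recenter_int. Qed.

Definition displace_quot (j : 'I_n) (z : V) : R[i] :=
  Complex 0 ((2 * l%:R)^-1) * (1 + expi (- (l%:R * z.1 0 j))) * Complex (recenter_x j z) 0.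

(** The displacement is divisible by [theta j], because
    [2 i sin (2 pi a) = (expi a - 1) (1 + expi (- a))]. *)
Lemma displaceE j z : Complex (displace j z) 0 = theta j z * displace_quot j z.
Proof.
rewrite /theta /displace_quot /displace; set a := _ * z.1 0 j.
have -> : (expi a - 1) * (Complex 0 ((2 * l%:R)^-1) * (1 + expi (- a)) * Complex (recenter_x j z) 0) =
  Complex 0 ((2 * l%:R)^-1) * (expi a - expi (- a)) * Complex (recenter_x j z) 0.
  have E : expi (- a) = (expi a)^-1.
    by apply: (mulIf (expi_neq0 a)); rewrite expiNK mulVf // expi_neq0.
  by rewrite E; field; exact: expi_neq0.
apply: complex_ext; rewrite ?Re_mul ?Im_mul ?Re_add ?Im_add ?Re_opp ?Im_opp /= mulrN cosN sinN;
  by field; rewrite pnatr_eq0 -lt0n.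
Qed.

Lemma test_section_displace_quot j : test_section 0 (displace_quot j).
Proof.
have e1 : test_section 0 (fun z : V => Complex (recenter_x j z) 0).
  split; first by apply: smooth_pair; [exact: rsmooth_recenter_x|exact: rsmooth_cst].
  move=> mu nu z; rewrite -add_lat /recenter_x lx_lat recenter_int.
  by rewrite mul0r oppr0 expi0 mul1r.
have e2 : test_section 0 (fun z : V => 1 + expi (- (l%:R * z.1 0 j))).
  apply: test_sectionD; first exact: test_section_cst.
  by have := test_section_expi_x j (-1); under eq_fun do rewrite mulN1r.
apply: test_sectionM e1; apply: test_sectionM e2; exact: test_section_cst.
Qed.

Variable k : nat.

(** The image of the sections under multiplication by the functions [theta j]. *)
Definition in_ideal g := exists h : 'I_n -> V -> R[i],
  (forall j, test_section k (h j)) /\ forall z, g z = \sum_j theta j z * h j z.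

Lemma in_idealD g h : in_ideal g -> in_ideal h -> in_ideal (fun z => g z + h z).
Proof.
move=> [a [ha Ea]] [b [hb Eb]]; exists (fun j z => a j z + b j z); split.
  by move=> j; exact: test_sectionD.
by move=> z; rewrite Ea Eb -big_split; apply: eq_bigr => j _; rewrite mulrDr.
Qed.

Lemma in_ideal_theta j h : test_section k h -> in_ideal (fun z => theta j z * h z).
Proof.
move=> hh; exists (fun i z => if i == j then h z else 0); split.
  by move=> i; case: eqP => // _; exact: test_section0.
move=> z; rewrite (bigD1 j) //= eqxx big1 ?addr0 // => i /negbTE ->.
by rewrite mulr0.
Qed.

Definition shift_coord j h : V -> R[i] := fun z => h (z + displace j z *: dirx R j).

Lemma test_section_shift_coord j h : test_section k h -> test_section k (shift_coord j h).
Proof.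
move=> hh; have [sh _] := hh; split.
  exact: smooth_comp (clinear_id V) sh (rsmooth_displace j).
move=> mu nu z; rewrite -add_lat /shift_coord displace_lat addrAC.
by rewrite (test_section_lat _ _ _ hh) /= scaler0 addr0.
Qed.

(** The averages are taken over a segment of variable length. The displacement is
    periodic and along x only, so the multiplier of the section is constant on the
    segment. *)
Lemma test_section_moving_avg j h : test_section k h ->
  test_section k (fun z => cavg (displace j z *: dirx R j) h z).
Proof.
move=> hh; have [sh _] := hh; split.
  pose K (p : V * R) := h (p.1 + (p.2 * displace j p.1) *: dirx R j).
  have sK : smooth K.
    apply: smooth_comp (clinear_fst _ _) sh _; apply: rsmoothM.
      by apply: rsmooth_linear; exact: clinear_snd.
    have [s _] := rsmooth_affine 0 (clinear_fst V R) (rsmooth_displace j).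
    by apply: rsmooth_ext s => p; rewrite addr0.
  have /smoothP[K1 K2] := sK.
  apply: (@smooth_ext _ _ _ (fun z => Complex (pint (re_fun K) z) (pint (im_fun K) z))).
    move=> z; apply: complex_ext => /=; apply: eq_int01 => t _; by rewrite scalerA.
  by apply: smooth_pair; exact: rsmooth_pint (@frame_torus R n) _ _.
move=> mu nu z; rewrite -add_lat displace_lat.
pose chi (y : V) : R[i] := expi (- (k%:R * dotr (zrow R mu) y.2)).
have -> : cavg (displace j z *: dirx R j) h (z + lat R mu nu) =
    cavg (displace j z *: dirx R j) (fun y => chi y * h y) z.
  apply: complex_ext => /=; apply: eq_int01 => t _; rewrite addrAC /re_fun /im_fun.
    by rewrite (test_section_lat _ _ _ hh).
  by rewrite (test_section_lat _ _ _ hh).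
rewrite cavgM // => y t; congr expi; congr (- (_ * dotr _ _)).
by rewrite /= !scaler0 addr0.
Qed.

(** The fundamental theorem of calculus along the displacement exhibits the
    difference as [displace j], a multiple of [theta j], times a section. *)
Lemma shift_coord_ideal j h : test_section k h ->
  in_ideal (fun z => h z - shift_coord j h z).
Proof.
move=> hh; have [sh _] := hh.
pose P z := cavg (displace j z *: dirx R j) (dx j h) z.
have tP : test_section k P.
  by apply: (@test_section_moving_avg j (dx j h)); exact: test_section_dx.
have tQ : test_section k (fun z => (- 1) * (displace_quot j z * P z)).
  apply: test_sectionZ; apply: test_sectionM tP; exact: test_section_displace_quot.
have := in_ideal_theta j tQ.
congr in_ideal; apply/funext => z.
rewrite -[RHS]opprB /shift_coord; set w := _ *: dirx R j.
rewrite -(cavg_ftc w z sh).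
have -> : cderive w h = fun y => Complex (displace j z) 0 * dx j h y.
  by apply/funext => y; rewrite /w cderive_scale.
rewrite cavgM //; last exact: smooth_cderive.
by rewrite displaceE -/(P z); ring.
Qed.

Definition shift_coords (s : seq 'I_n) h := foldr shift_coord h s.

Lemma test_section_shift_coords s h : test_section k h -> test_section k (shift_coords s h).
Proof. by move=> hh; elim: s => //= j s; exact: test_section_shift_coord. Qed.

Lemma shift_coords_ideal s h : test_section k h ->
  in_ideal (fun z => h z - shift_coords s h z).
Proof.
move=> hh; elim: s => [|j s IH] /=.
  exists (fun _ _ => 0); split=> [j|z]; first exact: test_section0.
  by rewrite subrr big1 // => j _; rewrite mulr0.
have := in_idealD IH (shift_coord_ideal j (test_section_shift_coords s hh)).
by congr in_ideal; apply/funext => z; rewrite addrA subrK.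
Qed.

Lemma displace_dirx i j z a : i != j -> displace i (z + a *: dirx R j) = displace i z.
Proof.
move=> ij; rewrite /displace /recenter_x.
by rewrite /= !mxE (negbTE ij) andbF mulr0 addr0.
Qed.

Definition moved (s : seq 'I_n) z : 'rV[R]_n :=
  \row_i (z.1 0 i + (if i \in s then displace i z else 0)).

Lemma movedE s z i : moved s z 0 i = z.1 0 i + (if i \in s then displace i z else 0).
Proof. exact: mxE. Qed.

Lemma shift_coordsE s h z : uniq s -> shift_coords s h z = h (moved s z, z.2).
Proof.
elim: s z => [|j s IH] z.
  move=> _; have -> : moved [::] z = z.1 by apply/rowP => i; rewrite movedE in_nil addr0.
  by case: z.
rewrite cons_uniq => /andP[js us].
have -> : shift_coords (j :: s) h z = shift_coords s h (z + displace j z *: dirx R j) by [].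
have c1 i : (z + displace j z *: dirx R j).1 0 i = z.1 0 i + displace j z * (i == j)%:R.
  by rewrite /= !mxE.
have c2 : (z + displace j z *: dirx R j).2 = z.2 by rewrite /= scaler0 addr0.
have c3 i : i != j -> displace i (z + displace j z *: dirx R j) = displace i z.
  exact: displace_dirx.
move: (z + displace j z *: dirx R j) c1 c2 c3 => z' c1 c2 c3.
have E : moved s z' = moved (j :: s) z.
  apply/rowP => i.
  rewrite [LHS]movedE [RHS]movedE c1 inE.
  have [->|ij] := eqVneq i j; first by rewrite (negbTE js) addr0 mulr1.
  by rewrite mulr0 addr0 c3.
by rewrite (IH _ us) E c2.
Qed.

(** Close to the lattice the displacement lands on the lattice, so a section that
    vanishes on the lattice fibres becomes zero on a neighbourhood of them. *)
Lemma shift_coords_vanish g z :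
  (forall (q : 'rV[int]_n) y, g (l%:R^-1 *: zrow R q, y) = 0) ->
  (forall j, 2^-1 <= cos (2 * pi * (l%:R * z.1 0 j))) ->
  shift_coords (enum 'I_n) g z = 0.
Proof.
move=> hg hc; rewrite (shift_coordsE _ _ (enum_uniq _)).
have /choice [q hq] : forall j, exists q : int,
    sin (2 * pi * (l%:R * z.1 0 j)) * recenter_x j z = l%:R * z.1 0 j - q%:~R.
  by move=> j; exact: recenterE.
have -> : moved (enum 'I_n) z = l%:R^-1 *: zrow R (\row_j q j); last exact: hg.
have l0 : (l%:R : R) != 0 by rewrite pnatr_eq0 -lt0n.
apply/rowP => i; rewrite movedE !mxE mem_enum /= /displace hq mulrBr mulKf // opprB addrC subrK //.
Qed.

Definition theta_sq (z : V) : R := \sum_j (2 - 2 * cos (2 * pi * (l%:R * z.1 0 j))).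
(** Nonzero only where all coordinates are close to [Z / l], that is, where the
    displaced section is zero: adding it to the denominator [theta_sq] makes the
    denominator positive without changing the quotient. *)
Definition near_lattice (z : V) : R := \prod_j flat (cos (2 * pi * (l%:R * z.1 0 j)) - 2^-1).

Lemma theta_sq_ge0 z : 0 <= theta_sq z.
Proof.
apply: sumr_ge0 => j _; have := cos_le1 (2 * pi * (l%:R * z.1 0 j)); lra.
Qed.

Lemma near_lattice_ge0 z : 0 <= near_lattice z.
Proof. by apply: prodr_ge0 => j _; exact: flat_ge0. Qed.

Lemma denominator_gt0 z : 0 < theta_sq z + near_lattice z.
Proof.
have [h|h] := ltP 0 (theta_sq z).
  by apply: ltr_wpDr => //; exact: near_lattice_ge0.
apply: ltr_wpDl; first exact: theta_sq_ge0.
apply: prodr_gt0 => j _; apply: flat_gt0.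
have hz : theta_sq z = 0 by apply/eqP; rewrite eq_le h theta_sq_ge0.
have := cos_le1 (2 * pi * (l%:R * z.1 0 j)).
have : 2 - 2 * cos (2 * pi * (l%:R * z.1 0 j)) <= theta_sq z.
  rewrite /theta_sq (bigD1 j) //= lerDl; apply: sumr_ge0 => i _.
  by have := cos_le1 (2 * pi * (l%:R * z.1 0 i)); lra.
rewrite hz; lra.
Qed.

Lemma theta_sqE z : Complex (theta_sq z) 0 =
  \sum_j theta j z * (expi (- (l%:R * z.1 0 j)) - 1).
Proof.
have E (a : R) : (expi a - 1) * (expi (- a) - 1) = Complex (2 - 2 * cos (2 * pi * a)) 0.
  have -> : (expi a - 1) * (expi (- a) - 1) = expi (- a) * expi a - expi a - expi (- a) + 1.
    by ring.
  rewrite expiNK; apply: complex_ext; rewrite ?Re_add ?Im_add ?Re_opp ?Im_opp /= ?mulrN ?cosN ?sinN.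
    by ring.
  by ring.
rewrite /theta_sq /theta; under [RHS]eq_bigr do rewrite E.
elim: (index_enum _) => [|j s IH]; first by rewrite !big_nil.
by rewrite !big_cons -IH; apply: complex_ext; rewrite ?Re_add ?Im_add /= ?addr0.
Qed.

Lemma rsmooth_cos_lx j : rsmooth (fun z : V => cos (2 * pi * (l%:R * z.1 0 j))).
Proof. exact: rsmooth_cos2pi (rsmooth_lx j). Qed.

Lemma test_section_inv_denominator :
  test_section 0 (fun z => Complex (theta_sq z + near_lattice z)^-1 0).
Proof.
split.
  apply: smooth_pair; last exact: rsmooth_cst.
  apply: rsmoothV; last by move=> z; rewrite gt_eqF // denominator_gt0.
  apply: rsmoothD.
    apply: rsmooth_sum => j; apply: rsmoothB; first exact: rsmooth_cst.
    by apply: rsmoothM; [exact: rsmooth_cst|exact: rsmooth_cos_lx].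
  apply: rsmooth_prod => j; apply: (rsmooth_comp1 (rsmooth_flatn R 0)).
  by apply: rsmoothB; [exact: rsmooth_cos_lx|exact: rsmooth_cst].
move=> mu nu z; rewrite -add_lat mul0r oppr0 expi0 mul1r.
congr (Complex (_ + _)^-1 0).
  by apply: eq_bigr => j _; rewrite lx_lat cos2pi_int.
by apply: eq_bigr => j _; rewrite lx_lat cos2pi_int.
Qed.

(** Hadamard's lemma on the torus. Displacing all coordinates towards the lattice
    changes [g] by an element of the ideal, and turns it into a section that is zero
    near the lattice fibres. Such a section can be divided by
    [theta_sq], the sum of the squared moduli of the [theta j], which is in the ideal
    as each squared modulus is the product of [theta j] by its conjugate. *)
Theorem division_theorem g : test_section k g ->
  (forall (q : 'rV[int]_n) y, g (l%:R^-1 *: zrow R q, y) = 0) -> in_ideal g.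
Proof.
move=> tg hg.
pose G := shift_coords (enum 'I_n) g.
have tG : test_section k G by exact: test_section_shift_coords.
suff iG : in_ideal G.
  have := in_idealD (shift_coords_ideal (enum 'I_n) tg) iG.
  by congr in_ideal; apply/funext => z; rewrite subrK.
pose Q z := Complex (theta_sq z + near_lattice z)^-1 0 * G z.
have tQ : test_section k Q by apply: test_sectionM tG; exact: test_section_inv_denominator.
have nQ z : Complex (near_lattice z) 0 * Q z = 0.
  have [h|] := pselect (forall j, 2^-1 <= cos (2 * pi * (l%:R * z.1 0 j))).
    by rewrite /Q /G shift_coords_vanish ?mulr0.
  move/existsNP => [j /negP]; rewrite -ltNge => hj.
  rewrite /near_lattice (bigD1 j) //= flat_le0; first by rewrite mul0r -[Complex 0 0]/(0 : R[i]) mul0r.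
  by rewrite subr_le0 ltW.
(* The first factor is the conjugate of [theta j z]. *)
exists (fun j z => (expi (- (l%:R * z.1 0 j)) - 1) * Q z); split.
  move=> j; apply: test_sectionM tQ; apply: test_sectionD; last exact: test_section_cst.
  by have := test_section_expi_x j (-1); under eq_fun do rewrite mulN1r.
move=> z; under eq_bigr do rewrite mulrA; rewrite -mulr_suml -theta_sqE.
(* [near_lattice z * Q z] is zero, so it completes [theta_sq] into the denominator
   of [Q]. *)
rewrite -[RHS]addr0 -(nQ z) -mulrDl.
have -> : Complex (theta_sq z) 0 + Complex (near_lattice z) 0 =
    Complex (theta_sq z + near_lattice z) 0.
  by apply: complex_ext; rewrite ?Re_add ?Im_add /= ?addr0.
rewrite /Q mulrA -[LHS]mul1r; congr (_ * _).
have dn := denominator_gt0 z.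
apply: complex_ext; rewrite ?Re_mul ?Im_mul /= ?mulr0 ?mul0r ?subr0 ?addr0 //.
by rewrite mulfV // gt_eqF.
Qed.

End DivisionTheorem.

(** * Weil-Brezin coefficients and their decay *)

Section WeilBrezin.
Variables (R : realType) (n : nat).
Notation V := ('rV[R]_n * 'rV[R]_n)%type.
Implicit Types (z : V) (g h tau : V -> R[i]) (m p q : 'rV[int]_n) (x y : 'rV[R]_n).

Let yaxes : seq V := [seq diry R j | j <- enum 'I_n].

Definition chary m : V -> R[i] := fun z => expi (dotr (zrow R m) z.2).

Definition yavg g : V -> R[i] := cavgs yaxes g.

(** The integral over [y] becomes an operator on functions of [(x, y)], evaluated at
    [y = 0]. *)
Lemma ccube_int_yavg g x : ccube_int (fun y => g (x, y)) = yavg g (x, 0).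
Proof.
have hA (y : 'rV[R]_n) (t : R) (w : 'rV[R]_n) : (x, y + t *: w) = (x, y) + t *: ((0, w) : V) :> V.
  by rewrite -[RHS]/(_, _) /= scaler0 addr0.
have E (F : V -> R) : cube_int (fun y => F (x, y)) = ravgs yaxes F (x, 0).
  rewrite cube_int_ravgs (ravgs_affine _ F hA) -map_comp; congr (ravgs _ F _).
apply: complex_ext.
  by rewrite -[RHS]/(re_fun (yavg g) (x, 0)) re_cavgs; exact: E.
by rewrite -[RHS]/(im_fun (yavg g) (x, 0)) im_cavgs; exact: E.
Qed.

Lemma weil_brezinE tau m x :
  weil_brezin tau m x = yavg (fun z => chary m z * tau z) (x, 0).
Proof. exact: (ccube_int_yavg (fun z => chary m z * tau z)). Qed.

Lemma fourier_y_weil_brezin g p : fourier_y g p = weil_brezin g (- p).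
Proof.
apply/funext => x; congr ccube_int; apply/funext => y; congr (expi _ * _).
by rewrite /dotr -sumrN; apply: eq_bigr => i _; rewrite !mxE rmorphN mulNr.
Qed.

Lemma smooth_chary m : smooth (chary m).
Proof. exact: (smooth_expi (rsmooth_dot_y R m)). Qed.

Lemma chary_add p q z : chary (p + q) z = chary p z * chary q z.
Proof. by rewrite /chary zrowD dotrDl expiD. Qed.

Lemma chary_periodic m mu nu z : chary m (z + lat R mu nu) = chary m z.
Proof. by rewrite /chary /= dotrD expiD dotr_int expi_int mulr1. Qed.

Lemma cderive_chary m v z :
  cderive v (chary m) z = Complex 0 (2 * pi * dotr (zrow R m) v.2) * chary m z.
Proof. by rewrite cderive_expi ?derive_dot_y //; exact: rsmooth_dot_y. Qed.

Lemma smooth_yavg g : smooth g -> smooth (yavg g).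
Proof. exact: smooth_cavgs (@frame_torus R n) _ _. Qed.

Lemma cderive_yavg v g : smooth g -> cderive v (yavg g) = yavg (cderive v g).
Proof. exact: cderive_cavgs (@frame_torus R n) _ _ _. Qed.

Lemma mem_yaxes w : w \in yaxes -> exists j, w = diry R j.
Proof. by move/mapP => [j _ ->]; exists j. Qed.

Lemma yavgM g h z : smooth g -> (forall z j t, h (z + t *: diry R j) = h z) ->
  yavg (fun z => h z * g z) z = h z * yavg g z.
Proof.
move=> sg hh; apply: (cavgsM (@frame_torus R n)) => // w z' t /mem_yaxes[j ->].
exact: hh.
Qed.

Lemma clinear_x0 : clinear (fun x : 'rV[R]_n => (x, 0) : V).
Proof.
split=> [a u v|x]; first by rewrite -[RHS]/(_, _) /= scaler0 addr0.
by apply: (@cvg_pair _ _ _ (nbhs x) (nbhs x) (nbhs 0)); [exact: cvg_id|exact: cvg_cst].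
Qed.

Lemma smooth_weil_brezin tau m : smooth tau -> smooth (weil_brezin tau m).
Proof.
move=> st; have sc : smooth (fun z => chary m z * tau z).
  by apply: smoothM => //; exact: smooth_chary.
have [s _] := smooth_affine 0 clinear_x0 (smooth_yavg sc).
by apply: smooth_ext s => x; rewrite addr0 weil_brezinE.
Qed.

Lemma cderive_weil_brezin tau m i : smooth tau ->
  cderive (delta_mx 0 i) (weil_brezin tau m) = weil_brezin (dx i tau) m.
Proof.
move=> st; have sc : smooth (fun z => chary m z * tau z).
  by apply: smoothM => //; exact: smooth_chary.
have [_ D] := smooth_affine 0 clinear_x0 (smooth_yavg sc).
apply/funext => x; rewrite weil_brezinE.
have -> : weil_brezin tau m = (fun x => yavg (fun z => chary m z * tau z) ((x, 0) + 0)).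
  by apply/funext => y; rewrite weil_brezinE addr0.
rewrite D addr0 cderive_yavg //; congr (yavg _ _); apply/funext => z.
rewrite cderiveM //; last exact: smooth_chary.
by rewrite cderive_chary /= dotrC dot0r mulr0 -[Complex 0 0]/(0 : R[i]) !mul0r add0r.
Qed.

Lemma foldr_cderive_weil_brezin tau m t : smooth tau ->
  foldr (fun i => cderive (delta_mx 0 i)) (weil_brezin tau m) t =
  weil_brezin (foldr (@dx R n) tau t) m.
Proof.
move=> st; elim: t => //= i t ->; rewrite cderive_weil_brezin //.
by elim: t => //= j t; exact: smooth_cderive.
Qed.

Lemma weil_brezin_le k tau m x B : test_section k tau ->
  (forall z, normc (tau z) <= B) -> normc (weil_brezin tau m x) <= 2 * B.
Proof.
move=> [st _] hB; rewrite weil_brezinE; apply: (normc_cavgs_le (@frame_torus R n)).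
  by apply: smoothM => //; exact: smooth_chary.
by move=> z; rewrite normcM normc_expi mul1r.
Qed.

Lemma weil_brezinM_chary tau m q x :
  weil_brezin (fun z => chary q z * tau z) m x = weil_brezin tau (m + q) x.
Proof.
rewrite !weil_brezinE; congr (yavg _ _); apply/funext => z.
by rewrite chary_add mulrA.
Qed.

Lemma weil_brezinD g h m x : smooth g -> smooth h ->
  weil_brezin (fun z => g z + h z) m x = weil_brezin g m x + weil_brezin h m x.
Proof.
move=> sg sh; rewrite !weil_brezinE -(cavgsD (@frame_torus R n)).
- by congr (cavgs _ _ _); apply/funext => z; rewrite mulrDr.
- by apply: smoothM => //; exact: smooth_chary.
- by apply: smoothM => //; exact: smooth_chary.
Qed.

Lemma weil_brezinM g h m x : smooth g -> (forall z j t, h (z + t *: diry R j) = h z) ->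
  weil_brezin (fun z => h z * g z) m x = h (x, 0) * weil_brezin g m x.
Proof.
move=> sg hh; rewrite !weil_brezinE -yavgM //.
  by congr (yavg _ _); apply/funext => z; rewrite mulrCA.
by apply: smoothM => //; exact: smooth_chary.
Qed.

Lemma weil_brezinZ a g m x : smooth g ->
  weil_brezin (fun z => a * g z) m x = a * weil_brezin g m x.
Proof. by move=> sg; apply: (@weil_brezinM g (fun=> a)). Qed.

Lemma weil_brezin_sum (J : Type) (s : seq J) (G : J -> V -> R[i]) m x :
  (forall j, smooth (G j)) ->
  weil_brezin (fun z => \sum_(j <- s) G j z) m x = \sum_(j <- s) weil_brezin (G j) m x.
Proof.
move=> sG; elim: s => [|j s IH].
  have -> : (fun z => \sum_(j <- [::]) G j z) = fun z => 0 * (0 : R[i]).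
    by apply/funext => z; rewrite big_nil mul0r.
  by rewrite (@weil_brezinZ 0 (fun=> 0)) ?mul0r ?big_nil //; exact: smooth_cst.
rewrite big_cons -IH -weil_brezinD //; last exact: smooth_sum.
by congr (weil_brezin _ _ _); apply/funext => z; rewrite big_cons.
Qed.

(** Integration by parts: the derivative of the character brings down [m j]. *)
Lemma weil_brezin_dy k g m j x : test_section k g ->
  weil_brezin (dy j g) m x = - Complex 0 (2 * pi * (m 0 j)%:~R) * weil_brezin g m x.
Proof.
move=> tg; have [sg _] := tg.
have sc : smooth (fun z => chary m z * g z) by apply: smoothM => //; exact: smooth_chary.
have : yavg (cderive (diry R j) (fun z => chary m z * g z)) (x, 0) = 0.
  apply: (cavgs_cderive0 (@frame_torus R n)) => //.
    by move=> z; rewrite diry_lat chary_periodic (section_y_periodic _ _ tg).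
  by apply: map_f; rewrite mem_enum.
have -> : cderive (diry R j) (fun z => chary m z * g z) =
    fun z => Complex 0 (2 * pi * (m 0 j)%:~R) * (chary m z * g z) + chary m z * dy j g z.
  apply/funext => z; rewrite cderiveM //; last exact: smooth_chary.
  by rewrite cderive_chary /= dotr_delta mxE mulrA.
have sd : smooth (dy j g) by exact: smooth_cderive.
rewrite /yavg (cavgsD (@frame_torus R n)); last first.
- by apply: smoothM => //; exact: smooth_chary.
- by apply: smoothM => //; exact: smooth_cst.
rewrite (cavgsZ (@frame_torus R n)) // -/(yavg _ _) -!/(yavg _) -!weil_brezinE => /eqP.
by rewrite addr_eq0 mulNr => /eqP ->; rewrite opprK.
Qed.

Lemma fourier_y_dy k g p j x : test_section k g ->
  fourier_y (dy j g) p x = Complex 0 (2 * pi * (p 0 j)%:~R) * fourier_y g p x.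
Proof.
move=> tg; rewrite !fourier_y_weil_brezin (weil_brezin_dy _ _ _ tg); congr (_ * _).
by apply: complex_ext; rewrite ?Re_opp ?Im_opp /= ?oppr0 // mxE rmorphN /= mulrN opprK.
Qed.

Lemma fourier_y_foldr_dy g p t x : test_section 0 g ->
  fourier_y (foldr (@dy R n) g t) p x =
  \prod_(j <- t) Complex 0 (2 * pi * (p 0 j)%:~R) * fourier_y g p x.
Proof.
move=> tg; elim: t => [|j t IH] /=; first by rewrite big_nil mul1r.
rewrite (fourier_y_dy _ _ _ (test_section_foldr_dy t tg)) IH big_cons mulrA //.
Qed.

Definition weight p : R := \prod_j (1 + (p 0 j)%:~R ^+ 2)^-1.

Lemma weight_gt0 p : 0 < weight p.
Proof. by apply: prodr_gt0 => j _; rewrite invr_gt0 ltr_pwDl // sqr_ge0. Qed.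

(** The operator [1 - (4 pi^2)^-1 d^2/dy_j^2], whose Fourier multiplier is
    [1 + p_j^2]. *)
Definition bessel j g : V -> R[i] :=
  fun z => g z + Complex (- ((2 * pi) ^+ 2)^-1) 0 * dy j (dy j g) z.

Lemma test_section_bessel j g : test_section 0 g -> test_section 0 (bessel j g).
Proof.
move=> tg; apply: test_sectionD => //; apply: test_sectionZ.
by do 2 apply: test_section_dy.
Qed.

Lemma fourier_y_bessel j g p x : test_section 0 g ->
  fourier_y (bessel j g) p x = Complex (1 + (p 0 j)%:~R ^+ 2) 0 * fourier_y g p x.
Proof.
move=> tg; have tdg := test_section_dy j tg; have [sg _] := tg.
have [sd _] := test_section_dy j tdg.
rewrite fourier_y_weil_brezin weil_brezinD //; last by apply: smoothM => //; exact: smooth_cst.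
rewrite weil_brezinZ // -!fourier_y_weil_brezin (fourier_y_dy _ _ _ tdg) (fourier_y_dy _ _ _ tg).
have pn0 : pi != 0 :> R by rewrite gt_eqF // pi_gt0.
rewrite -[X in X + _]mul1r !mulrA -mulrDl; congr (_ * _).
apply: complex_ext; rewrite ?Re_add ?Im_add ?Re_mul ?Im_mul ?Re_mul ?Im_mul /=.
  by move: (_%:~R) (pi : R) pn0 => a b b0; field.
by ring.
Qed.

(** Applying [bessel j] once for every [j] multiplies the coefficients by the
    inverse of the weight, and leaves them bounded. *)
Lemma fourier_y_decay g : test_section 0 g ->
  exists2 K : R, 0 <= K & forall p x, normc (fourier_y g p x) <= K * weight p.
Proof.
move=> tg.
pose G s := foldr bessel g s.
have tG s : test_section 0 (G s) by elim: s => //= j s; exact: test_section_bessel.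
have E s p x : fourier_y (G s) p x =
    Complex (\prod_(j <- s) (1 + (p 0 j)%:~R ^+ 2)) 0 * fourier_y g p x.
  elim: s => [|j s IH] /=; first by rewrite big_nil mul1r.
  rewrite fourier_y_bessel // IH big_cons mulrA; congr (_ * _).
  by apply: complex_ext; rewrite ?Re_mul ?Im_mul /= ?mulr0 ?mul0r ?subr0 ?addr0.
have [B hB] := section_bounded (tG (enum 'I_n)).
have B0 : 0 <= B by apply: le_trans (hB 0); exact: normc_ge0.
exists (2 * B); first by rewrite mulr_ge0.
move=> p x.
have := weil_brezin_le (- p) x (tG (enum 'I_n)) hB.
rewrite -fourier_y_weil_brezin E normcM normc_real big_enum /=.
have P0 : 0 < \prod_(j : 'I_n) (1 + (p 0 j)%:~R ^+ 2) :> R.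
  by apply: prodr_gt0 => j _; rewrite ltr_pwDl // sqr_ge0.
by rewrite gtr0_norm // /weight prodfV ler_pdivlMr // mulrC.
Qed.

End WeilBrezin.

(** * Unconditional sums *)

Section UnconditionalSums.
Variables (R : realType) (I : choiceType).
Implicit Types (F G : I -> R[i]) (A B : {fset I}) (w : I -> R).

(** Convergence along the net of finite sets, with explicit tolerances. *)
Definition hasum F (L : R[i]) : Prop := forall e : R, 0 < e ->
  exists A, forall B, (A `<=` B)%fset -> normc (\sum_(i <- B) F i - L) <= e.

Lemma csum_hasum F L : hasum F L -> csum F = L.
Proof.
move=> hF.
have ps (f : I -> R) B : @partial_sum I R f B = \sum_(i <- B) f i.
  by rewrite /partial_sum [RHS]big_seq_fsetE.
have key (f : R[i] -> R) : (forall x y, f (x + y) = f x + f y) ->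
    (forall x, `|f x| <= normc x) -> @summability.sum I R R^o (fun i => f (F i)) = f L.
  move=> fD fle.
  have f0 : f 0 = 0 by apply/eqP; rewrite -normr_eq0 eq_le normr_ge0 (le_trans (fle 0)) // normc0.
  have fS B : f (\sum_(i <- B) F i) = \sum_(i <- B) f (F i).
    elim: (enum_fset B) => [|i s IH]; first by rewrite !big_nil.
    by rewrite !big_cons fD IH.
  have fB x y : f x - f y = f (x - y).
    by apply/eqP; rewrite subr_eq -fD subrK.
  have FF : ProperFilter (@totally I) by exact: totally_filter.
  apply: (@cvg_lim R^o); first exact: Rhausdorff.
  apply/cvgrPdist_le => e e0; have [A hA] := hF e e0.
  exists A => // B /= AB; rewrite distrC ps -fS fB.
  exact: le_trans (fle _) (hA _ AB).
apply: complex_ext; rewrite /csum /=.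
  exact: (key (@complex.Re R) (@Re_add R) (@Re_le_normc R)).
exact: (key (@complex.Im R) (@Im_add R) (@Im_le_normc R)).
Qed.

Lemma eq_hasum F G L : F =1 G -> hasum F L -> hasum G L.
Proof. by move=> /funext ->. Qed.

Lemma hasumD F G L L' : hasum F L -> hasum G L' -> hasum (fun i => F i + G i) (L + L').
Proof.
move=> hF hG e e0; have e20 : 0 < e / 2 by rewrite divr_gt0.
have [A hA] := hF _ e20; have [A' hA'] := hG _ e20.
exists (A `|` A')%fset => B; rewrite fsubUset => /andP[AB A'B].
rewrite big_split /= opprD addrACA [e]splitr.
by apply: (le_trans (le_normcD _ _)); rewrite lerD ?hA ?hA'.
Qed.

Lemma hasumZ a F L : hasum F L -> hasum (fun i => a * F i) (a * L).
Proof.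
move=> hF e e0.
have a0 : 0 < normc a + 1 by rewrite ltr_wpDl // normc_ge0.
have [A hA] := hF _ (divr_gt0 e0 a0); exists A => B AB.
rewrite -mulr_sumr -mulrBr normcM.
apply: (@le_trans _ _ ((normc a + 1) * (e / (normc a + 1)))).
  by rewrite ler_pM ?normc_ge0 ?hA // lerDl.
by rewrite mulrCA mulfV ?mulr1 // gt_eqF.
Qed.

Lemma hasumN F L : hasum F L -> hasum (fun i => - F i) (- L).
Proof.
move=> hF; rewrite -mulN1r; apply: eq_hasum (hasumZ (-1) hF) => i.
by rewrite mulN1r.
Qed.

Lemma hasumB F G L L' : hasum F L -> hasum G L' -> hasum (fun i => F i - G i) (L - L').
Proof. by move=> hF hG; apply: hasumD => //; exact: hasumN. Qed.

Lemma hasum0 : hasum (fun _ => 0) 0.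
Proof.
by move=> e e0; exists fset0 => B _; rewrite big1 // subrr normc0 ltW.
Qed.

Lemma hasum_sum (J : Type) (s : seq J) (F : J -> I -> R[i]) (L : J -> R[i]) :
  (forall j, hasum (F j) (L j)) ->
  hasum (fun i => \sum_(j <- s) F j i) (\sum_(j <- s) L j).
Proof.
move=> hF; elim: s => [|j s IH].
  by rewrite big_nil; apply: eq_hasum hasum0 => i; rewrite big_nil.
rewrite big_cons; apply: eq_hasum (hasumD (hF j) IH) => i.
by rewrite big_cons.
Qed.

Lemma hasum_single (i0 : I) (a : R[i]) : hasum (fun i => if i == i0 then a else 0) a.
Proof.
move=> e e0; exists [fset i0]%fset => B; rewrite fsub1set => hB.
rewrite (big_fsetD1 i0) //= eqxx big_seq big1 ?addr0 ?subrr ?normc0 ?ltW // => i.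
by rewrite !inE => /andP[/negbTE ->].
Qed.

Lemma hasum_le F L M : hasum F L -> (forall B, normc (\sum_(i <- B) F i) <= M) -> normc L <= M.
Proof.
move=> hF hM; apply/ler_addgt0Pr => e e0; have [A hA] := hF e e0.
have -> : L = \sum_(i <- A) F i - (\sum_(i <- A) F i - L) by rewrite opprB addrC subrK.
apply: (le_trans (le_normcB _ _)); apply: lerD => //; exact: hA.
Qed.

(** A bijection of the index set permutes the finite sets, so it does not affect an
    unconditional sum. *)
Lemma hasum_reindex (f g : I -> I) F L : cancel f g -> cancel g f ->
  hasum F L -> hasum (fun i => F (f i)) L.
Proof.
move=> fK gK hF e e0; have [A hA] := hF e e0.
exists [fset g i | i in A]%fset => B AB.
have <- : \sum_(i <- [fset f i | i in B]%fset) F i = \sum_(i <- B) F (f i).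
  by rewrite big_imfset //= => i j _ _; exact: (can_inj fK).
apply: hA; apply/fsubsetP => i hi; apply/imfsetP; exists (g i); last by rewrite gK.
by apply: (fsubsetP AB); apply/imfsetP; exists i.
Qed.

Lemma big_fset_sub (V : nmodType) (F : I -> V) A B : (A `<=` B)%fset ->
  \sum_(i <- B) F i = \sum_(i <- A) F i + \sum_(i <- B | i \notin A) F i.
Proof.
move=> AB; rewrite (bigID (mem A)) /=; congr (_ + _).
rewrite -big_filter; apply: perm_big; apply: uniq_perm.
- by rewrite filter_uniq.
- exact: fset_uniq.
move=> i; rewrite mem_filter /= andb_idr //; exact: (fsubsetP AB).
Qed.

Section Dominated.
Variables (w : I -> R) (W : R).
Hypotheses (w_ge0 : forall i, 0 <= w i) (w_le : forall B, \sum_(i <- B) w i <= W).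

(** For nonnegative terms the sum of the family is this supremum. *)
Definition total : R := sup [set x | exists B : {fset I}, x = \sum_(i <- B) w i].

Let has_sup_total : has_sup [set x | exists B : {fset I}, x = \sum_(i <- B) w i].
Proof.
split; first by exists (\sum_(i <- (fset0 : {fset I})) w i), fset0.
by exists W => x [B ->].
Qed.

Lemma sum_le_total B : \sum_(i <- B) w i <= total.
Proof. by apply: sup_upper_bound => //; exists B. Qed.

Lemma sum_mono A B : (A `<=` B)%fset -> \sum_(i <- A) w i <= \sum_(i <- B) w i.
Proof. by move=> AB; rewrite (big_fset_sub w AB) lerDl sumr_ge0. Qed.

Lemma total_tail e : 0 < e -> exists A, forall B, (A `<=` B)%fset ->
  total - \sum_(i <- B) w i <= e.
Proof.
move=> e0; have [x [A ->] hA] := sup_adherent e0 has_sup_total.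
exists A => B AB; rewrite lerBlDr; apply: ltW.
by rewrite addrC -ltrBlDr; apply: lt_le_trans hA (sum_mono AB).
Qed.

(** Beyond [B] any finite set adds at most [K] times what is left of the total
    weight. *)
Lemma hasum_remainder F L K : 0 <= K -> (forall i, normc (F i) <= K * w i) -> hasum F L ->
  forall B, normc (L - \sum_(i <- B) F i) <= K * (total - \sum_(i <- B) w i).
Proof.
move=> K0 hK hF B; apply/ler_addgt0Pr => e e0; have [A hA] := hF e e0.
pose B' := (A `|` B)%fset.
have AB' : (A `<=` B')%fset by exact: fsubsetUl.
have BB' : (B `<=` B')%fset by exact: fsubsetUr.
have -> : L - \sum_(i <- B) F i =
    \sum_(i <- B' | i \notin B) F i - (\sum_(i <- B') F i - L).
  by rewrite (big_fset_sub F BB'); ring.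
apply: (le_trans (le_normcB _ _)); apply: lerD; last exact: hA.
apply: (le_trans (le_normc_sum _ _ _)).
apply: (@le_trans _ _ (\sum_(i <- B' | i \notin B) K * w i)).
  by apply: ler_sum => i _; exact: hK.
rewrite -mulr_sumr ler_wpM2l //.
have := sum_le_total B'; rewrite (big_fset_sub w BB'); lra.
Qed.

End Dominated.

(** Domination makes [f + K w] nonnegative; sums of nonnegative families converge to
    their suprema, and [f] is a difference of two of them. *)
Lemma real_sum_cvg w W (f : I -> R) K : (forall i, 0 <= w i) ->
  (forall B, \sum_(i <- B) w i <= W) -> (forall i, `|f i| <= K * w i) ->
  exists l, forall e, 0 < e -> exists A, forall B, (A `<=` B)%fset ->
    `|\sum_(i <- B) f i - l| <= e.
Proof.
move=> w0 hW hf.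
pose u i := f i + K * w i.
have Kw0 i : 0 <= K * w i by apply: le_trans (hf i).
have u0 i : 0 <= u i by have := hf i; rewrite ler_norml => /andP[h _]; rewrite /u; lra.
have uW B : \sum_(i <- B) u i <= 2 * `|K| * W.
  apply: (@le_trans _ _ (\sum_(i <- B) (2 * `|K|) * w i)).
    apply: ler_sum => i _; rewrite /u.
    have h := ler_norm K; have := hf i; rewrite ler_norml => /andP[_].
    have := w0 i; nra.
  by rewrite -mulr_sumr ler_wpM2l // mulr_ge0.
have vW B : \sum_(i <- B) K * w i <= `|K| * W.
  rewrite -mulr_sumr; apply: (@le_trans _ _ (`|K| * \sum_(i <- B) w i)).
    by rewrite ler_wpM2r ?ler_norm // sumr_ge0.
  by rewrite ler_wpM2l.
exists (total u - total (fun i => K * w i)) => e e0.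
have [A hA] := total_tail u0 uW (e := e) e0.
have [A' hA'] := total_tail Kw0 vW (e := e) e0.
exists (A `|` A')%fset => B; rewrite fsubUset => /andP[/hA h1 /hA' h2].
have h3 := sum_le_total uW B; have h4 := sum_le_total vW B.
have E : \sum_(i <- B) f i = \sum_(i <- B) u i - \sum_(i <- B) K * w i.
  by rewrite -sumrB; apply: eq_bigr => i _; rewrite /u addrK.
rewrite E ler_norml; lra.
Qed.

Lemma hasum_dominated w W F K : (forall i, 0 <= w i) ->
  (forall B, \sum_(i <- B) w i <= W) -> (forall i, normc (F i) <= K * w i) ->
  exists L, hasum F L.
Proof.
move=> w0 hW hF.
have [a ha] := @real_sum_cvg w W (fun i => complex.Re (F i)) K w0 hW
  (fun i => le_trans (Re_le_normc _) (hF i)).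
have [b hb] := @real_sum_cvg w W (fun i => complex.Im (F i)) K w0 hW
  (fun i => le_trans (Im_le_normc _) (hF i)).
exists (Complex a b) => e e0; have e20 : 0 < e / 2 by rewrite divr_gt0.
have [A hA] := ha _ e20; have [A' hA'] := hb _ e20.
exists (A `|` A')%fset => B; rewrite fsubUset => /andP[/hA h1 /hA' h2].
apply: (le_trans (normc_le_ReIm _)).
rewrite Re_add Im_add Re_opp Im_opp Re_sum Im_sum /= [e]splitr; exact: lerD.
Qed.

End UnconditionalSums.

Section WeightSummable.
Variable R : realType.

Lemma sum_sub_seq (T : eqType) (F : T -> R) (s t : seq T) : (forall x, 0 <= F x) ->
  uniq s -> uniq t -> {subset s <= t} -> \sum_(x <- s) F x <= \sum_(x <- t) F x.
Proof.
move=> F0 us ut st; rewrite [leRHS](bigID (mem s)) /=.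
have -> : \sum_(x <- t | x \in s) F x = \sum_(x <- s) F x.
  rewrite -big_filter; apply: perm_big.
  apply: uniq_perm => //; first by rewrite filter_uniq.
  by move=> x; rewrite mem_filter /= andb_idr //; exact: st.
by rewrite lerDl sumr_ge0.
Qed.

(** The terms are dominated by the telescoping ones [2 / (k (k + 1))]. *)
Lemma sum_inv_squares (m : nat) :
  \sum_(k <- iota 0 m) (1 + (k%:R : R) ^+ 2)^-1 <= 3 :> R.
Proof.
suff H k : \sum_(i <- iota 0 k.+1) (1 + (i%:R : R) ^+ 2)^-1 <= 3 - 2 / k.+1%:R :> R.
  case: m => [|m]; first by rewrite big_nil.
  by apply: (le_trans (H m)); rewrite gerBl divr_ge0.
elim: k => [|k IH]; first by rewrite /= big_seq1 expr0n /= addr0 invr1; lra.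
rewrite -addn1 iotaD big_cat /= big_seq1 add0n.
apply: (le_trans (lerD IH (lexx _))).
rewrite addn1; set a : R := k%:R.
have -> : k.+2%:R = a + 1 + 1 :> R by rewrite -!natr1.
have -> : k.+1%:R = a + 1 :> R by rewrite -natr1.
have a0 : 0 <= a by rewrite ler0n.
have h1 : 0 < a + 1 by lra.
have h2 : 0 < a + 1 + 1 by lra.
have h3 : 0 < 1 + (a + 1) ^+ 2 by rewrite ltr_pwDl // sqr_ge0.
have -> : 3 - 2 / (a + 1 + 1) = 3 - 2 / (a + 1) + 2 / ((a + 1) * (a + 1 + 1)).
  by field; rewrite !gt_eqF.
rewrite lerD2l -[X in X <= _]mul1r ler_pdivrMr // mulrAC ler_pdivlMr ?mulr_gt0 //.
nra.
Qed.

Lemma sum_weight_int (s : seq int) : uniq s -> \sum_(q <- s) (1 + (q%:~R : R) ^+ 2)^-1 <= 6.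
Proof.
move=> us; have [m hm] : exists m, forall q, q \in s -> (`|q| < m)%N.
  by exists (\max_(q <- s) `|q|%N).+1 => q hq; rewrite ltnS (leq_bigmax_seq _ hq).
pose t := [seq Posz k | k <- iota 0 m] ++ [seq Negz k | k <- iota 0 m].
have F0 (q : int) : 0 <= (1 + (q%:~R : R) ^+ 2)^-1 by rewrite invr_ge0 addr_ge0 // sqr_ge0.
apply: (@le_trans _ _ (\sum_(q <- t) (1 + (q%:~R : R) ^+ 2)^-1)).
  apply: sum_sub_seq => //.
    rewrite cat_uniq !map_inj_uniq ?iota_uniq /=; last by move=> ? ? [].
    rewrite andbT; apply/hasPn => x /mapP[k _ ->]; apply/negP => /mapP[k' _] //.
    by move=> ? ? [].
  move=> q /hm; rewrite mem_cat; case: q => k /= hk; apply/orP.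
    by left; apply/mapP; exists k => //; rewrite mem_iota.
  right; apply/mapP; exists k => //; rewrite mem_iota /= add0n.
  exact: ltn_trans hk.
rewrite /t big_cat !big_map /= (_ : 6 = 3 + 3 :> R); last by rewrite -natrD.
apply: lerD; first exact: sum_inv_squares.
apply: le_trans (sum_inv_squares m); apply: ler_sum => k _.
rewrite lef_pV2 ?posrE ?ltr_pwDl ?sqr_ge0 // lerD2l NegzE mulrNz sqrrN -pmulrn.
by rewrite ler_sqr ?nnegrE ?ler0n // ler_nat.
Qed.

(** A finite set of indices lies in a product of finite sets of integers, over which
    the sum of the product weights factors. *)
Lemma weight_summable n (B : {fset 'rV[int]_n}) : \sum_(p <- B) weight R p <= 6 ^+ n.
Proof.
pose C := undup (flatten [seq [seq p 0 j | j <- enum 'I_n] | p : 'rV[int]_n <- B]).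
pose T : finType := seq_sub C.
pose Phi (f : {ffun 'I_n -> T}) : 'rV[int]_n := \row_j ssval (f j).
pose t := [seq Phi f | f <- enum {ffun 'I_n -> T}].
have w0 p : 0 <= weight R p by exact/ltW/weight_gt0.
apply: (@le_trans _ _ (\sum_(p <- t) weight R p)).
  apply: sum_sub_seq => //.
    rewrite map_inj_uniq ?enum_uniq // => f g /rowP h; apply/ffunP => j.
    by apply: val_inj; have := h j; rewrite !mxE.
  move=> p hp.
  have hC j : p 0 j \in C.
    rewrite mem_undup; apply/flattenP; exists [seq p 0 j | j <- enum 'I_n].
      by apply/mapP; exists p.
    by apply: map_f; rewrite mem_enum.
  apply/mapP; exists [ffun j => SeqSub (hC j)]; first by rewrite mem_enum.
  by apply/rowP => j; rewrite !mxE ffunE.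
rewrite /t big_map big_enum /= /weight.
under eq_bigr do under eq_bigr do rewrite mxE.
rewrite -(bigA_distr_bigA (fun (_ : 'I_n) (c : T) => (1 + ((ssval c)%:~R : R) ^+ 2)^-1)) /=.
rewrite prodr_const card_ord lerXn2r ?nnegrE //.
  by apply: sumr_ge0 => c _; rewrite invr_ge0 addr_ge0 // sqr_ge0.
have -> : \sum_(c : T) (1 + ((ssval c)%:~R : R) ^+ 2)^-1 =
    \sum_(q <- [seq ssval c | c <- enum T]) (1 + (q%:~R : R) ^+ 2)^-1.
  by rewrite big_map big_enum.
by apply: sum_weight_int; rewrite map_inj_uniq ?enum_uniq //; exact: val_inj.
Qed.

End WeightSummable.

(** * Fourier series in y *)

Section FourierSeries.
Variables (R : realType) (n : nat).
Notation V := ('rV[R]_n * 'rV[R]_n)%type.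
Implicit Types (z : V) (g h tau : V -> R[i]) (m p q : 'rV[int]_n) (x y : 'rV[R]_n).

Lemma cavgs_cst (W : normedModType R) (ws : seq W) (a : R[i]) (z : W) : cavgs ws (fun=> a) z = a.
Proof.
elim: ws z => [//|w ws IH] z /=.
apply: complex_ext => /=.
  rewrite -[RHS](int01_cst (complex.Re a)); apply: eq_int01 => t _.
  by rewrite /re_fun IH.
rewrite -[RHS](int01_cst (complex.Im a)); apply: eq_int01 => t _.
by rewrite /im_fun IH.
Qed.

Lemma fourier_y_cst (a : R[i]) p x : fourier_y (fun _ : V => a) p x = if p == 0 then a else 0.
Proof.
have [->|p0] := eqVneq p 0.
  rewrite fourier_y_weil_brezin weil_brezinE.
  rewrite -[RHS](@cavgs_cst _ [seq diry R j | j <- enum 'I_n] a (x, 0)).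
  by congr (cavgs _ _ _); apply/funext => z; rewrite /chary oppr0 zrow0 dot0r expi0 mul1r.
have [j pj] : exists j, p 0 j != 0.
  apply/existsP; apply: contraNT p0 => /existsPn h; apply/eqP/rowP => j.
  by rewrite mxE; apply/eqP; rewrite -[_ == _]negbK.
have : fourier_y (dy j (fun _ : V => a)) p x = 0.
  have -> : dy j (fun _ : V => a) = fun z => 0 * 0.
    by apply/funext => z; rewrite /dy cderive_cst mul0r.
  by rewrite fourier_y_weil_brezin (@weil_brezinZ _ _ 0 (fun=> 0)) ?mul0r //; exact: smooth_cst.
rewrite (fourier_y_dy _ _ _ (test_section_cst n a)) => /eqP.
rewrite mulf_eq0 => /orP[|/eqP //]; rewrite eq_complex /= eqxx /=.
by rewrite !mulf_eq0 (gt_eqF (pi_gt0 R)) intr_eq0 (negbTE pj) pnatr_eq0.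
Qed.

Lemma clinear_y_of_x : clinear (fun z : V => (0, z.1) : V).
Proof.
split=> [a u v|z]; first by rewrite -[RHS]/(_, _) /= scaler0 addr0.
by apply: (@cvg_pair _ _ _ (nbhs z) (nbhs 0) (nbhs z.1)); [exact: cvg_cst|exact: cvg_fst].
Qed.

Lemma clinear_x_of_y : clinear (fun z : V => (z.2, 0) : V).
Proof.
split=> [a u v|z]; first by rewrite -[RHS]/(_, _) /= scaler0 addr0.
by apply: (@cvg_pair _ _ _ (nbhs z) (nbhs z.2) (nbhs 0)); [exact: cvg_snd|exact: cvg_cst].
Qed.

Definition unit_index (j : 'I_n) : 'rV[int]_n := delta_mx 0 j.

(** Hadamard's lemma with the variable [y] in the place of x, around the point [y]. *)
Lemma division_at_point g x y : test_section 0 g ->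
  exists H : 'I_n -> V -> R[i], (forall j, test_section 0 (H j)) /\
    forall z, g (x, z.2) = g (x, y) +
      \sum_j (expi (- y 0 j) * (chary (unit_index j) z * H j z) - H j z).
Proof.
move=> tg; have [sg _] := tg.
(* The division theorem cancels zeros on lattice fibres in x: the variable [y] is
   moved to the place of x, and [y + Z^n] becomes the lattice for [l = 1]. *)
pose G z := g (x, y + z.1) - g (x, y).
have tG : test_section 0 G.
  apply: test_sectionD; last exact: test_section_cst.
  split.
    have [s _] := smooth_affine (x, y) clinear_y_of_x sg.
    apply: smooth_ext s => z; congr (g _).
    by rewrite -[RHS]/(_, _) /= add0r addrC.
  move=> mu nu z; rewrite mul0r oppr0 expi0 mul1r /= addrA.
  have := section_y_periodic mu (x, y + z.1) tg.
  by rewrite add_lat /= zrow0 addr0.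
have [|h [th Eh]] := @division_theorem R n 1 isT 0 G tG.
  move=> q y'; rewrite /G /= invr1 scale1r.
  have := section_y_periodic q (x, y) tg.
  by rewrite add_lat /= zrow0 addr0 => ->; rewrite subrr.
exists (fun j z => h j (z.2 - y, 0)); split.
  move=> j; have [sh _] := th j; split.
    have [s _] := smooth_affine (- y, 0) clinear_x_of_y sh.
    apply: smooth_ext s => z; congr (h j _).
    by rewrite -[RHS]/(_, _) /= add0r.
  move=> mu nu z; rewrite mul0r oppr0 expi0 mul1r /= addrAC.
  have := test_section_lat nu 0 (z.2 - y, 0) (th j).
  by rewrite add_lat /= zrow0 addr0 mul0r oppr0 expi0 mul1r.
move=> z; have := Eh (z.2 - y, 0); rewrite /G /= subrKC => /eqP.
rewrite subr_eq addrC => /eqP ->; congr (_ + _); apply: eq_bigr => j _.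
rewrite /theta mulrBl mul1r mulrA; congr (_ * _ - _).
rewrite /chary /unit_index zrow_delta dotrC dotr_delta -expiD mul1r /= !mxE.
by rewrite addrC.
Qed.

(** Chernoff's argument. After division, the coefficients of [g - g (x, y)] are
    finite sums of differences between the values at [p - unit_index j] and at [p] of
    absolutely summable families, and shifting the index does not change a sum. *)
Lemma fourier_inversion g x y : test_section 0 g ->
  hasum (fun p => fourier_y g p x * expi (dotr (zrow R p) y)) (g (x, y)).
Proof.
move=> tg; have [H [tH EH]] := division_at_point x y tg.
pose u j p := fourier_y (H j) p x * expi (dotr (zrow R p) y).
have /choice[L hL] : forall j, exists L, hasum (u j) L.
  move=> j; have [K K0 hK] := fourier_y_decay (tH j).
  apply: (@hasum_dominated _ _ (@weight R n) (6 ^+ n) (u j) K).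
  - by move=> p; exact/ltW/weight_gt0.
  - exact: weight_summable.
  - by move=> p; rewrite normcM normc_expi mulr1.
have h1 j : hasum (fun p => u j (p - unit_index j)) (L j).
  apply: (@hasum_reindex _ _ _ (fun p => p + unit_index j)) (hL j).
    by move=> p; rewrite subrK.
  by move=> p; rewrite addrK.
have h2 := hasum_sum (index_enum 'I_n) (fun j => hasumB (h1 j) (hL j)).
have := hasumD (hasum_single (0 : 'rV[int]_n) (g (x, y))) h2.
rewrite [X in _ + X]big1 ?addr0; last by move=> j _; rewrite subrr.
apply: eq_hasum => p.
have -> : fourier_y g p x = fourier_y (fun z => g (x, z.2)) p x by [].
have -> : (fun z => g (x, z.2)) = (fun z => g (x, y) +
      \sum_j (expi (- y 0 j) * (chary (unit_index j) z * H j z) - H j z)).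
  by apply/funext => z; exact: EH.
have sH j : smooth (H j) by have [] := tH j.
have sc j : smooth (fun z => chary (unit_index j) z * H j z).
  by apply: smoothM => //; exact: smooth_chary.
have se j : smooth (fun z => expi (- y 0 j) * (chary (unit_index j) z * H j z)).
  by apply: smoothM => //; exact: smooth_cst.
have sN j : smooth (fun z => - H j z) by exact: smoothN.
rewrite fourier_y_weil_brezin weil_brezinD; first last.
- by apply: smooth_sum => j; exact: smoothD.
- exact: smooth_cst.
rewrite -fourier_y_weil_brezin fourier_y_cst weil_brezin_sum; last by move=> j; exact: smoothD.
rewrite mulrDl; congr (_ + _).
  by case: eqP => [->|]; rewrite ?mul0r // zrow0 dot0r expi0 mulr1.
rewrite mulr_suml; apply: eq_bigr => j _.
rewrite weil_brezinD // weil_brezinZ // weil_brezinM_chary.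
have -> : weil_brezin (fun z => - H j z) (- p) x = - weil_brezin (H j) (- p) x.
  rewrite -mulN1r -weil_brezinZ //; congr (weil_brezin _ _ _).
  by apply/funext => z; rewrite mulN1r.
rewrite mulrDl mulNr /u !fourier_y_weil_brezin opprB [_ - p]addrC; congr (_ - _).
rewrite mulrAC mulrC; congr (_ * _).
rewrite -expiD; congr expi.
have dB : dotr (zrow R (p - unit_index j)) y = dotr (zrow R p) y - y 0 j.
  rewrite -{2}(subrK (unit_index j) p) [in RHS]zrowD dotrDl zrow_delta.
  by rewrite [dotr (delta_mx _ _) _]dotrC dotr_delta addrK.
by rewrite dB; ring.
Qed.

Definition weight_total : R := total (@weight R n).

Lemma weight_tail e : 0 < e -> exists A : {fset 'rV[int]_n}, forall B : {fset 'rV[int]_n},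
  (A `<=` B)%fset -> weight_total - \sum_(p <- B) weight R p <= e.
Proof.
apply: total_tail; first by move=> p; exact/ltW/weight_gt0.
exact: weight_summable.
Qed.

Lemma clinear_x_part : clinear (fun z : V => (z.1, 0) : V).
Proof.
split=> [a u v|z]; first by rewrite -[RHS]/(_, _) /= scaler0 addr0.
by apply: (@cvg_pair _ _ _ (nbhs z) (nbhs z.1) (nbhs 0)); [exact: cvg_fst|exact: cvg_cst].
Qed.

Lemma smooth_fourier_y_x g p : smooth g -> smooth (fun z : V => fourier_y g p z.1).
Proof.
move=> sg; have sc : smooth (fun z => chary (- p) z * g z).
  by apply: smoothM => //; exact: smooth_chary.
have [s _] := smooth_affine 0 clinear_x_part (smooth_yavg sc).
by apply: smooth_ext s => z; rewrite addr0 fourier_y_weil_brezin weil_brezinE.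
Qed.

(** The Fourier series of [g] converges uniformly, hence it may be integrated
    against [tau] term by term; multiplying by the character of index [p] shifts the
    index of the Weil-Brezin coefficient by [p]. *)
Lemma weil_brezin_product k g tau m x : test_section 0 g -> test_section k tau ->
  hasum (fun p => fourier_y g p x * weil_brezin tau (m + p) x)
    (weil_brezin (fun z => g z * tau z) m x).
Proof.
move=> tg tt; have [sg _] := tg; have [st _] := tt.
have [K K0 hK] := fourier_y_decay tg; have [T hT] := section_bounded tt.
have T0 : 0 <= T by apply: le_trans (hT 0); exact: normc_ge0.
move=> e e0.
(* The factor 2 comes from [normc_cavgs_le], where real and imaginary parts are
   bounded separately; the added 1 allows [K] or [T] to be 0. *)
have c0 : 0 < 2 * (K * T) + 1 by rewrite ltr_wpDl // !mulr_ge0.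
have [A hA] := weight_tail (divr_gt0 e0 c0); exists A => B AB.
pose E z := g z - \sum_(p <- B) fourier_y g p z.1 * chary p z.
have sF p : smooth (fun z : V => fourier_y g p z.1) by exact: smooth_fourier_y_x.
have sFc p : smooth (fun z : V => fourier_y g p z.1 * chary p z).
  by apply: smoothM => //; exact: smooth_chary.
have sE : smooth E by apply: smoothB => //; exact: smooth_sum.
have hE z : normc (E z) <= K * (weight_total - \sum_(p <- B) weight R p).
  case: z => x' y'; rewrite /E.
  have hF p : normc (fourier_y g p x' * expi (dotr (zrow R p) y')) <= K * weight R p.
    by rewrite normcM normc_expi mulr1.
  exact: (hasum_remainder (@weight_summable R n) K0 hF (fourier_inversion x' y' tg) B).
set r := weight_total - _ in hE.
have -> : \sum_(p <- B) fourier_y g p x * weil_brezin tau (m + p) x -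
    weil_brezin (fun z => g z * tau z) m x = - weil_brezin (fun z => E z * tau z) m x.
  have -> : (fun z => E z * tau z) = fun z => g z * tau z +
      \sum_(p <- B) ((-1) * fourier_y g p z.1) * (chary p z * tau z).
    apply/funext => z; rewrite /E mulrBl mulr_suml -sumrN; congr (_ + _).
    by apply: eq_bigr => p _; rewrite -mulrA mulN1r mulrA.
  have sct p : smooth (fun z => chary p z * tau z).
    by apply: smoothM => //; exact: smooth_chary.
  have sT p : smooth (fun z : V => (-1) * fourier_y g p z.1 * (chary p z * tau z)).
    by apply: smoothM => //; apply: smoothM => //; exact: smooth_cst.
  rewrite weil_brezinD; [|exact: smoothM|exact: smooth_sum].
  rewrite weil_brezin_sum // opprD addrC; congr (_ + _); rewrite -sumrN.
  apply: eq_bigr => p _; rewrite (@weil_brezinM _ _ _ (fun z => (-1) * fourier_y g p z.1)) //.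
    by rewrite weil_brezinM_chary -mulrA mulN1r opprK.
  by move=> z j t; rewrite /= scaler0 addr0.
rewrite normcN weil_brezinE.
apply: (@le_trans _ _ (2 * (K * r * T))).
  apply: (normc_cavgs_le (@frame_torus R n)).
    by apply: smoothM; [exact: smooth_chary|exact: smoothM].
  move=> z; rewrite normcM normc_expi mul1r normcM.
  by rewrite ler_pM ?normc_ge0.
apply: (@le_trans _ _ (2 * (K * (e / (2 * (K * T) + 1)) * T))).
  by rewrite ler_wpM2l // ler_wpM2r // ler_wpM2l //; exact: hA.
rewrite (_ : 2 * _ = (2 * (K * T)) * (e / (2 * (K * T) + 1))); last by ring.
by rewrite mulrA ler_pdivrMr // mulrC ler_wpM2l ?(ltW e0) // lerDl.
Qed.

End FourierSeries.

(** * Averages over parallel transport along the polarization *)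

Section ParallelTransport.
Variables (R : realType) (n : nat).
Notation V := ('rV[R]_n * 'rV[R]_n)%type.
Implicit Types (z : V) (g h tau : V -> R[i]) (G : V * R -> R[i]) (p : V * R) (m q : 'rV[int]_n).

(** The parameter is a coordinate of the product space, so that this is an average
    along the last axis and its calculus is the one of [cavg]. *)
Definition pavg G : V -> R[i] := fun z => cavg ((0, 1) : V * R) G (z, 0).

Lemma param_line z (t : R) : (z, 0) + t *: (0, 1) = (z, t) :> V * R.
Proof. by rewrite -[LHS]/(_, _) /= scaler0 addr0 add0r /GRing.scale /= mulr1. Qed.

Lemma pavg_diff G : smooth G ->
  smooth (pavg G) /\ forall v, cderive v (pavg G) = pavg (cderive (v, 0) G).
Proof.
move=> /smoothP[G1 G2].
have E (F : V * R -> R) z : ravg ((0, 1) : V * R) F (z, 0) = pint F z.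
  by apply: eq_int01 => t _; rewrite param_line.
have E1 : re_fun (pavg G) = pint (re_fun G) by apply/funext => z; exact: E.
have E2 : im_fun (pavg G) = pint (im_fun G) by apply/funext => z; exact: E.
split.
  by apply/smoothP; rewrite E1 E2; split; exact: rsmooth_pint (@frame_torus R n) _ _.
move=> v; apply/funext => z; apply: complex_ext; rewrite /= ?E1 ?E2.
  by rewrite (proj2 (pint_diff (@frame_torus R n) z G1)) E.
by rewrite (proj2 (pint_diff (@frame_torus R n) z G2)) E.
Qed.

Lemma eq_pavg G G' z : (forall t, G (z, t) = G' (z, t)) -> pavg G z = pavg G' z.
Proof.
by move=> h; apply: complex_ext => /=; apply: eq_int01 => t _;
  rewrite param_line /re_fun /im_fun h.
Qed.

Lemma pavg_ftc G z : smooth G -> pavg (cderive ((0, 1) : V * R) G) z = G (z, 1) - G (z, 0).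
Proof.
by move=> sG; rewrite /pavg cavg_ftc // -[X in (z, 0) + X]scale1r param_line.
Qed.

Lemma pavgD G G' z : smooth G -> smooth G' ->
  pavg (fun p => G p + G' p) z = pavg G z + pavg G' z.
Proof. by move=> sG sG'; rewrite /pavg cavgD. Qed.

Lemma pavgZ (a : R[i]) G z : smooth G -> pavg (fun p => a * G p) z = a * pavg G z.
Proof. by move=> sG; rewrite /pavg (@cavgM _ _ _ G (fun=> a)). Qed.

Section OneDirection.
Variables (k : nat) (j : 'I_n).

Let angle (p : V * R) : R := p.2 * (k%:R * p.1.1 0 j).

Let rsmooth_angle' : rsmooth angle.
Proof.
apply: rsmoothM; first by apply: rsmooth_linear; exact: clinear_snd.
have [s _] := rsmooth_affine 0 (clinear_fst V R) (rsmooth_lx R k j).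
by apply: rsmooth_ext s => p; rewrite addr0.
Qed.

Let derive_angle v (s : R) p :
  'D_(v, s) angle p = s * (k%:R * p.1.1 0 j) + p.2 * (k%:R * v.1 0 j).
Proof.
have c2 : clinear (fun p : V * R => p.2) by exact: clinear_snd.
have [d2 D2] := clinear_diff c2.
have cx : clinear (fun p : V * R => k%:R * p.1.1 0 j).
  split; last first.
    apply: rsmooth_continuous.
    have [s' _] := rsmooth_affine 0 (clinear_fst V R) (rsmooth_lx R k j).
    by apply: rsmooth_ext s' => p'; rewrite addr0.
  by move=> a u w; rewrite /= !mxE mulrDr /GRing.scale /= mulrCA.
have [dx' Dx'] := clinear_diff cx.
by rewrite /angle deriveME // D2 Dx' /= addrC [X in X + _]mulrC.
Qed.

Definition transport tau : V * R -> R[i] :=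
  fun p => expi (p.2 * (k%:R * p.1.1 0 j)) * tau (p.1 + p.2 *: diry R j).

Lemma smooth_flow tau : smooth tau ->
  smooth (fun p : V * R => tau (p.1 + p.2 *: diry R j)) /\
  forall v s p, cderive ((v, s) : V * R) (fun p : V * R => tau (p.1 + p.2 *: diry R j)) p =
    cderive (v + s *: diry R j) tau (p.1 + p.2 *: diry R j).
Proof.
move=> st; have [s D] := smooth_affine 0 (clinear_flow (diry R j)) st.
have E : (fun p : V * R => tau (p.1 + p.2 *: diry R j)) =
         (fun p : V * R => tau (p.1 + p.2 *: diry R j + 0)).
  by apply/funext => p; rewrite addr0.
by rewrite E; split=> // v t p; rewrite D addr0.
Qed.

Lemma smooth_transport tau : smooth tau -> smooth (transport tau).
Proof.
move=> st; apply: smoothM; last by have [] := smooth_flow st.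
exact: (smooth_expi rsmooth_angle').
Qed.

Lemma cderive_transport tau v s p : smooth tau -> cderive ((v, s) : V * R) (transport tau) p =
  Complex 0 (2 * pi * (s * (k%:R * p.1.1 0 j) + p.2 * (k%:R * v.1 0 j))) * transport tau p +
  expi (p.2 * (k%:R * p.1.1 0 j)) *
    cderive (v + s *: diry R j) tau (p.1 + p.2 *: diry R j).
Proof.
move=> st; have [sf Df] := smooth_flow st.
rewrite [LHS](cderiveM _ _ (smooth_expi rsmooth_angle') sf).
by rewrite (cderive_expi _ _ rsmooth_angle') derive_angle Df -mulrA.
Qed.

(** Transport is the flow of the covariant derivative. *)
Lemma transport_ode tau p : smooth tau ->
  cderive ((0, 1) : V * R) (transport tau) p = cderive ((diry R j, 0) : V * R) (transport tau) p +
    Complex 0 (2 * pi * k%:R * p.1.1 0 j) * transport tau p.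
Proof.
move=> st; rewrite !cderive_transport //= mxE !mulr0 mul0r !addr0 mul1r mulr0.
by rewrite -[Complex 0 0]/(0 : R[i]) mul0r !add0r scale0r scale1r addr0 addrC !mulrA.
Qed.

Lemma transport_lat tau mu nu z t : test_section k tau ->
  transport tau (z + lat R mu nu, t) =
  expi (- (k%:R * dotr (zrow R mu) z.2)) * transport tau (z, t).
Proof.
move=> tt; rewrite /transport /= -/(lat R mu nu) addrAC (test_section_lat _ _ _ tt) !mxE /=.
rewrite !mulrA -!expiD; congr (expi _ * _).
rewrite dotrD dotrZ dotr_delta mxE; ring.
Qed.

Definition taverage tau : V -> R[i] := pavg (transport tau).

(** The weight vanishes at the end of the unit time and is 1 at its start. *)
Let ramp (p : V * R) : R[i] := Complex (1 - p.2) 0.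

Let smooth_ramp : smooth ramp.
Proof.
apply: smooth_pair; last exact: rsmooth_cst.
by apply: rsmoothB; [exact: rsmooth_cst|apply: rsmooth_linear; exact: clinear_snd].
Qed.

Let cderive_ramp v s p : cderive ((v, s) : V * R) ramp p = Complex (- s) 0.
Proof.
have c2 : clinear (fun p : V * R => p.2) by exact: clinear_snd.
have [d2 D2] := clinear_diff c2.
apply: complex_ext => /=; last exact: derive_cst.
rewrite -[LHS]/('D_(v, s) (fun p : V * R => 1 + (- p.2)) p).
rewrite deriveDE //; last exact: differentiableN.
by rewrite derive_cst add0r deriveNE // D2.
Qed.

Definition tmoment tau : V -> R[i] := pavg (fun p => ramp p * transport tau p).

(** The multiplier of a section is unaffected by transport: the factor gained by the
    translation in [y] compensates the one gained by the angle. *)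
Lemma test_section_pavg tau (r : V * R -> R[i]) : smooth r ->
  (forall z z' t, r (z, t) = r (z', t)) -> test_section k tau ->
  test_section k (pavg (fun p => r p * transport tau p)).
Proof.
move=> sr hr tt; have [st _] := tt; have sT := smooth_transport st.
have sP : smooth (fun p => r p * transport tau p) by exact: smoothM.
split; first by have [] := pavg_diff sP.
move=> mu nu z; rewrite -(pavgZ _ _ sP) -add_lat.
apply: complex_ext => /=; apply: eq_int01 => t _; rewrite !param_line.
  by rewrite /re_fun (transport_lat _ _ _ _ tt) (hr _ z) mulrCA.
by rewrite /im_fun (transport_lat _ _ _ _ tt) (hr _ z) mulrCA.
Qed.

Lemma test_section_taverage tau : test_section k tau -> test_section k (taverage tau).
Proof.
move=> tt; have := @test_section_pavg tau (fun=> 1) (@smooth_cst R _ 1) (fun _ _ _ => erefl) tt.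
by congr test_section; congr pavg; apply/funext => p; rewrite mul1r.
Qed.

Lemma test_section_tmoment tau : test_section k tau -> test_section k (tmoment tau).
Proof. exact: test_section_pavg smooth_ramp _. Qed.

(** The derivative of the average along its flow is a difference of end values: the
    holonomy around the circle in the direction of [y_j] minus the identity. *)
Lemma nabla_taverage tau z : test_section k tau ->
  nabla_y k j (taverage tau) z = theta k j z * tau z.
Proof.
move=> tt; have [st _] := tt; have sT := smooth_transport st.
have [_ D] := pavg_diff sT.
rewrite /nabla_y /dy /taverage D -(pavgZ _ _ sT).
have sD : smooth (cderive ((diry R j, 0) : V * R) (transport tau)) by exact: smooth_cderive.
have sZ : smooth (fun p => Complex 0 (2 * pi * k%:R * z.1 0 j) * transport tau p).
  by apply: smoothM => //; exact: smooth_cst.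
rewrite -(pavgD _ sD sZ).
have -> : pavg (fun p => cderive ((diry R j, 0) : V * R) (transport tau) p +
    Complex 0 (2 * pi * k%:R * z.1 0 j) * transport tau p) z =
    pavg (cderive ((0, 1) : V * R) (transport tau)) z.
  by apply: eq_pavg => t; rewrite (transport_ode _ st).
rewrite (pavg_ftc _ sT) /transport /= scale1r scale0r addr0 mul1r mul0r expi0 mul1r.
by rewrite diry_lat (section_y_periodic _ _ tt) /theta mulrBl mul1r.
Qed.

(** Integration by parts against [1 - t]. *)
Lemma nabla_tmoment tau z : test_section k tau ->
  nabla_y k j (tmoment tau) z = (- 1) * tau z + taverage tau z.
Proof.
move=> tt; have [st _] := tt; have sT := smooth_transport st.
have sRT : smooth (fun p => ramp p * transport tau p) by exact: smoothM.
have [_ D] := pavg_diff sRT.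
rewrite /nabla_y /dy /tmoment D -(pavgZ _ _ sRT).
have sD : smooth (cderive ((diry R j, 0) : V * R) (fun p => ramp p * transport tau p)).
  exact: smooth_cderive.
have sD1 : smooth (cderive ((0, 1) : V * R) (fun p => ramp p * transport tau p)).
  exact: smooth_cderive.
have sZ : smooth (fun p => Complex 0 (2 * pi * k%:R * z.1 0 j) * (ramp p * transport tau p)).
  by apply: smoothM => //; exact: smooth_cst.
rewrite -(pavgD _ sD sZ).
have -> : pavg (fun p => cderive ((diry R j, 0) : V * R) (fun p => ramp p * transport tau p) p +
    Complex 0 (2 * pi * k%:R * z.1 0 j) * (ramp p * transport tau p)) z =
    pavg (fun p => cderive ((0, 1) : V * R) (fun p => ramp p * transport tau p) p +
    transport tau p) z.
  apply: eq_pavg => t; rewrite !(cderiveM _ _ smooth_ramp sT) !cderive_ramp (transport_ode _ st).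
  rewrite oppr0 -[Complex 0 0]/(0 : R[i]) mul0r add0r /=.
  have -> : Complex (- 1) 0 = - 1 :> R[i] by apply: complex_ext; rewrite ?Re_opp ?Im_opp /= ?oppr0.
  by ring.
rewrite (pavgD _ sD1 sT) (pavg_ftc _ sRT) -/(taverage tau z); congr (_ + _).
rewrite /ramp /transport /= subrr subr0 -[Complex 0 0]/(0 : R[i]) -[Complex 1 0]/(1 : R[i]).
by rewrite !mul0r expi0 !mul1r scale0r addr0 sub0r mulN1r.
Qed.

End OneDirection.

Definition taverages k (s : seq 'I_n) tau := foldr (taverage k) tau s.

Lemma test_section_taverages k s tau : test_section k tau -> test_section k (taverages k s tau).
Proof. by move=> tt; elim: s => //= j s; exact: test_section_taverage. Qed.

Lemma cderive_frame (W : normedModType R) (I : finType) (e : I -> W) (c : I -> W -> R)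
    (g : W -> R[i]) (v z : W) : frame e c -> smooth g ->
  cderive v g z = \sum_i Complex (c i v) 0 * cderive (e i) g z.
Proof.
move=> [hs _ _] sg.
have E (s : seq I) : cderive (\sum_(i <- s) c i v *: e i) g z =
    \sum_(i <- s) Complex (c i v) 0 * cderive (e i) g z.
  elim: s => [|i s IH]; first by rewrite !big_nil cderive_dir0.
  by rewrite !big_cons cderive_add // cderive_scale // IH.
by rewrite {1}(hs v) E.
Qed.

(** All derivatives in [y] of the average vanish, by integration by parts. *)
Lemma yavg_const g x y : smooth g -> (forall z j, g (z + diry R j) = g z) ->
  yavg g (x, y) = yavg g (x, 0).
Proof.
move=> sg gp; have sF := smooth_yavg sg.
have D0 j z : cderive (diry R j) (yavg g) z = 0.
  rewrite cderive_yavg //; apply: (cavgs_cderive0 (@frame_torus R n)) => //.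
  by apply: map_f; rewrite mem_enum.
have D z : cderive (0, y) (yavg g) z = 0.
  rewrite (cderive_frame _ _ (@frame_torus R n)) // big1 // => -[i|i] _ /=.
    by rewrite mxE -[Complex 0 0]/(0 : R[i]) mul0r.
  by rewrite D0 mulr0.
have := cavg_ftc (0, y) (x, 0) sF.
rewrite (_ : cderive _ _ = fun=> 0); last by apply/funext => z; exact: D.
have -> : cavg ((0, y) : V) (fun=> 0) (x, 0) = 0 by exact: (cavgs_cst [:: ((0, y) : V)] 0).
rewrite -[(x, 0) + (0, y)]/(_, _) /= addr0 add0r => /esym/eqP.
by rewrite subr_eq0 => /eqP.
Qed.

(** On the fibre [k x = m] the holonomy is trivial, and transport is translation in
    [y] after multiplication by the character of index [m]. *)
Lemma taverages_on_fibre k s tau m x y : smooth tau -> k%:R *: x = zrow R m ->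
  taverages k s tau (x, y) =
  chary (- m) (x, y) * cavgs [seq diry R j | j <- s] (fun z => chary m z * tau z) (x, y).
Proof.
move=> st hx; elim: s y => [|j s IH] y /=.
  by rewrite mulrA -chary_add addNr /chary zrow0 dot0r expi0 mul1r.
have sc : smooth (fun z => chary m z * tau z) by apply: smoothM => //; exact: smooth_chary.
have sJ := smooth_cavgs (@frame_torus R n) [seq diry R j | j <- s] sc.
rewrite -(@cavgM _ _ _ _ (fun=> chary (- m) (x, y))) //.
apply: complex_ext => /=; apply: eq_int01 => t _; rewrite param_line /re_fun /im_fun.
  rewrite /transport /= -[(x, y) + _]/(_, _) /= scaler0 addr0 IH mulrA; congr (complex.Re (_ * _)).
  have -> : k%:R * x 0 j = zrow R m 0 j by rewrite -hx mxE.
  rewrite /chary /= dotrD dotrZ dotr_delta -expiD !mxE rmorphN /=; congr expi; ring.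
rewrite /transport /= -[(x, y) + _]/(_, _) /= scaler0 addr0 IH mulrA; congr (complex.Im (_ * _)).
have -> : k%:R * x 0 j = zrow R m 0 j by rewrite -hx mxE.
rewrite /chary /= dotrD dotrZ dotr_delta -expiD !mxE rmorphN /=; congr expi; ring.
Qed.

(** Averaging over all the directions of [y] leaves only the flat section of the
    fibre, with the Weil-Brezin coefficient as its scale. *)
Lemma taverages_lattice k tau m y : (0 < k)%N -> test_section k tau ->
  taverages k (enum 'I_n) tau (Defs.over R k m, y) =
  chary (- m) (Defs.over R k m, y) * weil_brezin tau m (Defs.over R k m).
Proof.
move=> k0 tt; have [st _] := tt.
rewrite (taverages_on_fibre _ (m := m)) //; last first.
  by rewrite /Defs.over scalerA mulfV ?scale1r // pnatr_eq0 -lt0n.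
congr (_ * _); rewrite weil_brezinE; apply: yavg_const.
  by apply: smoothM => //; exact: smooth_chary.
by move=> z j; rewrite diry_lat chary_periodic (section_y_periodic _ _ tt).
Qed.

End ParallelTransport.

(** * Polarized sections as combinations of the basis *)

Section PolarizedSections.
Variables (R : realType) (n k : nat).
Hypothesis k_gt0 : (0 < k)%N.
Notation V := ('rV[R]_n * 'rV[R]_n)%type.
Notation functional := ((V -> R[i]) -> R[i]).
Implicit Types (z : V) (g h tau : V -> R[i]) (m q : 'rV[int]_n) (s : functional).

Let k0 : (k%:R : R) != 0. Proof. by rewrite pnatr_eq0 -lt0n. Qed.

Lemma zrow_mulrn q (l : nat) : zrow R (q *+ l) = l%:R *: zrow R q.
Proof. by apply/rowP => i; rewrite !mxE mulmxnE rmorphMn /= mulr_natl. Qed.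

Lemma overD m q : Defs.over R k (m + q) = Defs.over R k m + Defs.over R k q.
Proof. by rewrite /Defs.over zrowD scalerDr. Qed.

Lemma over_mulrn q : Defs.over R k (q *+ k) = zrow R q.
Proof. by rewrite /Defs.over zrow_mulrn scalerA mulVf // scale1r. Qed.

(** The multiplier of the translation by [q] in x is the character of index
    [- k q]. *)
Lemma weil_brezin_shift tau m q x : test_section k tau ->
  weil_brezin tau (m + q *+ k) x = weil_brezin tau m (x - zrow R q).
Proof.
move=> tt; congr ccube_int; apply/funext => y.
have := test_section_lat q 0 (x - zrow R q, y) tt.
rewrite add_lat /= zrow0 addr0 subrK => ->.
rewrite zrowD zrow_mulrn dotrDl [dotr (_ *: _) _]dotrC dotrZ [dotr y _]dotrC.
by rewrite mulrA -expiD addrK.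
Qed.

Lemma residue_decomposition m : exists r : residues n k, exists q, m = rep r + q *+ k.
Proof.
pose a j := m 0 j.
have kz : (k : int) != 0 by case: (k) k_gt0.
have lt j : (`|(a j %% k)%Z| < k)%N.
  by rewrite -ltz_nat gez0_abs ?modz_ge0 // ltz_pmod.
exists [ffun j => Ordinal (lt j)], (\row_j (a j %/ k)%Z).
apply/rowP => j; rewrite !mxE ffunE /= mulmxnE mxE.
by rewrite gez0_abs ?modz_ge0 // addrC -mulr_natr natz -divz_eq.
Qed.

Lemma sigma_linear (r : residues n k) a t1 t2 : test_section k t1 -> test_section k t2 ->
  sigma r (fun z => a * t1 z + t2 z) = a * sigma r t1 + sigma r t2.
Proof.
move=> [s1 _] [s2 _]; rewrite /sigma weil_brezinD ?weil_brezinZ //.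
by apply: smoothM => //; exact: smooth_cst.
Qed.

Definition linear_on_sections s := forall a t1 t2, test_section k t1 -> test_section k t2 ->
  s (fun z => a * t1 z + t2 z) = a * s t1 + s t2.

Lemma linear_on0 s : linear_on_sections s -> s (fun=> 0) = 0.
Proof.
move=> ls; have t0 := @test_section0 R n k.
have := ls 1 _ _ t0 t0.
have -> : (fun z : V => 1 * 0 + 0) = (fun=> 0) :> (V -> R[i]).
  by apply/funext => z; rewrite mulr0 addr0.
by rewrite mul1r => /eqP; rewrite -subr_eq0 opprD addNKr oppr_eq0 => /eqP.
Qed.

Lemma linear_on_sum s (J : Type) (l : seq J) (c : J -> R[i]) (F : J -> V -> R[i]) :
  linear_on_sections s -> (forall j, test_section k (F j)) ->
  s (fun z => \sum_(j <- l) c j * F j z) = \sum_(j <- l) c j * s (F j).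
Proof.
move=> ls tF; elim: l => [|j l IH].
  rewrite big_nil -[RHS](linear_on0 ls); congr s.
  by apply/funext => z; rewrite big_nil.
rewrite big_cons -IH -ls //.
  by congr s; apply/funext => z; rewrite big_cons.
by apply: test_section_sum => i; exact: test_sectionZ.
Qed.

(** The constant functions are enough as coefficients of the vector field. *)
Lemma polarized_nabla s j tau : polarized k s -> test_section k tau ->
  s (nabla_y k j tau) = 0.
Proof.
move=> [[ls _] hs] tt.
pose a (i : 'I_n) : V -> R[i] := fun=> (i == j)%:R.
have := hs a (fun i => (torus_functionE _).2 (test_section_cst n _)) tau tt.
rewrite (bigD1 j) //= big1 ?addr0; last first.
  move=> i /negbTE ij.
  have E : (fun z => a i z * tau z) = (fun=> 0) by apply/funext => z; rewrite /a ij mul0r.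
  have N0 : nabla_y k i (fun _ : V => 0) = (fun=> 0).
    by apply/funext => z; rewrite /nabla_y /dy cderive_cst mulr0 addr0.
  by rewrite /mulD /nabla_yD E N0 linear_on0 // oppr0.
rewrite /mulD /nabla_yD /a eqxx => /eqP; rewrite oppr_eq0 => /eqP.
by under eq_fun do rewrite mul1r.
Qed.

Section Annihilated.
Variable s : functional.
Hypotheses (ls : linear_on_sections s)
  (ns : forall j tau, test_section k tau -> s (nabla_y k j tau) = 0).

(** Multiplication by the holonomy minus 1 is a covariant derivative, of the average
    over transport. *)
Lemma functional_theta j tau : test_section k tau -> s (fun z => theta k j z * tau z) = 0.
Proof.
move=> tt; rewrite -(ns j (test_section_taverage j tt)); congr s.
by apply/funext => z; rewrite nabla_taverage.
Qed.

(** The average over transport differs from the section by a covariant derivative. *)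
Lemma functional_taverage j tau : test_section k tau -> s (taverage k j tau) = s tau.
Proof.
move=> tt; have := ns j (test_section_tmoment j tt).
have -> : nabla_y k j (tmoment k j tau) = fun z => (-1) * tau z + taverage k j tau z.
  by apply/funext => z; rewrite nabla_tmoment.
rewrite ls //; last exact: test_section_taverage.
by rewrite mulN1r addrC => /eqP; rewrite subr_eq0 => /eqP.
Qed.

Lemma functional_taverages l tau : test_section k tau -> s (taverages k l tau) = s tau.
Proof.
move=> tt; elim: l => [//|j l IH] /=.
by rewrite functional_taverage //; exact: test_section_taverages.
Qed.

(** Averaged over transport, the section is zero on all the fibres [x = m / k],
    because its coefficients there are. It is then a combination of multiples of the
    [theta k j], and these are annihilated. *)
Lemma functional_kernel tau : test_section k tau ->
  (forall r : residues n k, sigma r tau = 0) -> s tau = 0.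
Proof.
move=> tt h0; rewrite -(functional_taverages (enum 'I_n) tt).
have tT := test_section_taverages (enum 'I_n) tt.
have [h [th E]] : in_ideal k k (taverages k (enum 'I_n) tau).
  apply: division_theorem => // m y.
  rewrite -/(Defs.over R k m) taverages_lattice //.
  have [r [q ->]] := residue_decomposition m.
  by rewrite (weil_brezin_shift _ _ _ tt) overD over_mulrn addrK -/(sigma r tau) h0 mulr0.
have -> : taverages k (enum 'I_n) tau = fun z => \sum_j 1 * (theta k j z * h j z).
  by apply/funext => z; rewrite E; apply: eq_bigr => j _; rewrite mul1r.
rewrite (linear_on_sum _ (fun=> 1) (F := fun j z => theta k j z * h j z)) //.
  by rewrite big1 // => j _; rewrite functional_theta ?mulr0.
move=> j; apply: test_sectionM => //; exact: test_section_theta.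
Qed.

End Annihilated.

(** Linear algebra: a functional that vanishes on a common kernel of finitely many
    others is a combination of them. One functional is removed at a time, after
    subtraction of its multiple that matches a vector dual to it. *)
Lemma span_of_kernel (I : eqType) (l : seq I) (e : I -> functional) s : uniq l ->
  (forall i, linear_on_sections (e i)) -> linear_on_sections s ->
  (forall tau, test_section k tau -> (forall i, i \in l -> e i tau = 0) -> s tau = 0) ->
  exists c : I -> R[i], forall tau, test_section k tau -> s tau = \sum_(i <- l) c i * e i tau.
Proof.
move=> ul le; elim: l s ul => [|i l IH] s.
  move=> _ ls hs; exists (fun=> 0) => tau tt; rewrite big_nil; exact: hs.
rewrite cons_uniq => /andP[il ul] ls hs.
have extend a c tau : \sum_(j <- i :: l) (if j == i then a else c j) * e j tau =
    a * e i tau + \sum_(j <- l) c j * e j tau.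
  rewrite big_cons eqxx; congr (_ + _); apply: eq_big_seq => j jl.
  by case: eqP => // ji; move: il; rewrite -ji jl.
have [h|] := pselect (forall tau, test_section k tau ->
    (forall j, j \in l -> e j tau = 0) -> e i tau = 0).
  have [|c hc] := IH s ul ls.
    by move=> tau tt hl; apply: hs => // j; rewrite inE => /predU1P[->|]; [exact: h|exact: hl].
  by exists (fun j => if j == i then 0 else c j) => tau tt; rewrite extend mul0r add0r hc.
move=> /existsNP[t /not_implyP[tt /not_implyP[hl /eqP hi]]].
pose b := s t / e i t.
have [||c hc] := IH (fun tau => s tau - b * e i tau) ul.
- by move=> a t1 t2 h1 h2; rewrite ls // le //; ring.
- move=> tau ttau htau.
  have h0 : s (fun z => (- (e i tau / e i t)) * t z + tau z) = 0.
    apply: hs; first exact: test_section_lin.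
    move=> j; rewrite inE le // => /predU1P[->|jl]; first by field.
    by rewrite (hl j jl) (htau j jl) mulr0 addr0.
  by rewrite ls // in h0; rewrite -[RHS]h0 /b; ring.
exists (fun j => if j == i then b else c j) => tau ttau.
by rewrite extend -hc // addrC subrK.
Qed.

(** The coordinates are defined by choice; they exist because [s] vanishes where all
    the basis functionals do. *)
Lemma coordsP s tau : polarized k s -> test_section k tau ->
  s tau = \sum_(r : residues n k) coords k s r * sigma r tau.
Proof.
move=> ps; have [[ls _] _] := ps.
suff : [set c : {ffun residues n k -> R[i]} |
    forall tau, test_section k tau -> s tau = \sum_r c r * sigma r tau] (coords k s).
  by move=> /(_ tau).
apply: xgetPex.
have ns j t : test_section k t -> s (nabla_y k j t) = 0 by exact: polarized_nabla.
have [||c hc] := @span_of_kernel _ (enum {: residues n k}) (@sigma R n k) s (enum_uniq _) _ ls.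
- by move=> r a t1 t2; exact: sigma_linear.
- move=> t tt h; apply: (functional_kernel ls ns tt) => r.
  by apply: h; rewrite mem_enum.
exists [ffun r => c r] => t tt; rewrite hc // big_enum /=.
by apply: eq_bigr => r _; rewrite ffunE.
Qed.

Lemma foldr_dx_bounded N tau : test_section k tau -> exists2 B : R, 0 <= B &
  forall t z, (size t <= N)%N -> normc (foldr (@dx R n) tau t z) <= B.
Proof.
elim: N tau => [|N IH] tau tt.
  have [B hB] := section_bounded tt.
  exists B; first by apply: le_trans (hB 0); exact: normc_ge0.
  by case.
have [B hB] := section_bounded tt.
have B0 : 0 <= B by apply: le_trans (hB 0); exact: normc_ge0.
have /choice[C hC] : forall i, exists C : R, 0 <= C /\
    forall t z, (size t <= N)%N -> normc (foldr (@dx R n) (dx i tau) t z) <= C.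
  by move=> i; have [C C0 hC] := IH _ (test_section_dx i tt); exists C.
have S0 (P : pred 'I_n) : 0 <= \sum_(i | P i) C i by apply: sumr_ge0 => i _; have [] := hC i.
exists (B + \sum_i C i); first exact: addr_ge0.
move=> t z; elim/last_ind: t => [_|t i _]; first by rewrite (le_trans (hB z)) // lerDl.
rewrite size_rcons ltnS foldr_rcons => ht.
apply: (le_trans ((hC i).2 _ _ ht)).
by rewrite (bigD1 i) //= addrCA lerDl addr_ge0.
Qed.

(** Every index is a residue up to a multiple of [k], and such a multiple only
    translates the coefficient. The supremum is one of a bounded set because the
    derivatives of a section along x are sections. *)
Lemma foldr_le_test_norm N tau m t x : test_section k tau -> (size t <= N)%N ->
  normc (weil_brezin (foldr (@dx R n) tau t) m x) <= test_norm k N tau.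
Proof.
move=> tt ht; have [st _] := tt; have [r [q ->]] := residue_decomposition m.
rewrite weil_brezin_shift; last exact: test_section_foldr_dx.
apply: sup_upper_bound; last first.
  exists r, t, (x - zrow R q); split=> //.
  by rewrite foldr_cderive_weil_brezin.
split; first by eexists; exists r, [::], 0; split.
have [B B0 hB] := foldr_dx_bounded N tt.
exists (2 * B) => _ [r' [t' [x' [ht' ->]]]].
rewrite foldr_cderive_weil_brezin //.
apply: (weil_brezin_le _ _ (test_section_foldr_dx t' tt)) => z; exact: hB.
Qed.

Lemma test_norm_ge0 N tau : test_section k tau -> 0 <= test_norm k N tau.
Proof.
move=> tt; apply: le_trans (foldr_le_test_norm (t := [::]) 0 0 tt (leq0n N)).
exact: normc_ge0.
Qed.

End PolarizedSections.

(** * Iterated derivatives and Taylor expansions *)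

Section IteratedDerivatives.
Variables (R : realType) (n : nat) (W : normedModType R) (e : 'I_n -> W).
Implicit Types (g h : W -> R[i]) (t : seq 'I_n).

(** The derivatives are taken from the head of the list onwards, the order in which
    transposition of the weak derivatives produces them. *)
Definition pder t g : W -> R[i] := foldl (fun g i => cderive (e i) g) g t.

Lemma smooth_pder t g : smooth g -> smooth (pder t g).
Proof. by elim: t g => //= i t IH g sg; apply: IH; exact: smooth_cderive. Qed.

Lemma pderD t g h z : smooth g -> smooth h ->
  pder t (fun z => g z + h z) z = pder t g z + pder t h z.
Proof.
elim: t g h => //= i t IH g h sg sh; rewrite -IH; try exact: smooth_cderive.
by congr (pder t _ z); apply/funext => y; rewrite cderiveD.
Qed.

Lemma pderZ t (a : R[i]) g z : smooth g -> pder t (fun z => a * g z) z = a * pder t g z.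
Proof.
elim: t g => //= i t IH g sg; rewrite -IH; last exact: smooth_cderive.
by congr (pder t _ z); apply/funext => y; rewrite cderiveZ.
Qed.

Fixpoint splits t : seq (seq 'I_n * seq 'I_n) :=
  if t is i :: t' then
    [seq (i :: a.1, a.2) | a <- splits t'] ++ [seq (a.1, i :: a.2) | a <- splits t']
  else [:: ([::], [::])].

Lemma size_splits t a : a \in splits t -> (size a.2 <= size t)%N.
Proof.
elim: t a => [|i t IH] a /=; first by rewrite inE => /eqP ->.
rewrite mem_cat => /orP[] /mapP[b hb ->] /=; last by rewrite ltnS IH.
by rewrite ltnW // ltnS IH.
Qed.

Lemma leibniz t g h z : smooth g -> smooth h ->
  pder t (fun z => g z * h z) z = \sum_(a <- splits t) pder a.1 g z * pder a.2 h z.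
Proof.
elim: t g h => [|i t IH] g h sg sh; first by rewrite big_seq1.
have sg' := smooth_cderive (e i) sg; have sh' := smooth_cderive (e i) sh.
rewrite big_cat !big_map /= -!IH // -pderD; try exact: smoothM.
by congr (pder t _ z); apply/funext => y; rewrite cderiveM.
Qed.

Lemma iter_cderive_linear r v (I : Type) (s : seq I) (c : I -> R[i]) (F : I -> W -> R[i]) z :
  (forall i, smooth (F i)) ->
  iter r (cderive v) (fun z => \sum_(i <- s) c i * F i z) z =
  \sum_(i <- s) c i * iter r (cderive v) (F i) z.
Proof.
elim: r F z => [//|r IH] F z sF; rewrite iterSr.
have -> : cderive v (fun z => \sum_(i <- s) c i * F i z) =
    fun z => \sum_(i <- s) c i * cderive v (F i) z.
  apply/funext => y; rewrite cderive_sum.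
    by apply: eq_bigr => i _; rewrite cderiveZ.
  by move=> i; apply: smoothM => //; exact: smooth_cst.
rewrite IH; first by apply: eq_bigr => i _; rewrite -iterSr.
by move=> i; exact: smooth_cderive.
Qed.

Lemma sum_tuple_cons (V : nmodType) r (F : seq 'I_n -> V) :
  \sum_(t : r.+1.-tuple 'I_n) F t = \sum_i \sum_(t : r.-tuple 'I_n) F (i :: t).
Proof.
rewrite pair_big /= (reindex (fun p : 'I_n * r.-tuple 'I_n => [tuple of p.1 :: p.2])) //=.
exists (fun t : r.+1.-tuple 'I_n => (thead t, [tuple of behead t])).
  by move=> [i t] _ /=; congr (_, _); apply: val_inj.
by move=> t _; rewrite [in RHS](tuple_eta t); apply: val_inj.
Qed.

(** The expansion runs over all lists of indices rather than over multi-indices, as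
    in the definition of the operators. *)
Lemma iter_cderive_frame r v c g z : frame e c -> smooth g ->
  iter r (cderive v) g z =
  \sum_(t : r.-tuple 'I_n) \prod_(j <- t) Complex (c j v) 0 * pder t g z.
Proof.
move=> hf; elim: r g z => [|r IH] g z sg.
  rewrite (big_pred1 [tuple]) /=; first by rewrite big_nil mul1r.
  by move=> t; rewrite /= (tuple0 t) /= eqxx.
rewrite iterSr.
have -> : cderive v g = fun z => \sum_i Complex (c i v) 0 * cderive (e i) g z.
  by apply/funext => y; exact: cderive_frame.
have sd i := smooth_cderive (e i) sg.
rewrite iter_cderive_linear //.
rewrite (sum_tuple_cons r (fun t => \prod_(j <- t) Complex (c j v) 0 * pder t g z)).
apply: eq_bigr => i _; rewrite IH // mulr_sumr; apply: eq_bigr => t _.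
by rewrite big_cons mulrA.
Qed.

End IteratedDerivatives.

Section Taylor.
Variables (R : realType) (W : normedModType R).

Lemma is_derive_sum_ord (N : nat) (f f' : nat -> R -> R) (t : R) :
  (forall r, is_derive t (1:R) (f r) (f' r t)) ->
  is_derive t (1:R) (fun t => \sum_(r < N) f r t) (\sum_(r < N) f' r t).
Proof.
move=> h; elim: N => [|N IH].
  rewrite big_ord0; have -> : (fun t => \sum_(r < 0) f r t) = cst 0.
    by apply/funext => y; rewrite big_ord0.
  exact: (is_derive_cst (0 : R) t (1 : R)).
have -> : (fun t => \sum_(r < N.+1) f r t) = (fun t => \sum_(r < N) f r t) + f N.
  by apply/funext => y; rewrite big_ord_recr.
by rewrite big_ord_recr /=; exact: is_deriveD.
Qed.

Lemma is_derive_monomial (r : nat) (t : R) :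
  is_derive t (1:R) (fun t => t ^+ r.+1 / r.+1`!%:R) (t ^+ r / r`!%:R).
Proof.
have h := is_deriveX r.+1 (is_derive_id t (1:R)).
have -> : (fun t : R => t ^+ r.+1 / r.+1`!%:R) = (r.+1`!%:R)^-1 *: ((@id R) ^+ r.+1).
  apply/funext => y; rewrite mulrC -[RHS]/(_ * ((@id R) ^+ r.+1) y); congr (_ * _).
  by rewrite exprfctE.
have h2 := is_deriveZ (r.+1`!%:R)^-1 h.
apply: is_derive_eq h2 _.
have f0 : (r`!%:R : R) != 0 by rewrite pnatr_eq0 -lt0n fact_gt0.
have a0 : (r.+1%:R : R) != 0 by rewrite pnatr_eq0.
rewrite /GRing.scale /= mulr1 factS natrM; move: (r`!%:R) (r.+1%:R) f0 a0 => f a f0 a0.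
by field; rewrite f0 a0.
Qed.

(** Induction on the order: the derivative in [t] of the remainder is the remainder
    of lower order for the directional derivative, so the same bound holds after
    integration over a time at most 1. *)
Lemma taylor_real N (F : W -> R) (x v : W) (B : R) : rsmooth F ->
  (forall y, `|iter N (fun g z => 'D_v g z) F y| <= B) ->
  forall t, 0 <= t <= 1 ->
  `|F (x + t *: v) - \sum_(r < N) t ^+ r / r`!%:R * iter r (fun g z => 'D_v g z) F x| <= B.
Proof.
elim: N F B => [|N IH] F B sF hB t ht; first by rewrite big_ord0 subr0; exact: hB.
pose D (g : W -> R) z := 'D_v g z.
pose a r := iter r D F x.
pose G t := F (x + t *: v) - (a 0%N + \sum_(r < N) t ^+ r.+1 / r.+1`!%:R * a r.+1).
pose G' t := 'D_v F (x + t *: v) - \sum_(r < N) t ^+ r / r`!%:R * a r.+1.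
have dG u : is_derive u (1:R) G (G' u).
  have d1 := is_derive_ray x v u sF.
  have d2 : is_derive u (1:R) (fun t => \sum_(r < N) t ^+ r.+1 / r.+1`!%:R * a r.+1)
      (\sum_(r < N) u ^+ r / r`!%:R * a r.+1).
    apply: (@is_derive_sum_ord N (fun r t => t ^+ r.+1 / r.+1`!%:R * a r.+1)
      (fun r t => t ^+ r / r`!%:R * a r.+1)) => r.
    have d := is_deriveZ (a r.+1) (is_derive_monomial r u).
    have -> : (fun t : R => t ^+ r.+1 / r.+1`!%:R * a r.+1) =
      a r.+1 *: (fun t : R => t ^+ r.+1 / r.+1`!%:R).
      by apply/funext => y; rewrite /= [LHS]mulrC.
    by apply: is_derive_eq d _; rewrite [LHS]mulrC.
  have d3 := is_deriveD (is_derive_cst (a 0%N) u (1:R)) d2.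
  have d4 := is_deriveB d1 d3.
  by apply: is_derive_eq d4 _; rewrite add0r.
have G0 : G 0 = 0.
  rewrite /G scale0r addr0 big1 ?addr0 ?subrr // => r _.
  by rewrite expr0n /= !mul0r.
have hG' u : 0 <= u <= 1 -> `|G' u| <= B.
  move=> hu.
  have E r y : iter r D (fun z => 'D_v F z) y = iter r.+1 D F y by rewrite iterSr.
  have hB' y : `|iter N D (fun z => 'D_v F z) y| <= B by rewrite E.
  have := IH _ B (rsmooth_derive v sF) hB' u hu.
  congr (`|_ - _| <= B); apply: eq_bigr => r _; congr (_ * _); exact: E.
have -> : F (x + t *: v) - \sum_(r < N.+1) t ^+ r / r`!%:R * iter r D F x = G t.
  by rewrite /G big_ord_recl /= expr0 fact0 divr1 mul1r.
case/andP: ht; rewrite le_eqVlt => /predU1P[<-|t0] t1.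
  by rewrite G0 normr0; apply: le_trans (hB x); exact: normr_ge0.
have cG : {within `[0, t], continuous G}.
  apply: continuous_subspaceT => u; apply: differentiable_continuous.
  by apply/derivable1_diffP; have [] := dG u.
have [xi hxi] := MVT t0 (fun u _ => dG u) cG.
rewrite G0 !subr0 => ->; move: hxi; rewrite in_itv /= => /andP[x0 xt].
rewrite normrM; apply: (@le_trans _ _ (`|G' xi| * 1)).
  by rewrite ler_wpM2l // ger0_norm // ltW.
by rewrite mulr1; apply: hG'; rewrite ltW //= (le_trans (ltW xt)).
Qed.

Lemma re_iter_cderive r (v : W) (h : W -> R[i]) :
  re_fun (iter r (cderive v) h) = iter r (fun g z => 'D_v g z) (re_fun h).
Proof. by elim: r => //= r <-. Qed.

Lemma im_iter_cderive r (v : W) (h : W -> R[i]) :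
  im_fun (iter r (cderive v) h) = iter r (fun g z => 'D_v g z) (im_fun h).
Proof. by elim: r => //= r <-. Qed.

Lemma inv_natrC (m : nat) : (m%:R : R[i])^-1 = Complex (m%:R^-1) 0.
Proof.
rewrite -[RHS]/((m%:R^-1)%:C%C) (fmorphV (real_complex R)); congr (_^-1).
by rewrite rmorph_nat.
Qed.

Lemma taylor_complex N (h : W -> R[i]) (x v : W) (B : R) : smooth h ->
  (forall y, normc (iter N (cderive v) h y) <= B) ->
  normc (h (x + v) - \sum_(0 <= r < N) (r`!%:R)^-1 * iter r (cderive v) h x) <= 2 * B.
Proof.
move=> /smoothP[s1 s2] hB; rewrite big_mkord.
have h01 : 0 <= (1 : R) <= 1 by rewrite ler01 lexx.
apply: (le_trans (normc_le_ReIm _)); rewrite mulr2n mulrDl mul1r; apply: lerD.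
  have h1 y : `|iter N (fun g z => 'D_v g z) (re_fun h) y| <= B.
    by rewrite -re_iter_cderive; exact: le_trans (Re_le_normc _) (hB y).
  have := taylor_real x s1 h1 h01; rewrite Re_add Re_opp Re_sum scale1r.
  congr (`|_ - _| <= B); apply: eq_bigr => r _.
  by rewrite expr1n div1r -re_iter_cderive Re_mul inv_natrC /= mul0r subr0.
have h2 y : `|iter N (fun g z => 'D_v g z) (im_fun h) y| <= B.
  by rewrite -im_iter_cderive; exact: le_trans (Im_le_normc _) (hB y).
have := taylor_real x s2 h2 h01; rewrite Im_add Im_opp Im_sum scale1r.
congr (`|_ - _| <= B); apply: eq_bigr => r _.
by rewrite expr1n div1r -im_iter_cderive Im_mul inv_natrC /= mul0r addr0.
Qed.

End Taylor.

(** * The estimate *)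

Section ToeplitzEstimate.
Variables (R : realType) (n : nat).
Notation V := ('rV[R]_n * 'rV[R]_n)%type.
Notation functional := ((V -> R[i]) -> R[i]).
Implicit Types (f g tau : V -> R[i]) (m p q : 'rV[int]_n) (t : seq 'I_n).

Let axis (i : 'I_n) : 'rV[R]_n := delta_mx 0 i.
Let xpder := pder (@dirx R n).

Lemma xpderE t g : xpder t g = foldr (@dx R n) g (rev t).
Proof. by rewrite -[X in xpder X _]revK /xpder /pder foldl_rev. Qed.

Lemma test_section_xpder k t g : test_section k g -> test_section k (xpder t g).
Proof. by rewrite xpderE; exact: test_section_foldr_dx. Qed.

Lemma pder_weil_brezin tau m t : smooth tau ->
  pder axis t (weil_brezin tau m) = weil_brezin (xpder t tau) m.
Proof.
by rewrite /xpder; elim: t tau => //= i t IH tau st; rewrite cderive_weil_brezin // IH //;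
  exact: smooth_cderive.
Qed.

Lemma frame_axis : frame axis (fun i (u : 'rV[R]_n) => u 0 i).
Proof.
split=> [u|i u|i a u v]; first by rewrite [LHS]row_sum_delta.
  exact: rV_entry_le.
by rewrite !mxE.
Qed.

Lemma foldr_nabla_xD (s : functional) t g :
  foldr (@nabla_xD R n) s t g = (-1) ^+ size t * s (xpder t g).
Proof.
rewrite /xpder; elim: t g => [|i t IH] g /=; first by rewrite mul1r.
by rewrite /nabla_xD IH exprS mulN1r mulNr.
Qed.

Definition fibre_term f tau m p : 'rV[R]_n -> R[i] :=
  fun x => fourier_y f p x * weil_brezin tau (m + p) x.

Definition term_on_sigma f k (r : nat) (m : residues n k) tau : R[i] :=
  (r`!%:R)^-1 * (Complex 0 (2 * pi * k%:R)^-1) ^+ r *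
    \sum_(t : r.-tuple 'I_n)
      (-1) ^+ r * sigma m (xpder t (fun z => foldr (@dy R n) f t z * tau z)).

Section Estimate.
Variables (f : V -> R[i]) (tf : test_section 0 f).

Let sf : smooth f. Proof. by have [] := tf. Qed.

Lemma smooth_fourier_y p : smooth (fourier_y f p).
Proof. by rewrite fourier_y_weil_brezin; exact: smooth_weil_brezin. Qed.

Lemma smooth_fibre_term k tau m p : test_section k tau -> smooth (fibre_term f tau m p).
Proof.
by move=> [st _]; apply: smoothM; [exact: smooth_fourier_y|exact: smooth_weil_brezin].
Qed.

Definition yder t : V -> R[i] := foldr (@dy R n) f t.

Lemma test_section_yder t : test_section 0 (yder t).
Proof. exact: test_section_foldr_dy. Qed.

Lemma pder_fibre_term k tau m p t x : test_section k tau ->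
  pder axis t (fibre_term f tau m p) x =
  \sum_(a <- splits t) pder axis a.1 (fourier_y f p) x * weil_brezin (xpder a.2 tau) (m + p) x.
Proof.
move=> [st _]; rewrite leibniz; [|exact: smooth_fourier_y|exact: smooth_weil_brezin].
by apply: eq_bigr => a _; rewrite pder_weil_brezin.
Qed.

Lemma fourier_y_xpder_yder p a t x : fourier_y (xpder a (yder t)) p x =
  \prod_(j <- t) Complex 0 (2 * pi * (p 0 j)%:~R) * pder axis a (fourier_y f p) x.
Proof.
have [sy _] := test_section_yder t.
rewrite fourier_y_weil_brezin -pder_weil_brezin // -fourier_y_weil_brezin.
rewrite -pderZ; last exact: smooth_fourier_y.
by congr (pder axis a _ x); apply/funext => y; exact: fourier_y_foldr_dy.
Qed.

(** The Leibniz rule reduces both sides to products of derivatives of [f] and of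
    [tau], whose Weil-Brezin coefficients are given by [weil_brezin_product]. The
    derivatives of [f] in [y] act on its coefficients as the factors [2 pi i p_j]. *)
Lemma hasum_sigma_xpder k (m : residues n k) tau t : test_section k tau ->
  hasum (fun p => \prod_(j <- t) Complex 0 (2 * pi * (p 0 j)%:~R) *
      pder axis t (fibre_term f tau (rep m) p) (Defs.over R k (rep m)))
    (sigma m (xpder t (fun z => yder t z * tau z))).
Proof.
move=> tt; have [st _] := tt; have [sy _] := test_section_yder t.
set x := Defs.over R k (rep m).
have -> : sigma m (xpder t (fun z => yder t z * tau z)) =
    \sum_(a <- splits t)
      weil_brezin (fun z => xpder a.1 (yder t) z * xpder a.2 tau z) (rep m) x.
  rewrite /sigma -/x.
  have -> : xpder t (fun z => yder t z * tau z) =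
      fun z => \sum_(a <- splits t) xpder a.1 (yder t) z * xpder a.2 tau z.
    by apply/funext => z; rewrite /xpder leibniz.
  rewrite weil_brezin_sum // => a.
  by apply: smoothM; exact: smooth_pder.
have h (a : seq 'I_n * seq 'I_n) := @weil_brezin_product R n k _ _ (rep m) x
  (test_section_xpder a.1 (test_section_yder t)) (test_section_xpder a.2 tt).
apply: eq_hasum (hasum_sum (splits t) h) => p.
rewrite (pder_fibre_term _ _ _ _ tt) mulr_sumr; apply: eq_bigr => a _.
by rewrite fourier_y_xpder_yder mulrA.
Qed.

(** The factor [i / (2 pi k)] of the operator, the sign of transposition and the
    factor [2 pi i p_j] of the derivative in [y_j] combine to [p_j / k]: the
    components of the vector that joins the points [m / k] and [(m + p) / k]. *)
Lemma prod_scaled_frequencies k p t : (0 < k)%N ->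
  (Complex 0 (2 * pi * k%:R)^-1) ^+ size t * (-1) ^+ size t *
    \prod_(j <- t) Complex 0 (2 * pi * (p 0 j)%:~R) =
  \prod_(j <- t) Complex (Defs.over R k p 0 j) 0 :> R[i].
Proof.
move=> k0; have kn0 : (k%:R : R) != 0 by rewrite pnatr_eq0 -lt0n.
have pn0 : (pi : R) != 0 by rewrite gt_eqF // pi_gt0.
elim: t => [|j t IH] /=; first by rewrite !big_nil !expr0 !mulr1.
rewrite !big_cons -IH !exprS; set A := _ ^+ size t; set B := _ ^+ size t; set P := \prod_(_ <- _) _.
have -> : Complex (Defs.over R k p 0 j) 0 =
    Complex 0 (2 * pi * k%:R)^-1 * -1 * Complex 0 (2 * pi * (p 0 j)%:~R).
  apply: complex_ext; rewrite ?Re_mul ?Im_mul ?Re_mul ?Im_mul ?Re_opp ?Im_opp /= ?mxE; last by ring.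
  by move: (_%:~R) (pi : R) pn0 => a b b0; field; rewrite kn0 b0.
by ring.
Qed.

(** Summed over all lists of indices, the products of the components [p_j / k] with
    derivatives form the power of the directional derivative along [p / k]. *)
Lemma hasum_term k (m : residues n k) tau r : (0 < k)%N -> test_section k tau ->
  hasum (fun p => (r`!%:R)^-1 *
      iter r (cderive (Defs.over R k p)) (fibre_term f tau (rep m) p) (Defs.over R k (rep m)))
    (term_on_sigma f r m tau).
Proof.
move=> k0 tt; set x := Defs.over R k (rep m).
pose c : R[i] := (r`!%:R)^-1 * (Complex 0 (2 * pi * k%:R)^-1) ^+ r.
have h (t : r.-tuple 'I_n) := hasumZ ((-1) ^+ r) (hasum_sigma_xpder m t tt).
have := hasumZ c (hasum_sum (index_enum _) h).
apply: eq_hasum => p.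
rewrite (iter_cderive_frame _ _ _ frame_axis (smooth_fibre_term _ _ tt)).
rewrite -[LHS]mulrA; congr (_ * _); rewrite mulr_sumr; apply: eq_bigr => t _.
by rewrite -(prod_scaled_frequencies _ _ k0) size_tuple !mulrA.
Qed.

(** The components [p_j / k] are absorbed by derivatives of [f] in [y], which leaves
    the powers of [1 / k] and coefficients of smooth functions; these decay like the
    weight, uniformly in x. *)
Lemma remainder_decay N : exists2 K : R, 0 <= K &
  forall k m p tau x, (0 < k)%N -> test_section k tau ->
    normc (iter N (cderive (Defs.over R k p)) (fibre_term f tau m p) x) <=
    K * test_norm k N tau * (k%:R ^+ N)^-1 * weight R p.
Proof.
have /choice[C hC] : forall ta : seq 'I_n * seq 'I_n, exists C : R, 0 <= C /\
    forall p x, normc (fourier_y (xpder ta.2 (yder ta.1)) p x) <= C * weight R p.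
  move=> ta.
  by have [C C0 hC] := fourier_y_decay (test_section_xpder ta.2 (test_section_yder ta.1)); exists C.
have C0 ta : 0 <= C ta by have [] := hC ta.
pose S t := \sum_(a <- splits t) C (t, a.1).
have S0 t : 0 <= S t by apply: sumr_ge0.
exists (\sum_(t : N.-tuple 'I_n) S t); first exact: sumr_ge0.
move=> k m p tau x k0 tt; have [st _] := tt.
have kp : 0 < (k%:R : R) by rewrite ltr0n.
rewrite (iter_cderive_frame _ _ _ frame_axis (smooth_fibre_term _ _ tt)).
apply: (le_trans (le_normc_sum _ _ _)).
rewrite !mulr_suml; apply: ler_sum => t _.
rewrite (pder_fibre_term _ _ _ _ tt) mulr_sumr.
apply: (le_trans (le_normc_sum _ _ _)).
rewrite /S !mulr_suml big_seq [leRHS]big_seq; apply: ler_sum => a ha.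
rewrite mulrA normcM.
have hT : normc (weil_brezin (xpder a.2 tau) (m + p) x) <= test_norm k N tau.
  rewrite xpderE; apply: foldr_le_test_norm => //.
  by rewrite size_rev (leq_trans (size_splits ha)) // size_tuple.
(* The derivatives in [a.1] fall on the coefficient of [f], those in [a.2] on the one
   of [tau]. As [1 <= 2 pi], the constants left by the absorbed frequencies are at
   most 1. *)
have hP : normc (\prod_(j <- t) Complex (Defs.over R k p 0 j) 0 * pder axis a.1 (fourier_y f p) x) <=
    C (tval t, a.1) * weight R p * (k%:R ^+ N)^-1.
  rewrite -(prod_scaled_frequencies _ _ k0) size_tuple -mulrA -fourier_y_xpder_yder.
  rewrite !normcM !normcX normcN normc1 expr1n mulr1 normc_imag mulrC.
  apply: ler_pM; rewrite ?normc_ge0 ?exprn_ge0 //; first by have [_] := hC (tval t, a.1); apply.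
  rewrite normfV -exprVn lerXn2r ?nnegrE ?invr_ge0 ?normr_ge0 ?ler0n //.
  have h1 : 1 <= 2 * (pi : R) by have := pi_ge2 R; lra.
  rewrite lef_pV2 ?posrE // ?normr_gt0 ?mulf_neq0 ?gt_eqF ?pi_gt0 //.
  rewrite gtr0_norm ?mulr_gt0 ?pi_gt0 //.
  by rewrite -[leLHS]mul1r ler_pM2r.
apply: (le_trans (ler_pM (normc_ge0 _) (normc_ge0 _) hP hT)).
by rewrite le_eqVlt; apply/orP; left; apply/eqP; ring.
Qed.

(** The expansion of Taylor from [m / k] to [(m + p) / k] is applied to each summand
    of the operator, and the remainders are summed with the weights. *)
Lemma sigma_estimate N : exists2 K : R, 0 <= K &
  forall k (m : residues n k) tau, (0 < k)%N -> test_section k tau ->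
    normc (toeplitz_sigma f m tau - \sum_(0 <= r < N) term_on_sigma f r m tau) <=
    K * test_norm k N tau * (k%:R ^+ N)^-1.
Proof.
have [K K0 hK] := remainder_decay N.
(* The factor 2 is the one of [taylor_complex], and [6 ^+ n] bounds the sum of the
   weights. *)
exists (2 * K * 6 ^+ n); first by rewrite !mulr_ge0 // exprn_ge0.
move=> k m tau k0 tt; have [st _] := tt.
have w0 p : 0 <= weight R p by exact/ltW/weight_gt0.
set x := Defs.over R k (rep m).
pose F p := fibre_term f tau (rep m) p (Defs.over R k (rep m + p)).
have [L hL] : exists L, hasum F L.
  have [K1 K10 hK1] := fourier_y_decay tf; have [T hT] := section_bounded tt.
  apply: (@hasum_dominated _ _ (@weight R n) (6 ^+ n) F (K1 * (2 * T)) w0).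
    exact: weight_summable.
  move=> p; rewrite normcM mulrAC; apply: ler_pM; rewrite ?normc_ge0 //.
  exact: weil_brezin_le tt hT.
have -> : toeplitz_sigma f m tau = L by exact: csum_hasum.
have hD := hasumB hL (hasum_sum (index_iota 0 N) (fun r => hasum_term m r k0 tt)).
apply: (hasum_le hD) => B.
apply: (le_trans (le_normc_sum _ _ _)).
pose c := K * test_norm k N tau * (k%:R ^+ N)^-1.
have c0 : 0 <= c by rewrite !mulr_ge0 ?invr_ge0 ?exprn_ge0 ?test_norm_ge0.
apply: (@le_trans _ _ (\sum_(p <- B) (2 * c) * weight R p)).
  apply: ler_sum => p _; rewrite /F overD -mulrA.
  apply: taylor_complex; first exact: smooth_fibre_term tt.
  by move=> y; exact: hK.
rewrite -mulr_sumr; apply: (@le_trans _ _ (2 * c * 6 ^+ n)).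
  by apply: ler_wpM2l; [rewrite mulr_ge0|exact: weight_summable].
by rewrite le_eqVlt; apply/orP; left; apply/eqP; rewrite /c; ring.
Qed.

(** The operators act on the section through its coordinates, by transposition and
    [coordsP]. *)
Lemma toeplitz_term_coords k (s : functional) tau r : (0 < k)%N ->
  polarized k s -> test_section k tau ->
  toeplitz_term f r k s tau = \sum_(m : residues n k) coords k s m * term_on_sigma f r m tau.
Proof.
move=> k0 ps tt; rewrite /toeplitz_term /term_on_sigma.
under [RHS]eq_bigr do rewrite mulrCA mulr_sumr.
rewrite -mulr_sumr; congr (_ * _); rewrite exchange_big /=; apply: eq_bigr => t _.
rewrite /mulD foldr_nabla_xD size_tuple.
have tft : test_section k (fun z => yder t z * tau z).
  by apply: test_sectionM tt; exact: test_section_yder.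
rewrite (coordsP k0 ps (test_section_xpder t tft)) mulr_sumr.
by apply: eq_bigr => m _; rewrite mulrCA.
Qed.

End Estimate.

End ToeplitzEstimate.

Theorem theorem1p4 (R : realType) (n : nat)
    (f : 'rV[R]_n * 'rV[R]_n -> R[i]) (N : nat) (hf : smooth_on_torus f) :
  exists2 C : R, 0 < C &
    forall (k : nat) (s : ('rV[R]_n * 'rV[R]_n -> R[i]) -> R[i])
      (tau : 'rV[R]_n * 'rV[R]_n -> R[i]),
      (0 < k)%N -> polarized k s -> test_section k tau ->
      normc (toeplitz f k s tau - \sum_(0 <= r < N.+1) toeplitz_term f r k s tau)
        <= C * l1norm k s * test_norm k N.+1 tau * (k%:R ^+ N.+1)^-1.
Proof.
have tf := (torus_functionE f).1 hf.
have [K K0 hK] := sigma_estimate tf N.+1.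
(* [K] is only known to be nonnegative. *)
exists (K + 1); first by rewrite ltr_wpDl.
move=> k s tau k0 ps tt.
have -> : toeplitz f k s tau - \sum_(0 <= r < N.+1) toeplitz_term f r k s tau =
    \sum_m coords k s m * (toeplitz_sigma f m tau - \sum_(0 <= r < N.+1) term_on_sigma f r m tau).
  under [RHS]eq_bigr do rewrite mulrBr mulr_sumr.
  rewrite sumrB exchange_big /=; congr (_ - _); apply: eq_bigr => r _.
  exact: toeplitz_term_coords.
apply: (le_trans (le_normc_sum _ _ _)).
rewrite /l1norm -mulrA [K + 1 in leRHS]lock mulrAC mulr_sumr -lock; apply: ler_sum => m _.
rewrite normcM mulrC; apply: ler_wpM2r; first exact: normc_ge0.
apply: (le_trans (hK k m tau k0 tt)); rewrite -mulrA ler_wpM2r ?lerDl //.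
by rewrite mulr_ge0 ?invr_ge0 ?exprn_ge0 ?test_norm_ge0.
Qed.
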